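(* Let $(\mathcal X,Q,\pi)$ be an irreducible reversible finite Markov chain with generator $L$, let $\kappa\in\mathbb R$, assume $\mathrm{Ric}(\mathcal X,Q,\pi)\ge\kappa$ (entropic Ricci curvature bounded below by $\kappa$), and let $\lambda_1$ be the spectral gap of $L$. Then for every subset $A\subset\mathcal X$, $$\pi^+(\partial A)\ \ge\ \frac13\sqrt{Q_*}\,\min\Big(\frac{\lambda_1}{\sqrt{|\kappa|}},\sqrt{\lambda_1}\Big)\,\pi(A)\big(1-\pi(A)\big),$$ where $Q_*=\min\{Q(x,y):Q(x,y)>0\}$ and, for $\kappa=0$, the minimum is understood to be $\sqrt{\lambda_1}$.
   Context: Setting. $\mathcal X$ is a finite set with at least two points and $Q:\mathcal X\times\mathcal X\to[0,\infty)$ is a collection of transition rates with $Q(x,x)=0$, irreducible: any $x,y$ are joined by a sequence $x=x_1,\dots,x_n=y$ with $Q(x_i,x_{i+1})>0$. The generator is $L\psi(x)=\sum_{y}(\psi(y)-\psi(x))Q(x,y)$. $\pi$ is the unique (strictly positive) stationary probability measure, assumed reversible: $Q(x,y)\pi(x)=Q(y,x)\pi(y)$ for all $x,y$. Transport distance. $\mathcal P(\mathcal X)=\{\rho:\mathcal X\to[0,\infty): \sum_x\rho(x)\pi(x)=1\}$ is the set of probability densities. Let $\theta(s,t)=\int_0^1 s^{1-p}t^p\,dp$ (logarithmic mean) and $\hat\rho(x,y)=\theta(\rho(x),\rho(y))$. For $\rho_0,\rho_1\in\mathcal P(\mathcal X)$, $$\mathcal W(\rho_0,\rho_1)^2=\inf\Big\{\tfrac12\int_0^1\sum_{x,y}(\psi_t(x)-\psi_t(y))^2\hat\rho_t(x,y)Q(x,y)\pi(x)\,dt\Big\},$$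 the infimum being over absolutely continuous curves $\rho:[0,1]\to\mathcal P(\mathcal X)$ with endpoints $\rho_0,\rho_1$ and measurable $\psi:[0,1]\to\mathbb R^{\mathcal X}$ such that for a.e. $t$ and all $x$: $\frac{d}{dt}\rho_t(x)+\sum_y(\psi_t(y)-\psi_t(x))\hat\rho_t(x,y)Q(x,y)=0$. $\mathcal W$ is a metric on $\mathcal P(\mathcal X)$. Curvature. Let $\mathcal H(\rho)=\sum_x\pi(x)\rho(x)\log\rho(x)$ (with $0\log0=0$). A constant speed geodesic is a curve $(\rho_t)_{t\in[0,1]}$ with $\mathcal W(\rho_s,\rho_t)=|s-t|\mathcal W(\rho_0,\rho_1)$. $\mathrm{Ric}(\mathcal X,Q,\pi)\ge\kappa$ means that for every constant speed geodesic $(\rho_t)$ in $(\mathcal P(\mathcal X),\mathcal W)$ and $t\in[0,1]$: $\mathcal H(\rho_t)\le(1-t)\mathcal H(\rho_0)+t\mathcal H(\rho_1)-\frac\kappa2t(1-t)\mathcal W(\rho_0,\rho_1)^2$. $\lambda_1$ is the smallest non-zero eigenvalue of $-L$; $\pi^+(\partial A)=\sum_{x\in A,\,y\in A^c}Q(x,y)\pi(x)$ is the perimeter measure of $A$. *)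

(* Defs.v *)
From HB Require Import structures.
From mathcomp Require Import all_boot all_order all_algebra.
From mathcomp Require Import all_classical all_reals all_analysis.

Set Implicit Arguments.
Unset Strict Implicit.
Unset Printing Implicit Defensive.

Import Order.TTheory GRing.Theory Num.Theory.
Import numFieldNormedType.Exports.

Local Open Scope classical_set_scope.
Local Open Scope ring_scope.

Section MarkovChain.
Variables (R : realType) (X : finType).
Implicit Types (Q : X -> X -> R) (pi : X -> R).

Definition transition_rates Q : Prop :=
  (forall x y, 0 <= Q x y) /\ (forall x, Q x x = 0).

Definition irreducible Q : Prop :=
  forall x y, connect (fun a b => 0 < Q a b) x y.

Definition probability_weights pi : Prop :=
  (forall x, 0 <= pi x) /\ \sum_x pi x = 1.

Definition generator Q (psi : X -> R) (x : X) : R :=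
  \sum_y (psi y - psi x) * Q x y.

Definition stationary Q pi : Prop :=
  forall psi, \sum_x generator Q psi x * pi x = 0.

Definition reversible Q pi : Prop :=
  forall x y, Q x y * pi x = Q y x * pi y.

Definition density pi (rho : X -> R) : Prop :=
  (forall x, 0 <= rho x) /\ \sum_x rho x * pi x = 1.

(* In [powR], [0 `^ p = 0] for [p != 0] and [0 `^ 0 = 1]; the value at the
   endpoints of the integration interval is immaterial, so the mean vanishes as
   soon as [s = 0] or [t = 0]. *)
Definition log_mean (s t : R) : R :=
  \int[lebesgue_measure]_(p in `[0, 1]) (s `^ (1 - p) * t `^ p).

Definition edge_density (rho : X -> R) (x y : X) : R :=
  log_mean (rho x) (rho y).

Definition absolutely_continuous01 (f : R -> R) : Prop :=
  forall e : R, 0 < e -> exists2 d : R, 0 < d &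
    forall (n : nat) (a b : 'I_n -> R),
      (forall i, [/\ 0 <= a i, a i <= b i & b i <= 1]) ->
      (forall i j, i != j -> b i <= a j \/ b j <= a i) ->
      \sum_i (b i - a i) < d ->
      \sum_i `|f (b i) - f (a i)| < e.

(* Curves are functions on all of [R], of which only the restriction to
   [`[0, 1]] is constrained. Absolute continuity of a curve in [R^X] is
   coordinatewise absolute continuity. *)
Definition admissible Q pi (rho0 rho1 : X -> R)
    (rho psi : R -> X -> R) : Prop :=
  [/\ (forall t, t \in `[0, 1] -> density pi (rho t)),
      (forall x, absolutely_continuous01 (rho^~ x)),
      rho 0 = rho0 /\ rho 1 = rho1,
      (forall x, measurable_fun (`[0, 1] : set R) (psi^~ x : R -> R)) &
      {ae lebesgue_measure, forall t : R, t \in `[0, 1] -> forall x,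
        derivable (rho^~ x) t 1 /\
        derive1 (rho^~ x) t +
          \sum_y (psi t y - psi t x) * edge_density (rho t) x y * Q x y = 0}].

Definition action Q pi (rho psi : R -> X -> R) : \bar R :=
  ((2^-1)%:E * \int[lebesgue_measure]_(t in `[0%R, 1%R])
    (\sum_x \sum_y (psi t x - psi t y) ^+ 2 * edge_density (rho t) x y
                   * Q x y * pi x)%:E)%E.

Definition transport_dist Q pi (rho0 rho1 : X -> R) : \bar R :=
  sqrte (ereal_inf [set a | exists rho psi,
    admissible Q pi rho0 rho1 rho psi /\ a = action Q pi rho psi]).

(* [ln 0 = 0] in the library, but in any case [0 * ln 0 = 0]. *)
Definition entropy pi (rho : X -> R) : R :=
  \sum_x pi x * (rho x * ln (rho x)).

Definition constant_speed_geodesic Q pi (rho : R -> X -> R) : Prop :=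
  (forall t, t \in `[0, 1] -> density pi (rho t)) /\
  (forall s t, s \in `[0, 1] -> t \in `[0, 1] ->
    transport_dist Q pi (rho s) (rho t) =
    (`|s - t|%:E * transport_dist Q pi (rho 0%R) (rho 1%R))%E).

Definition entropic_Ric_ge Q pi (kappa : R) : Prop :=
  forall rho, constant_speed_geodesic Q pi rho ->
  forall t, t \in `[0, 1] ->
    ((entropy pi (rho t))%:E <=
     ((1 - t) * entropy pi (rho 0%R) + t * entropy pi (rho 1%R))%:E -
     (kappa / 2 * t * (1 - t))%:E *
       transport_dist Q pi (rho 0%R) (rho 1%R) ^+ 2)%E.

Definition eigenvalue_of (T : (X -> R) -> X -> R) (a : R) : Prop :=
  exists2 psi : X -> R, (exists x, psi x != 0) & forall x, T psi x = a * psi x.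

Definition is_least (S : set R) (m : R) : Prop := S m /\ lbound S m.

Definition spectral_gap Q (lambda1 : R) : Prop :=
  is_least [set a | a != 0 /\ eigenvalue_of (fun psi x => - generator Q psi x) a]
    lambda1.

Definition min_rate Q (Qmin : R) : Prop :=
  is_least [set q | 0 < q /\ exists x y, q = Q x y] Qmin.

Definition set_weight pi (A : {set X}) : R := \sum_(x in A) pi x.

Definition perimeter Q pi (A : {set X}) : R :=
  \sum_(x in A) \sum_(y | y \notin A) Q x y * pi x.

Definition isoperimetric_rate (kappa lambda1 : R) : R :=
  if kappa == 0 then Num.sqrt lambda1
  else Num.min (lambda1 / Num.sqrt `|kappa|) (Num.sqrt lambda1).

End MarkovChain.

(* Main.v *)
(** Near a density with positive coordinates, the geodesic equations
    (Hamilton's equations of half the squared gradient form) have local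
    solutions. To see that such a curve [r], with momentum [p], is a constant
    speed geodesic for a short time, one compares it with an arbitrary
    admissible curve by a calibration: a concave quadratic function of the
    density, tangent to [r], that satisfies the Hamilton-Jacobi inequality in a
    tube around [r]. Its value is below [-1] outside the tube, so its maximum
    with [-1] is a subsolution for every curve, including those that touch the
    boundary of the simplex. Convexity of the entropy along these short
    geodesics gives the Bochner inequality [kappa * grad_form <= hess_form].

    Along the heat flow [u], interpolating [grad_form (r s) (u (t - s))] by
    Bochner and integrating in [s] gives a reverse Poincare inequality, hence
    [|u t x - u t y| <= C / sqrt t] on every edge, with a density [r 0] that is
    almost concentrated on the two endpoints. For [u 0 = 1_A - 1/2], the mass
    that flows out of [A] up to time [T] is then at most
    [C * sqrt T * perimeter A], while the spectral gap forces it to be at least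
    [(1 - exp (- lambda1 T)) pi(A) (1 - pi(A))]; the theorem follows by taking
    [T = min (1 / (2 |kappa|)) (1 / lambda1)]. *)

From HB Require Import structures.
Require Import Defs.
From mathcomp Require Import all_boot all_order all_algebra.
From mathcomp Require Import all_classical all_reals all_analysis.
From mathcomp Require Import measurable_realfun ring lra.

Set Implicit Arguments.
Unset Strict Implicit.
Unset Printing Implicit Defensive.
Import Order.TTheory GRing.Theory Num.Theory.
Import numFieldNormedType.Exports.
Local Open Scope classical_set_scope.
Local Open Scope ring_scope.

(** * Calculus on the line *)

(** The curvature hypothesis speaks only about constant speed geodesics of a distance that is
    defined as an infimum, and it provides no such geodesic. They have to be produced, with their
    length bounded from both sides. The action of the flow gives the upper bound; the lower bound
    must hold against every admissible curve, whose potential is merely measurable and whose density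
    may vanish, so that the metric degenerates. Short times suffice because the Bochner inequality
    is infinitesimal.

    The edge estimate must involve [Q_*] but not the weights. When the density takes the same value
    at both endpoints, the logarithmic mean is this value, about [1 / (pi x + pi y)], while
    reversibility gives [Q x y * pi x >= Q_* (pi x + pi y) / 2]: the weights cancel.

    With [gam = 1 - 1/e], the gradient estimate costs [sqrt gam] and the spectral gap costs [gam].
    Since [gam * sqrt gam >= 17/36], three times this is at least [17/12 >= sqrt 2], and [sqrt 2] is
    the loss in the case [T = 1 / (2 k)]; hence the factor [1/3]. *)

Section Calculus.
Context {R : realType}.
Implicit Types (f g : R -> R) (a b t x : R).

Lemma is_derive_continuous f x (d : R) :
  is_derive x 1 f d -> {for x, continuous f}.
Proof.
by move=> [df _]; apply/differentiable_continuous/derivable1_diffP.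
Qed.

Lemma is_deriveD_fun f g x (df dg : R) :
  is_derive x 1 f df -> is_derive x 1 g dg ->
  is_derive x 1 (fun t => f t + g t) (df + dg).
Proof. exact: is_deriveD. Qed.

Lemma is_deriveB_fun f g x (df dg : R) :
  is_derive x 1 f df -> is_derive x 1 g dg ->
  is_derive x 1 (fun t => f t - g t) (df - dg).
Proof. exact: is_deriveB. Qed.

Lemma is_deriveM_fun f g x (df dg : R) :
  is_derive x 1 f df -> is_derive x 1 g dg ->
  is_derive x 1 (fun t => f t * g t) (f x * dg + df * g x).
Proof.
move=> Hf Hg; apply: (is_derive_eq (is_deriveM Hf Hg)).
by rewrite [df * _]mulrC.
Qed.

Lemma is_deriveZ_fun (c : R) f x (df : R) :
  is_derive x 1 f df -> is_derive x 1 (fun t => c * f t) (c * df).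
Proof. by move=> Hf; apply: is_deriveZ. Qed.

Lemma is_derive_sqr_fun f x (df : R) :
  is_derive x 1 f df -> is_derive x 1 (fun t => f t ^+ 2) (2 * f x * df).
Proof.
move=> Hf; apply: (is_derive_eq (is_deriveM_fun Hf Hf)).
by rewrite [df * _]mulrC -mulrDr -[in RHS]mulrA mulr_natl mulr2n mulrDr.
Qed.

Lemma is_derive_sum_fun (I : finType) (P : pred I) (h : I -> R -> R) (dh : I -> R) x :
  (forall i, is_derive x 1 (h i) (dh i)) ->
  is_derive x 1 (fun t => \sum_(i | P i) h i t) (\sum_(i | P i) dh i).
Proof.
move=> H; rewrite /index_enum; elim: Finite.enum => [|i s IH].
  rewrite big_nil; under eq_fun do rewrite big_nil.
  exact: is_derive_cst.
rewrite big_cons; under eq_fun do rewrite big_cons.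
by case: (P i) => //; apply: is_deriveD_fun.
Qed.

Lemma is_derive_comp_fun f g x (df dg : R) :
  is_derive (g x) 1 f df -> is_derive x 1 g dg ->
  is_derive x 1 (fun t => f (g t)) (df * dg).
Proof. exact: is_derive1_comp. Qed.

Lemma is_derive_reflect f (c x df : R) :
  is_derive (c - x) 1 f df -> is_derive x 1 (fun t => f (c - t)) (- df).
Proof.
move=> Hf; rewrite -mulrN1; apply: (@is_derive_comp_fun f (fun t => c - t) _ _ _ Hf).
apply: (is_derive_eq (is_deriveB_fun (is_derive_cst c x 1) (is_derive_id x 1))).
exact: sub0r.
Qed.

Lemma is_derive_scale f (c x df : R) :
  is_derive (c * x) 1 f df -> is_derive x 1 (fun t => f (c * t)) (df * c).
Proof.
move=> Hf; apply: (@is_derive_comp_fun f (fun t => c * t) _ _ _ Hf).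
apply: (is_derive_eq (is_deriveZ_fun c (is_derive_id x 1))).
by rewrite mulr1.
Qed.

Lemma continuous_sum_at (T : topologicalType) (I : finType) (P : pred I)
    (h : I -> T -> R) (x : T) :
  (forall i, {for x, continuous (h i)}) ->
  {for x, continuous (fun w => \sum_(i | P i) h i w)}.
Proof.
move=> H; elim: (index_enum I) => [|i s IH].
  rewrite (_ : (fun _ => _) = cst 0); last first.
    by apply/funext => w; rewrite big_nil.
  exact: cvg_cst.
rewrite (_ : (fun _ => _) = fun w => if P i then h i w + \sum_(j <- s | P j) h j w
  else \sum_(j <- s | P j) h j w); last by apply/funext => w; rewrite big_cons.
by case: (P i) => //; apply: cvgD => //; exact: H.
Qed.

Lemma continuous_at_dominated f g x : {for x, continuous g} -> g x = 0 ->
  (forall t, `|f t - f x| <= g t) -> {for x, continuous f}.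
Proof.
move=> cg gx fg; apply/cvgrPdist_le => e e0.
have /cvgrPdist_le /(_ e e0) := cg.
apply: filterS => t; rewrite gx sub0r normrN => ge.
by rewrite distrC (le_trans (fg t))// (le_trans (ler_norm _)).
Qed.

Lemma is_derive_near_eq f g x (d : R) :
  (\forall t \near x, f t = g t) -> is_derive x 1 f d -> is_derive x 1 g d.
Proof. exact: near_eq_is_derive. Qed.

(** [u] and [v] are free on the two sides of [t]: an estimate on every short interval containing [t]
    is the form of differentiability that [interval_induction] consumes. *)
Lemma is_derive_slope f t (d eta : R) : is_derive t 1 f d -> 0 < eta ->
  exists2 r : R, 0 < r & forall u v, u <= t -> t <= v -> t - r < u -> v < t + r ->
    `|f v - f u - d * (v - u)| <= eta * (v - u).
Proof.
move=> /is_derive1_caratheodory[k [fk ck kt]] eta0.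
have /cvgrPdist_le/(_ _ eta0)[r /= r0 kr] := ck.
exists r => // u v ut tv ur vr.
have H z : `|t - z| < r -> `|f z - f t - d * (z - t)| <= eta * `|t - z|.
  move=> zr; rewrite (distrC t) fk -mulrBl normrM ler_wpM2r// distrC -kt; exact: kr.
have Hu : `|t - u| < r by rewrite ger0_norm ?subr_ge0//; lra.
have Hv : `|t - v| < r by rewrite ler0_norm ?subr_le0//; lra.
have -> : f v - f u - d * (v - u) =
    (f v - f t - d * (v - t)) - (f u - f t - d * (u - t)) by ring.
rewrite (_ : v - u = `|t - v| + `|t - u|); last first.
  by rewrite ler0_norm ?subr_le0// ger0_norm ?subr_ge0//; ring.
rewrite [leRHS]mulrDr; apply: le_trans (ler_normB _ _) _.
by apply: lerD; exact: H.
Qed.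

Lemma continuous_at_within f a b :
  (forall t, a <= t <= b -> {for t, continuous f}) ->
  {within `[a, b], continuous f}.
Proof.
move=> cf; apply: continuous_in_subspaceT => t.
by rewrite inE/= in_itv/= => /cf.
Qed.

Lemma MVT_at f (f' : R -> R) a b : a <= b ->
  (forall t, a < t < b -> is_derive t 1 f (f' t)) ->
  (forall t, a <= t <= b -> {for t, continuous f}) ->
  exists2 c, a <= c <= b & f b - f a = f' c * (b - a).
Proof.
move=> ab df cf.
have df' t : t \in `]a, b[ -> is_derive t 1 f (f' t) by rewrite in_itv/=; exact: df.
have [c] := MVT_segment ab df' (continuous_at_within cf).
by rewrite in_itv/=; exists c.
Qed.

Lemma MVT_at_oo f (f' : R -> R) a b : a < b ->
  (forall t, a < t < b -> is_derive t 1 f (f' t)) ->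
  (forall t, a <= t <= b -> {for t, continuous f}) ->
  exists2 c, a < c < b & f b - f a = f' c * (b - a).
Proof.
move=> ab df cf.
have df' t : t \in `]a, b[ -> is_derive t 1 f (f' t) by rewrite in_itv/=; exact: df.
have [c] := MVT ab df' (continuous_at_within cf).
by rewrite in_itv/=; exists c.
Qed.

(** The derivative is asked only inside the interval and continuity at its ends, because the
    solutions of differential equations constructed below are differentiable only at positive
    times. *)
Lemma derive_ge0_le f (f' : R -> R) a b : a <= b ->
  (forall t, a < t < b -> is_derive t 1 f (f' t)) ->
  (forall t, a <= t <= b -> {for t, continuous f}) ->
  (forall t, a < t < b -> 0 <= f' t) -> f a <= f b.
Proof.
rewrite le_eqVlt => /predU1P[->//|ab] df cf f'0.
have [c cab] := MVT_at_oo ab df cf.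
rewrite -subr_ge0 => ->; rewrite mulr_ge0 ?f'0// subr_ge0; exact: ltW.
Qed.

Lemma derive_lip_oo f (f' : R -> R) (K : R) a b :
  (forall t, a < t < b -> is_derive t 1 f (f' t)) ->
  (forall t, a <= t <= b -> {for t, continuous f}) ->
  (forall t, a < t < b -> `|f' t| <= K) ->
  forall x y, a <= x <= b -> a <= y <= b -> `|f x - f y| <= K * `|x - y|.
Proof.
move=> df cf f'K.
have H x y : a <= x <= b -> a <= y <= b -> y <= x ->
    `|f x - f y| <= K * `|x - y|.
  move=> /andP[ax xb] /andP[ay yb]; rewrite le_eqVlt => /predU1P[->|yx].
    by rewrite !subrr !normr0 mulr0.
  have df' t : y < t < x -> is_derive t 1 f (f' t).
    by move=> /andP[yt tx]; apply: df; rewrite (le_lt_trans ay yt) (lt_le_trans tx xb).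
  have cf' t : y <= t <= x -> {for t, continuous f}.
    by move=> /andP[yt tx]; apply: cf; rewrite (le_trans ay yt) (le_trans tx xb).
  have [c /andP[yc cx] ->] := MVT_at_oo yx df' cf'.
  by rewrite normrM ler_wpM2r// f'K// (le_lt_trans ay yc) (lt_le_trans cx xb).
move=> x y xab yab; have [yx|xy] := leP y x; first exact: H.
by rewrite distrC (distrC x); apply: H => //; exact: ltW.
Qed.

Lemma derive_lip f (f' : R -> R) (K : R) a b :
  (forall t, a <= t <= b -> is_derive t 1 f (f' t)) ->
  (forall t, a <= t <= b -> `|f' t| <= K) ->
  forall x y, a <= x <= b -> a <= y <= b -> `|f x - f y| <= K * `|x - y|.
Proof.
move=> df f'K; apply: (@derive_lip_oo f f') => [t tab|t tab|t tab].
- by apply: df; exact: subset_itv_oo_cc tab.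
- exact: is_derive_continuous (df t tab).
- by apply: f'K; exact: subset_itv_oo_cc tab.
Qed.

Lemma derive0_cst (f : R -> R) (a b : R) :
  (forall t, a < t < b -> is_derive t 1 f 0) ->
  (forall t, a <= t <= b -> {for t, continuous f}) ->
  forall t, a <= t <= b -> f t = f a.
Proof.
move=> df cf t /andP[a_t tb].
have df' s : a < s < t -> is_derive s 1 f ((fun=> 0) s).
  by move=> /andP[as_ st]; apply: df; rewrite as_ (lt_le_trans st).
have cf' s : a <= s <= t -> {for s, continuous f}.
  by move=> /andP[as_ st]; apply: cf; rewrite as_ (le_trans st).
have [c _] := MVT_at a_t df' cf'.
by rewrite mul0r => /eqP; rewrite subr_eq0 => /eqP.
Qed.

End Calculus.

(** * Antiderivatives of continuous functions *)

Section Antiderivative.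
Context {R : realType}.
Notation mu := (@lebesgue_measure R).
Implicit Types (f g : R -> R) (a b t x : R).

Lemma continuous_integrable_itv f a b : continuous f ->
  mu.-integrable `[a, b] (EFin \o f).
Proof.
move=> cf; apply: continuous_compact_integrable; first exact: segment_compact.
exact: continuous_subspaceT.
Qed.

(** For [t <= 0] the domain is empty or a point, so the value is [0]: for continuous [f] the
    antiderivative is continuous on the whole line, with derivative [f] at positive times. *)
Definition antideriv f t : R := \int[mu]_(s in `[0, t]) f s.

Lemma antideriv_le0 f t : t <= 0 -> antideriv f t = 0.
Proof.
rewrite /antideriv le_eqVlt => /predU1P[->|t0].
  by rewrite set_itv1 Rintegral_set1.
by rewrite set_itv_ge ?Rintegral_set0// bnd_simp -ltNge.
Qed.

Lemma is_derive_antideriv f t : continuous f -> 0 < t ->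
  is_derive t 1 (antideriv f) (f t).
Proof.
move=> cf t0.
have [||df d1] := @continuous_FTC1_closed R f 0 t (t + 1) _ _ t0 (cf t).
- by rewrite ltrDl.
- exact: continuous_integrable_itv.
- by apply: DeriveDef => //; rewrite -derive1E.
Qed.

Lemma continuous_antideriv f : continuous f -> continuous (antideriv f).
Proof.
move=> cf t; have [t0|t0|->] := ltgtP t 0.
- apply/cvgrPdist_lt => e e0; near=> s.
  have s0 : s < 0 by near: s; exact: lt_nbhsl.
  by rewrite !antideriv_le0 ?ltW// subrr normr0.
- exact: is_derive_continuous (is_derive_antideriv cf t0).
- rewrite /continuous_at antideriv_le0//.
  by apply: (@parameterized_integral_cvg_left _ 0 1) => //;
    exact: continuous_integrable_itv.
Unshelve. all: by end_near. Qed.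

(** Integration reproduces an exponential weight and gains the factor [1/c]. This makes the Picard
    map a contraction for all times at once, as in Bielecki's weighted norm, with no gluing of local
    solutions. *)
Lemma antideriv_bound f (M c : R) t : continuous f -> 0 < c ->
  (forall s : R, 0 <= s -> `|f s| <= M * (c * expR (c * s))) ->
  `|antideriv f t| <= M * expR (c * `|t|).
Proof.
move=> cf c0 fM.
have M0 : 0 <= M.
  have := le_trans (normr_ge0 _) (fM 0 (lexx _)).
  by rewrite mulr0 expR0 mulr1 pmulr_lge0.
have [t0|t0] := leP t 0.
  by rewrite antideriv_le0// normr0 mulr_ge0// expR_ge0.
rewrite (gtr0_norm t0).
have dE (s : R) : is_derive s 1 (fun s => M * expR (c * s)) (M * (expR (c * s) * c)).
  by apply: is_deriveZ_fun; apply: is_derive_scale; exact: is_derive_expR.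
have cA := continuous_antideriv cf.
have H (g : R -> R) (g' : R -> R) : g 0 = 0 ->
    (forall s : R, {for s, continuous g}) ->
    (forall s : R, 0 < s -> is_derive s 1 g (g' s)) ->
    (forall s : R, 0 <= s -> g' s <= M * (c * expR (c * s))) ->
    g t <= M * expR (c * t).
  move=> g0 cg dg g'M; rewrite -subr_ge0.
  have : M * expR (c * 0) - g 0 <= M * expR (c * t) - g t.
    apply: (@derive_ge0_le _ (fun s => M * expR (c * s) - g s)
      (fun s => M * (expR (c * s) * c) - g' s)); first exact: ltW.
    - by move=> s /andP[s0 _]; exact: (is_deriveB_fun (dE s) (dg s s0)).
    - move=> s _; apply: cvgB; last exact: cg.
      exact: is_derive_continuous (dE s).
    - by move=> s /andP[s0 _]; rewrite subr_ge0 (mulrC (expR _)) g'M// ltW.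
  by apply: le_trans; rewrite g0 subr0 mulr_ge0// expR_ge0.
rewrite ler_norml lerNl; apply/andP; split.
- apply: (H (fun s => - antideriv f s) (fun s => - f s)).
  + by rewrite antideriv_le0// oppr0.
  + by move=> s; apply: cvgN; exact: cA.
  + by move=> s s0; apply: is_deriveN; exact: is_derive_antideriv.
  + by move=> s s0; rewrite (le_trans _ (fM s s0))// -normrN ler_norm.
- apply: (H (antideriv f) f).
  + by rewrite antideriv_le0.
  + by move=> s; exact: cA.
  + by move=> s s0; exact: is_derive_antideriv.
  + by move=> s s0; rewrite (le_trans _ (fM s s0))// ler_norm.
Qed.

Lemma antiderivB f g t : continuous f -> continuous g ->
  antideriv (fun s => f s - g s) t = antideriv f t - antideriv g t.
Proof.
move=> cf cg; rewrite /antideriv RintegralB//; exact: continuous_integrable_itv.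
Qed.

End Antiderivative.

(** * Ordinary differential equations *)

Section Picard.
Context {R : realType} {I : finType}.
Variables (F : (I -> R) -> I -> R) (L : R) (u0 : I -> R).
Hypothesis L0 : 0 < L.
Hypothesis F_lip : forall u v i, `|F u i - F v i| <= L * \sum_j `|u j - v j|.

(** The intervals [[v k - e k, v k + e k]], where [e k] is the tail of the geometric series, are
    nested; the limit is the supremum of their left ends. *)
Lemma geometric_cauchy (v : nat -> R) (M : R) :
  (forall k, `|v k.+1 - v k| <= M / 2 ^+ k) ->
  exists l, forall k, `|v k - l| <= 2 * M / 2 ^+ k.
Proof.
move=> vM; pose e k : R := 2 * M / 2 ^+ k.
have eS k : e k = M / 2 ^+ k + e k.+1.
  rewrite /e exprS invfM; have : (2 ^+ k : R) != 0 by rewrite expf_neq0.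
  by move=> ?; field.
have e0 k : 0 <= e k.
  rewrite /e -mulrA mulr_ge0//; exact: le_trans (normr_ge0 _) (vM k).
have incr : {homo (fun k => v k - e k) : m n / (m <= n)%N >-> m <= n}.
  apply: homo_leq => [//||k]; first exact: le_trans.
  by have := vM k; rewrite ler_norml => /andP[+ _]; rewrite (eS k); lra.
have decr : {homo (fun k => v k + e k) : m n / (m <= n)%N >-> n <= m}.
  apply: (@homo_leq _ _ (fun x y => y <= x)) => [//|y x z yx zy|k].
    exact: le_trans zy yx.
  by have := vM k; rewrite ler_norml => /andP[_ +]; rewrite (eS k); lra.
pose S := [set v k - e k | k in [set: nat]].
have ub j : ubound S (v j + e j).
  move=> _ [k _ <-].
  have := incr _ _ (leq_maxl k j); have := decr _ _ (leq_maxr k j).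
  by have := e0 (maxn k j); lra.
exists (sup S) => k; rewrite ler_distl.
have hS : has_sup S by split; [exists (v 0 - e 0), 0%N|exists (v 0 + e 0)].
apply/andP; split.
  by rewrite lerBlDr; apply: ge_sup; [exact: hS.1|exact: ub].
by rewrite -lerBlDr; apply: ub_le_sup; [exact: hS.2|exists k].
Qed.

Notation C := #|I|%:R.

(** Rate of the exponential weight. Summing over coordinates costs [L * C], at most half of [K], so
    each Picard step halves the weighted increment; the [+ 1] keeps [K] positive for an empty index
    set. *)
Let K : R := 2 * (L * C + 1).
Let LCK : L * C <= K / 2. Proof. by rewrite /K; lra. Qed.
Let K0 : 0 < K.
Proof. by rewrite /K mulr_gt0// ltr_wpDl// mulr_ge0 ?ler0n// ltW. Qed.

Fixpoint picard (k : nat) (t : R) (i : I) : R :=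
  if k is k'.+1 then u0 i + antideriv (fun s => F (picard k' s) i) t else u0 i.

Lemma F_continuous_at (v : R -> I -> R) (t : R) i :
  (forall j, {for t, continuous (v^~ j)}) ->
  {for t, continuous (fun s => F (v s) i)}.
Proof.
move=> cv; have cS : {for t, continuous (fun s => L * \sum_j `|v s j - v t j|)}.
  apply: cvgM; first exact: cvg_cst.
  apply: continuous_sum_at => j; apply: cvg_norm; apply: cvgB; first exact: cv.
  exact: cvg_cst.
apply: (continuous_at_dominated cS) => [|s]; last exact: F_lip.
by rewrite big1 ?mulr0// => j _; rewrite subrr normr0.
Qed.

Lemma picard_continuous k i : continuous (picard k ^~ i).
Proof.
elim: k i => [|k IH] i t; first exact: cvg_cst.
apply: cvgD; first exact: cvg_cst.
apply: continuous_antideriv => s; apply: F_continuous_at => j; exact: IH.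
Qed.

(** Makes the first increment, the antiderivative of the constant [F u0], obey the bound of
    [picard_step] at [k = 0]. *)
Let M0 : R := (\sum_i `|F u0 i|) / K.

Lemma picard_step k t i :
  `|picard k.+1 t i - picard k t i| <= (M0 * expR (K * `|t|)) / 2 ^+ k.
Proof.
elim: k t i => [|k IH] t i.
  rewrite expr0 divr1 /= addrC addKr; apply: antideriv_bound => // [s|s s0].
    exact: cvg_cst.
  rewrite mulrA divfK ?gt_eqF// -[leLHS]mulr1; apply: ler_pM => //.
    by rewrite (bigD1 i)//= lerDl sumr_ge0.
  by rewrite -expR0 ler_expR mulr_ge0// ltW.
rewrite [picard k.+2 t i]/= [X in _ - X]/= opprD addrACA subrr add0r.
rewrite -antiderivB; last 2 first.
  move=> s; apply: (@F_continuous_at (picard k.+1)) => j.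
  exact: (@picard_continuous k.+1 j s).
  move=> s; apply: (@F_continuous_at (picard k)) => j; exact: picard_continuous.
rewrite mulrAC; apply: antideriv_bound => // [s|s s0].
  apply: cvgB.
    apply: (@F_continuous_at (picard k.+1)) => j.
    exact: (@picard_continuous k.+1 j s).
  apply: (@F_continuous_at (picard k)) => j; exact: picard_continuous.
apply: le_trans (F_lip _ _ _) _.
have IHs j : `|picard k.+1 s j - picard k s j| <= M0 * expR (K * s) / 2 ^+ k.
  by have := IH s j; rewrite (ger0_norm s0).
apply: le_trans (_ : L * (C * (M0 * expR (K * s) / 2 ^+ k)) <= _).
  apply: ler_wpM2l; first exact: ltW.
  apply: le_trans (ler_sum _ (fun j _ => IHs j)) _.
  by rewrite sumr_const -[leLHS]mulr_natl.
rewrite mulrA.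
apply: le_trans (_ : K / 2 * (M0 * expR (K * s) / 2 ^+ k) <= _).
  by rewrite ler_wpM2r//; exact: le_trans (normr_ge0 _) (IHs i).
rewrite exprS invfM.
have : (2 ^+ k : R) != 0 by rewrite expf_neq0.
by move=> ?; rewrite le_eqVlt; apply/orP; left; apply/eqP; field.
Qed.

Theorem cauchy_lipschitz : exists u : R -> I -> R,
  [/\ forall i, continuous (u^~ i), u 0 = u0 &
      forall (t : R) i, 0 < t -> is_derive t 1 (u^~ i) (F (u t) i)].
Proof.
have Hl t i : exists l, forall k, `|picard k t i - l| <=
    2 * (M0 * expR (K * `|t|)) / 2 ^+ k.
  by apply: geometric_cauchy => k; exact: picard_step.
pose u t i := sval (cid (Hl t i)).
have uP k t i : `|picard k t i - u t i| <= 2 * (M0 * expR (K * `|t|)) / 2 ^+ k.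
  exact: svalP (cid (Hl t i)) k.
have small (B e : R) : 0 < e -> exists k, B / 2 ^+ k < e.
  move=> e0; exists (Num.truncn (B / e)).+1.
  rewrite ltr_pdivrMr ?exprn_gt0// -ltr_pdivrMl// mulrC.
  apply: lt_le_trans (truncnS_gt _) _.
  by rewrite -natrX ler_nat ltnW// ltn_expl.
have M0_ge0 : 0 <= M0 by rewrite /M0 divr_ge0 ?sumr_ge0// ltW.
have cu i : continuous (u^~ i).
  move=> t; apply/cvgrPdist_lt => e e0.
  have e3 : 0 < e / 3 by rewrite divr_gt0.
  (* One [k] serves the whole window [|s| <= |t| + 1], so the limit inherits continuity by a
     three-term estimate. *)
  have [k Bk] := small (2 * (M0 * expR (K * (`|t| + 1)))) _ e3.
  have uk s : `|s| <= `|t| + 1 -> `|picard k s i - u s i| < e / 3.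
    move=> st; apply: le_lt_trans (uP k s i) (le_lt_trans _ Bk).
    rewrite ler_wpM2r ?invr_ge0 ?exprn_ge0// ler_wpM2l// ler_wpM2l// ler_expR.
    by rewrite ler_wpM2l// ltW.
  have /cvgrPdist_lt/(_ _ e3) ck := @picard_continuous k i t.
  near=> s.
  have -> : u t i - u s i = (picard k t i - picard k s i)
      - (picard k t i - u t i) + (picard k s i - u s i) by ring.
  rewrite (_ : e = e / 3 + e / 3 + e / 3); last by field.
  apply: le_lt_trans (ler_normD _ _) _; apply: ltrD; last first.
    apply: uk; near: s; exists 1 => //= s st.
    rewrite addrC -lerBlDr (le_trans (lerB_dist _ _))// distrC; exact: ltW.
  apply: le_lt_trans (ler_normB _ _) _; apply: ltrD; last first.
    by apply: uk; rewrite lerDl.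
  near: s; exact: ck.
have cFu i : continuous (fun s => F (u s) i).
  by move=> s; apply: F_continuous_at => j; exact: cu.
have uE t i : u t i = u0 i + antideriv (fun s => F (u s) i) t.
  apply/eqP; rewrite -subr_eq0 -normr_eq0 eq_le normr_ge0 andbT.
  apply/ler_addgt0Pl => e e0; rewrite addr0.
  have [k Bk] := small (2 * (2 * (M0 * expR (K * `|t|)))) _ e0.
  apply: ltW; apply: le_lt_trans Bk.
  have -> : u t i - (u0 i + antideriv (fun s => F (u s) i) t) =
      antideriv (fun s => F (picard k s) i - F (u s) i) t
      - (picard k.+1 t i - u t i).
    rewrite antiderivB//=; last first.
      by move=> s; apply: F_continuous_at => j; exact: picard_continuous.
    by ring.
  apply: le_trans (ler_normB _ _) _.
  rewrite [leRHS](_ : _ = 2 * M0 / 2 ^+ k * expR (K * `|t|)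
      + 2 * (M0 * expR (K * `|t|)) / 2 ^+ k); last by ring.
  apply: lerD; last first.
    apply: le_trans (uP k.+1 t i) _.
    rewrite ler_wpM2l//; first by do 2 apply: mulr_ge0 => //; exact: expR_ge0.
    rewrite lef_pV2 ?posrE ?exprn_gt0//.
    by rewrite exprS ler_peMl ?exprn_ge0// ler1n.
  apply: antideriv_bound => // [s|s s0].
    apply: cvgB; last exact: cFu.
    by apply: F_continuous_at => j; exact: picard_continuous.
  apply: le_trans (F_lip _ _ _) _.
  have uPs j : `|picard k s j - u s j| <= 2 * (M0 * expR (K * s)) / 2 ^+ k.
    by have := uP k s j; rewrite (ger0_norm s0).
  apply: le_trans (_ : L * (C * (2 * (M0 * expR (K * s)) / 2 ^+ k)) <= _).
    apply: ler_wpM2l; first exact: ltW.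
    apply: le_trans (ler_sum _ (fun j _ => uPs j)) _.
    by rewrite sumr_const -[leLHS]mulr_natl.
  rewrite mulrA.
  apply: le_trans (_ : K * (2 * (M0 * expR (K * s)) / 2 ^+ k) <= _).
    rewrite ler_wpM2r//; first exact: le_trans (normr_ge0 _) (uPs i).
    by rewrite (le_trans LCK)// ler_pdivrMr// ler_peMr ?ler1n// ltW.
  by rewrite le_eqVlt; apply/orP; left; apply/eqP; ring.
exists u; split => // [|t i t0].
  by apply/funext => i; rewrite uE antideriv_le0// addr0.
have -> : u^~ i = (fun t => u0 i + antideriv (fun s => F (u s) i) t).
  by apply/funext => s; exact: uE.
apply: (is_derive_eq (is_deriveD_fun (is_derive_cst (u0 i) t 1)
  (is_derive_antideriv (cFu i) t0))).
exact: add0r.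
Unshelve. all: by end_near. Qed.

End Picard.

(** * Absolutely continuous functions *)

Section AbsolutelyContinuous.
Context {R : realType}.
Notation mu := (@lebesgue_measure R).
Implicit Types (f g h : R -> R) (a b t u v x : R).

(** Compactness in Cousin's form: the supremum of the points reachable from [a] is itself reachable,
    and it could be passed if it were not [b]. *)
Lemma interval_induction (P : R -> R -> Prop) a b : a <= b ->
  (forall u v w, a <= u -> u <= v -> v <= w -> w <= b ->
     P u v -> P v w -> P u w) ->
  (forall t, a <= t <= b -> exists2 d : R, 0 < d & forall u v,
     a <= u -> u <= t -> t <= v -> v <= b -> t - d < u -> v < t + d -> P u v) ->
  P a b.
Proof.
move=> ab Ptrans Ploc.
pose S := [set t | a <= t <= b /\ P a t].
have Sa : S a.
  split; first by rewrite lexx.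
  have [|d d0 Pd] := Ploc a; first by rewrite lexx.
  by apply: Pd => //; rewrite ?ltrBlDr ltrDl.
have hS : has_sup S by split; [exists a|exists b => t [/andP[]]].
have S_ge : a <= sup S by apply: ub_le_sup => //; exact: hS.2.
have S_le : sup S <= b by apply: ge_sup; [exists a|move=> t [/andP[]]].
have [|d d0 Pd] := Ploc (sup S); first by rewrite S_ge.
have [t [/andP[a_t t_b] Pt] td] := sup_adherent d0 hS.
have tS : t <= sup S by apply: ub_le_sup; [exact: hS.2|split=> //; rewrite a_t].
have PaS : P a (sup S).
  by apply: (Ptrans _ t) => //; apply: Pd => //; rewrite ltrDl.
pose v := Num.min b (sup S + d / 2).
have Sv : sup S <= v by rewrite le_min S_le lerDl divr_ge0// ltW.
have vb : v <= b by rewrite ge_min lexx.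
have vd : v < sup S + d.
  by rewrite gt_min; apply/orP; right; rewrite ltrD2l ltr_pdivrMr// ltr_pMr// ltr1n.
have Pav : P a v.
  apply: (Ptrans _ (sup S)) => //; apply: Pd => //.
  by rewrite ltrBlDr ltrDl.
have vS : v <= sup S.
  apply: ub_le_sup; first exact: hS.2.
  by split=> //; rewrite vb (le_trans S_ge).
suff <- : v = b by [].
apply/eqP; rewrite eq_le vb /= leNgt; apply/negP => vltb.
have vE : v = sup S + d / 2.
  by move: vltb; rewrite /v /Num.min; case: ifP => //; rewrite ltxx.
by move: vS; rewrite vE gerDl leNgt divr_gt0.
Qed.

(* [chain U u s v]: the intervals listed in [s] are included in [U], lie in
   [[u, v]] and follow one another from left to right. *)
Fixpoint chain (U : set R) u (s : seq (R * R)) v : Prop :=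
  if s is p :: s' then
    [/\ u <= p.1, p.1 <= p.2, `[p.1, p.2] `<=` U & chain U p.2 s' v]
  else u <= v.

Lemma chain_le U u s v : chain U u s v -> u <= v.
Proof.
elim: s u => //= p s IH u [up pp _ /IH pv].
exact: le_trans up (le_trans pp pv).
Qed.

Lemma chain_le_start U u u' s v : u' <= u -> chain U u s v -> chain U u' s v.
Proof.
case: s => [|p s] /= u'u; first exact: le_trans.
by move=> [up pp pU c]; split=> //; exact: le_trans up.
Qed.

Lemma chain_cat U u s v s' w :
  chain U u s v -> chain U v s' w -> chain U u (s ++ s') w.
Proof.
elim: s u => [|p s IH] u /=; first exact: chain_le_start.
by move=> [up pp pU c] c'; split=> //; exact: IH.
Qed.

Lemma chain_measure U u s v : measurable U -> chain U u s v ->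
  ((\sum_(p <- s) (p.2 - p.1))%:E <= mu (U `&` `]u, v]))%E.
Proof.
move=> mU; elim: s u => [|p s IH] u /=; first by rewrite big_nil measure_ge0.
move=> [up pp pU c]; rewrite big_cons EFinD.
have pv := chain_le c.
apply: (@le_trans _ _ (mu `]p.1, p.2] + mu (U `&` `]p.2, v]))%E).
  apply: leeD; last exact: IH.
  rewrite lebesgue_measure_itv/= lte_fin; case: ltP => // qp.
  by rewrite lee_fin subr_le0.
rewrite -measureU//; last 2 first.
  exact: measurableI.
  rewrite -subset0 => x /= []; rewrite !in_itv/= => /andP[_ xp] [_ /andP[px _]].
  by move: (lt_le_trans px xp); rewrite ltxx.
apply: le_measure; rewrite ?inE//=.
- by apply: measurableU => //; exact: measurableI.
- exact: measurableI.
- move=> x /= []; rewrite !in_itv/=; [move=> /andP[px xp]|move=> [Ux /andP[px xv]]].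
    split; first by apply: pU; rewrite /= in_itv/= ltW.
    by rewrite (le_lt_trans up px) (le_trans xp pv).
  by split=> //; rewrite xv andbT (le_lt_trans _ px)// (le_trans up pp).
Qed.

Lemma chain_nth_bound U u s v i : chain U u s v -> (i < size s)%N ->
  [/\ u <= (nth (0, 0) s i).1, (nth (0, 0) s i).1 <= (nth (0, 0) s i).2 &
      (nth (0, 0) s i).2 <= v].
Proof.
elim: s u i => // p s IH u [|i] /= [up pp _ c] si.
  by split=> //; exact: chain_le c.
have [? ? ?] := IH _ i c si; split=> //.
exact: le_trans up (le_trans pp _).
Qed.

Lemma chain_nth_lt U u s v i j : chain U u s v -> (i < j < size s)%N ->
  (nth (0, 0) s i).2 <= (nth (0, 0) s j).1.
Proof.
elim: s u i j => [|p s IH] u i j; first by rewrite andbF.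
case: j => // j /= [up pp _ c]; case: i => [|i] /=; rewrite !ltnS => ij.
  by have [] := chain_nth_bound c ij.
exact: IH c ij.
Qed.

Lemma absolutely_continuous_chain f (e : R) : absolutely_continuous01 f ->
  0 < e -> exists2 d : R, 0 < d & forall U s, chain U 0 s 1 ->
    \sum_(p <- s) (p.2 - p.1) < d -> \sum_(p <- s) `|f p.2 - f p.1| < e.
Proof.
move=> acf e0; have [d d0 H] := acf e e0; exists d => // U s c.
rewrite !(big_nth (0, 0)) !big_mkord.
apply: (H (size s) (fun i => (nth (0, 0) s i).1) (fun i => (nth (0, 0) s i).2)).
  by move=> i; have [? ? ?] := chain_nth_bound c (ltn_ord i).
move=> i j; rewrite neq_ltn => /orP[] ij; [left|right].
  by apply: chain_nth_lt c _; rewrite ij ltn_ord.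
by apply: chain_nth_lt c _; rewrite ij ltn_ord.
Qed.

(** Away from [N] the increments of [h] are small multiples of the lengths. [N] is covered by an
    open set of small measure; there the increments of [h] are at most those of [f], whose total is
    small by absolute continuity. Domination from above by [f] suits the intended [h], which is [f]
    minus a nondecreasing function. *)
Lemma slope_le0_le f h (N : set R) : absolutely_continuous01 f ->
  (forall u v, 0 <= u -> u <= v -> v <= 1 -> h v - h u <= f v - f u) ->
  mu.-negligible N ->
  (forall t : R, 0 <= t <= 1 -> ~ N t -> forall eta : R, 0 < eta ->
     exists2 d : R, 0 < d & forall u v,
       0 <= u -> u <= t -> t <= v -> v <= 1 -> t - d < u -> v < t + d ->
       h v - h u <= eta * (v - u)) ->
  h 1 <= h 0.
Proof.
move=> acf hf [M [mM M0 NM]] slope; rewrite -subr_le0.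
apply/ler_addgt0Pl => e e0; rewrite addr0.
have e2 : 0 < e / 2 by rewrite divr_gt0.
have [d d0 fd] := absolutely_continuous_chain acf e2.
have Moo : (mu M < +oo)%E by rewrite M0.
have [U [oU MU UM]] := lebesgue_regularity_outer mM Moo d0.
have mU : measurable U by exact: open_measurable.
have Ud : (mu U < d%:E)%E.
  have <- : (mu M + mu (U `\` M) = mu U)%E.
    rewrite -measureU ?setDUK//; first exact: measurableD.
    by rewrite setDE setICA setICr setI0.
  by rewrite M0 add0e.
(* The intervals inside [U] are recorded in a list, so that absolute continuity of [f] is applied
   only once, to all of them together; concatenation of lists makes [P] additive. *)
pose P u v := exists s, chain U u s v /\
  h v - h u <= e / 2 * (v - u) + \sum_(p <- s) `|f p.2 - f p.1|.
have [s [cs hs]] : P 0 1.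
  apply: interval_induction => // [u v w _ _ _ _ [s [c Hs]] [s' [c' Hs']]|t t01].
    exists (s ++ s'); split; first exact: chain_cat c c'.
    by rewrite big_cat/=; move: Hs Hs'; lra.
  have [Nt|Nt] := pselect (N t).
    have := oU t (MU _ (NM _ Nt)).
    move=> [/= r r0 rU]; exists r => // u v u0 ut tv v1 ur vr.
    exists [:: (u, v)]; split.
      split=> //=; first exact: le_trans tv.
      move=> x /=; rewrite in_itv/= => /andP[ux xv]; apply: rU => /=.
      by rewrite ltr_distlC; apply/andP; split; [exact: lt_le_trans ux|exact: le_lt_trans vr].
    rewrite big_seq1/=; apply: le_trans (hf u v u0 (le_trans ut tv) v1) _.
    apply: le_trans (ler_norm _) _.
    by rewrite lerDr mulr_ge0 ?subr_ge0 ?(le_trans ut)// ltW.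
  have [r r0 H] := slope t t01 Nt _ e2; exists r => // u v u0 ut tv v1 ur vr.
  exists [::]; split; first exact: le_trans tv.
  by rewrite big_nil addr0; exact: H.
apply: le_trans hs _; rewrite subr0 mulr1.
rewrite [leRHS](splitr e) lerD2l; apply: ltW; apply: (fd _ _ cs).
rewrite -lte_fin; apply: le_lt_trans (chain_measure mU cs) _.
apply: le_lt_trans Ud; apply: le_measure; rewrite ?inE//=.
exact: measurableI.
Qed.

(** An inequality version of the fundamental theorem. Only an upper bound on slopes is asked because
    the truncated calibration to which it is applied has corners. The primitive of [g] is subtracted
    from [f] and [slope_le0_le] is applied to the difference. *)
Lemma slope_le_integral f g (N : set R) : absolutely_continuous01 f ->
  measurable_fun (`[0, 1] : set R) g -> (forall t : R, 0 <= t <= 1 -> 0 <= g t) ->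
  mu.-negligible N ->
  (forall t : R, 0 <= t <= 1 -> ~ N t -> forall eta : R, 0 < eta ->
     exists2 d : R, 0 < d & forall u v,
       0 <= u -> u <= t -> t <= v -> v <= 1 -> t - d < u -> v < t + d ->
       f v - f u <= (g t + eta) * (v - u)) ->
  ((f 1 - f 0)%:E <= \int[mu]_(t in `[0%R, 1%R]) (g t)%:E)%E.
Proof.
move=> acf mg g0 Nn slope.
have [->|goo] := eqVneq (\int[mu]_(t in `[0%R, 1%R]) (g t)%:E)%E +oo%E.
  exact: leey.
have ig : mu.-integrable `[0, 1] (EFin \o g).
  apply/integrableP; split; first exact/measurable_EFinP.
  rewrite (_ : integral _ _ _ = \int[mu]_(t in `[0%R, 1%R]) (g t)%:E)%E ?ltey//.
  apply: eq_integral => t; rewrite inE/= in_itv/= => t01.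
  by rewrite ger0_norm// g0.
pose gr := g \_ `[0, 1].
have gr0 t : 0 <= gr t.
  by rewrite /gr patchE; case: ifPn => //; rewrite inE/= in_itv/=; exact: g0.
have igr D : measurable D -> mu.-integrable D (EFin \o gr).
  move=> mD; rewrite /gr -restrict_EFin.
  by apply/integrable_restrict => //; apply: integrableS ig => //; exact: measurableI.
have lgr : locally_integrable [set: R] gr by exact: integrable_locally_restrict.
pose G y := (\int[mu]_(t in [set` Interval (BLeft 0) (BRight y)]) gr t)%R.
have Gae := @FTC1 R gr (BLeft 0) (fun y => igr _ (measurable_itv _)) lgr.
have [M [mM M0 GM]] := Gae.
have Gmono u v : 0 <= u -> u <= v -> 0 <= G v - G u.
  move=> u0 uv; rewrite /G Rintegral_itvB ?bnd_simp//; last exact: igr.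
  by apply: Rintegral_ge0 => x _.
have G00 : G 0 = 0 by rewrite /G set_itv1 Rintegral_set1.
have Nn' : mu.-negligible (N `|` M `|` [set 0]).
  apply: negligibleU; first by apply: negligibleU => //; exact/negligibleP.
  by apply/negligibleP => //; exact: lebesgue_measure_set1.
have := @slope_le0_le f (fun t => f t - G t) _ acf _ Nn' _.
rewrite G00 subr0 => H.
have {H} : f 1 - G 1 <= f 0.
  apply: H => [u v u0 uv v1|t t01 /not_orP[/not_orP[Nt Mt] t0n] eta eta0].
    by have := Gmono u v u0 uv; lra.
  have eta2 : 0 < eta / 2 by rewrite divr_gt0.
  have [d d0 fd] := slope t t01 Nt _ eta2.
  have /andP[t0 t1] := t01.
  have [dG G't] : derivable G t 1 /\ derive1 G t = gr t.
    apply: contrapT => h; apply: Mt; apply: GM => h'; apply: h; apply: h'.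
    by rewrite lte_fin lt_neqAle t0 andbT; apply/eqP => t0E; exact: t0n.
  have dGt : is_derive t 1 G (g t).
    have -> : g t = gr t by rewrite /gr patchE mem_set//= in_itv/=.
    by rewrite -G't derive1E; exact: derivableP.
  have [r r0 Gr] := is_derive_slope dGt eta2.
  exists (Num.min d r); first by rewrite lt_min d0.
  move=> u v u0 ut tv v1; rewrite ltrBlDr -ltrBlDl lt_min => /andP[ud ur].
  rewrite -ltrBlDl lt_min => /andP[vd vr].
  have := fd u v u0 ut tv v1; rewrite ltrBlDr -ltrBlDl -[v < _]ltrBlDl => /(_ ud vd).
  have := Gr u v ut tv; rewrite ltrBlDr -ltrBlDl -[v < _]ltrBlDl => /(_ ur vr).
  by rewrite ler_norml => /andP[+ _]; lra.
rewrite lerBlDr -lerBlDl => fG.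
apply: (@le_trans _ _ (G 1)%:E); first by rewrite lee_fin.
have -> : G 1 = \int[mu]_(t in `[0, 1]) g t.
  by apply: eq_Rintegral => t tI; rewrite /gr patchE tI.
by rewrite /Rintegral fineK//; exact: integrable_fin_num.
Qed.

End AbsolutelyContinuous.

(** * The logarithmic mean *)

Section LogMean.
Context {R : realType}.
Notation mu := (@lebesgue_measure R).
Implicit Types (a b p s t x z : R) (k : nat).

(* [phi 0 z = (expR z - 1) / z], also at [z = 0], and [phi k] is its [k]-th
   derivative. *)
Definition phi k z : R := \int[mu]_(p in `[0, 1]) ((1 - p) ^+ k * expR ((1 - p) * z)).

Lemma is_derive_kernel k x p :
  is_derive x 1 (fun z => (1 - p) ^+ k * expR ((1 - p) * z))
    ((1 - p) ^+ k.+1 * expR ((1 - p) * x)).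
Proof.
apply: (is_derive_eq (is_deriveZ_fun ((1 - p) ^+ k)
  (is_derive_scale (is_derive_expR ((1 - p) * x))))).
by rewrite exprS; ring.
Qed.

Lemma continuous_kernel k z : continuous (fun p => (1 - p) ^+ k * expR ((1 - p) * z)).
Proof.
move=> p.
have d1 : is_derive p 1 (fun p => 1 - p) (0 - 1).
  exact: (is_deriveB_fun (is_derive_cst (1 : R) p 1) (is_derive_id p 1)).
have c1 := is_derive_continuous d1.
apply: cvgM.
  elim: k => [|k IH]; first by rewrite expr0; under eq_fun do rewrite expr0; exact: cvg_cst.
  by rewrite exprS; under eq_fun do rewrite exprS; exact: cvgM c1 IH.
apply: (@continuous_comp _ _ _ (fun p => (1 - p) * z) expR).
  by apply: cvgM; [exact: c1|exact: cvg_cst].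
exact: continuous_expR.
Qed.

Lemma integrable_kernel k z :
  mu.-integrable `[0, 1] (EFin \o (fun p => (1 - p) ^+ k * expR ((1 - p) * z))).
Proof.
apply: continuous_compact_integrable; first exact: segment_compact.
by apply: continuous_subspaceT; exact: continuous_kernel.
Qed.

Lemma kernel_ge0 k z p : 0 <= p <= 1 -> 0 <= (1 - p) ^+ k * expR ((1 - p) * z).
Proof. by move=> /andP[p0 p1]; rewrite mulr_ge0 ?expR_ge0// exprn_ge0 ?subr_ge0. Qed.

Lemma kernel_le k z p : 0 <= p <= 1 -> (1 - p) ^+ k * expR ((1 - p) * z) <= expR `|z|.
Proof.
move=> /andP[p0 p1]; rewrite -[leRHS]mul1r ler_pM ?expR_ge0 ?exprn_ge0 ?subr_ge0//.
  by rewrite exprn_ile1 ?subr_ge0// gerBl.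
rewrite ler_expR (le_trans (ler_norm _))// normrM ler_piMl//.
by rewrite ger0_norm ?subr_ge0// gerBl.
Qed.

Lemma integral01_cst (c : R) : \int[mu]_(p in `[0, 1]) c = c.
Proof.
by rewrite Rintegral_cst//= lebesgue_measure_itv/= lte_fin ltr01 oppr0 adde0 mulr1.
Qed.

Lemma integrable01_cst (c : R) : mu.-integrable `[0, 1] (EFin \o (fun _ : R => c)).
Proof.
apply: continuous_compact_integrable; first exact: segment_compact.
by apply: continuous_subspaceT => x; exact: cvg_cst.
Qed.

Lemma phi_ge0 k z : 0 <= phi k z.
Proof. by apply: Rintegral_ge0 => p /=; rewrite in_itv/=; exact: kernel_ge0. Qed.

Lemma phi_le k z : phi k z <= expR `|z|.
Proof.
rewrite -[leRHS]integral01_cst; apply: le_Rintegral => //.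
- exact: integrable_kernel.
- exact: integrable01_cst.
- by move=> p /=; rewrite in_itv/=; exact: kernel_le.
Qed.

Lemma is_derive_phi k z : is_derive z 1 (phi k) (phi k.+1 z).
Proof.
pose f (x p : R) := (1 - p) ^+ k * expR ((1 - p) * x).
have d1E x p : partial1of2 f x p = (1 - p) ^+ k.+1 * expR ((1 - p) * x).
  rewrite partial1of2E.
  exact: (@derive_val _ _ _ _ _ _ _ (is_derive_kernel k x p)).
have zI : `]z - 1, z + 1[%classic z by rewrite /= in_itv/= gtrBl ltrDl ltr01.
have intf x : `]z - 1, z + 1[%classic x -> mu.-integrable `[0, 1] (EFin \o f x).
  by move=> _; exact: integrable_kernel.
have derf x p : `]z - 1, z + 1[%classic x -> `[0, 1]%classic p ->
    derivable (f ^~ p) x 1.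
  by move=> _ _; exact: (@ex_derive _ _ _ _ _ _ _ (is_derive_kernel k x p)).
have G_ub x p : `]z - 1, z + 1[%classic x -> `[0, 1]%classic p ->
    `|partial1of2 f x p| <= (fun _ : R => expR (`|z| + 1)) p.
  rewrite /= !in_itv/= d1E => /andP[zx xz] p01.
  rewrite ger0_norm ?kernel_ge0// (le_trans (kernel_le _ _ p01))// ler_expR.
  by rewrite -lerBlDl (le_trans (lerB_dist _ _))// ler_distl; lra.
have G0 (p : R) : 0 <= (fun _ : R => expR (`|z| + 1)) p by exact: expR_ge0.
have D : derivable (phi k) z 1.
  by apply: (derivable_under_integral _ zI intf derf G0 (integrable01_cst _) G_ub).
apply: DeriveDef => //; rewrite -derive1E.
apply: etrans (differentiation_under_integral _ zI intf derf G0
  (integrable01_cst _) G_ub) _ => //.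
by apply: eq_Rintegral => p _; exact: d1E.
Qed.

Lemma phi0_expR z : z * phi 0 z = expR z - 1.
Proof.
rewrite /phi -RintegralZl//; last exact: integrable_kernel.
pose F (p : R) := - expR ((1 - p) * z).
have dF (p : R) : is_derive p 1 F (z * ((1 - p) ^+ 0 * expR ((1 - p) * z))).
  have d1 : is_derive p 1 (fun p => 1 - p) (0 - 1).
    exact: (is_deriveB_fun (is_derive_cst (1 : R) p 1) (is_derive_id p 1)).
  have d2 := is_deriveM_fun d1 (is_derive_cst z p 1).
  have d3 := @is_derive_comp_fun R expR (fun p => (1 - p) * z) p _ _
    (is_derive_expR ((1 - p) * z)) d2.
  apply: (is_derive_eq (is_deriveN d3)).
  by rewrite /= expr0; ring.
rewrite /Rintegral (@continuous_FTC2 _ _ F 0 1)//.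
- by rewrite -EFinB /= /F subr0 subrr mul1r mul0r expR0 opprK addrC.
- apply: continuous_subspaceT => p; apply: cvgM; first exact: cvg_cst.
  exact: continuous_kernel.
- split.
  + by move=> p _; exact: (@ex_derive _ _ _ _ _ _ _ (dF p)).
  + by apply: cvg_at_right_filter; exact: is_derive_continuous (dF 0).
  + by apply: cvg_at_left_filter; exact: is_derive_continuous (dF 1).
- by move=> p _; rewrite derive1E; exact: (@derive_val _ _ _ _ _ _ _ (dF p)).
Qed.

Lemma phi00 : phi 0 0 = 1.
Proof.
rewrite /phi -[RHS]integral01_cst; apply: eq_Rintegral => p _.
by rewrite expr0 mulr0 expR0 mulr1.
Qed.

(* [th] is the logarithmic mean of positive numbers, written so that it is
   visibly smooth across [s = t]; [th1] is its derivative in [s]. *)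
Definition th s t : R := t * phi 0 (ln s - ln t).
Definition th1 s t : R := t * phi 1 (ln s - ln t) / s.

Lemma log_meanE s t : 0 < s -> 0 < t -> log_mean s t = th s t.
Proof.
move=> s0 t0; rewrite /log_mean /th /phi -RintegralZl//; last exact: integrable_kernel.
apply: eq_Rintegral => p _; rewrite /powR !gt_eqF//= expr0 mul1r -expRD.
rewrite -{2}(lnK t0) -expRD; congr expR; ring.
Qed.

Lemma th_ln s t : 0 < s -> 0 < t -> th s t * (ln s - ln t) = s - t.
Proof.
move=> s0 t0; rewrite /th -mulrA (mulrC (phi _ _)) phi0_expR expRB !lnK//.
by field; rewrite gt_eqF.
Qed.

Lemma thxx s : th s s = s.
Proof. by rewrite /th subrr phi00 mulr1. Qed.

(** Symmetry is hidden in the formula for [th]; it follows from [th_ln], where exchanging [s] and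
    [t] changes the sign of both differences. *)
Lemma thC s t : 0 < s -> 0 < t -> th s t = th t s.
Proof.
move=> s0 t0; have [->//|st] := eqVneq s t.
have lst : ln s - ln t != 0 by rewrite subr_eq0; apply: contra st => /eqP /ln_inj->.
apply: (mulIf lst); by rewrite th_ln// -[X in _ * X]opprB mulrN th_ln// opprB.
Qed.

Lemma th_ge0 s t : 0 <= t -> 0 <= th s t.
Proof. by move=> t0; rewrite mulr_ge0 ?phi_ge0. Qed.

Lemma is_derive_th_l s t : 0 < s -> is_derive s 1 (th^~ t) (th1 s t).
Proof.
move=> s0.
have d1 := is_deriveB_fun (is_derive1_ln s0) (is_derive_cst (ln t) s 1).
have d2 := @is_derive_comp_fun R (phi 0) (fun s => ln s - ln t) s _ _
  (is_derive_phi 0 (ln s - ln t)) d1.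
apply: (is_derive_eq (is_deriveZ_fun t d2)).
by rewrite /th1; ring.
Qed.

Lemma is_derive_th_r s t : 0 < s -> 0 < t -> is_derive t 1 (th s) (th1 t s).
Proof.
move=> s0 t0; apply: (is_derive_near_eq _ (is_derive_th_l s t0)).
near=> x; apply: thC => //; near: x; exact: lt_nbhsr.
Unshelve. all: by end_near. Qed.

(** The derivative of [th s] at [t] is computed in two ways, from the formula and through the
    symmetry of [th]; this replaces an integration by parts. *)
Lemma phi01 s t : 0 < s -> 0 < t ->
  phi 0 (ln s - ln t) - phi 1 (ln s - ln t) = th1 t s.
Proof.
move=> s0 t0.
have d1 := is_deriveB_fun (is_derive_cst (ln s) t 1) (is_derive1_ln t0).
have d2 := @is_derive_comp_fun R (phi 0) (fun t => ln s - ln t) t _ _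
  (is_derive_phi 0 (ln s - ln t)) d1.
have d3 := is_deriveM_fun (is_derive_id t 1) d2.
have := @derive_val _ _ _ _ _ _ _ (is_derive_th_r s0 t0).
rewrite (@derive_val _ _ _ _ _ _ _ d3) => <-.
by field; rewrite gt_eqF.
Qed.

Lemma is_derive_th (f g : R -> R) x (df dg : R) : 0 < f x -> 0 < g x ->
  is_derive x 1 f df -> is_derive x 1 g dg ->
  is_derive x 1 (fun x => th (f x) (g x)) (th1 (f x) (g x) * df + th1 (g x) (f x) * dg).
Proof.
move=> f0 g0 Hf Hg.
have l1 := @is_derive_comp_fun R _ f x _ _ (is_derive1_ln f0) Hf.
have l2 := @is_derive_comp_fun R _ g x _ _ (is_derive1_ln g0) Hg.
have d2 := @is_derive_comp_fun R (phi 0) (fun x => ln (f x) - ln (g x)) x _ _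
  (is_derive_phi 0 _) (is_deriveB_fun l1 l2).
apply: (is_derive_eq (is_deriveM_fun Hg d2)).
by rewrite -(phi01 f0 g0) /th1; field; rewrite !gt_eqF.
Qed.

(** With [z = ln s - ln t >= 0] the claim, multiplied by [z], is
    [expR z - 1 <= z * (expR z + 1) / 2]. The difference vanishes at [0], and its derivative is
    nonnegative by [1 - y <= expR (- y)]. *)
Lemma th_le_mean s t : 0 < s -> 0 < t -> th s t <= (s + t) / 2.
Proof.
move=> s0 t0.
wlog st : s t s0 t0 / t <= s => [H|].
  have [ts|/ltW st] := leP t s; first exact: H.
  by rewrite thC// [s + t]addrC H.
set z := ln s - ln t.
have z0 : 0 <= z by rewrite subr_ge0 ler_ln.
have H : z * phi 0 z <= z * ((expR z + 1) / 2).
  rewrite phi0_expR -subr_ge0.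
  pose f (y : R) := y * ((expR y + 1) / 2) - (expR y - 1).
  have f0 : f 0 = 0 by rewrite /f expR0; ring.
  rewrite -[leRHS]/(f z) -f0.
  pose f' (y : R) := y * (expR y / 2) + (expR y + 1) / 2 - expR y.
  have df (y : R) : is_derive y 1 f (f' y).
    have dc (c : R) := is_derive_cst c y 1.
    have d1 := is_deriveM_fun (is_deriveD_fun (is_derive_expR y) (dc 1)) (dc 2^-1).
    have d2 := is_deriveM_fun (is_derive_id y 1) d1.
    have d3 := is_deriveB_fun d2 (is_deriveB_fun (is_derive_expR y) (dc 1)).
    by apply: (is_derive_eq d3); rewrite /f' /=; field.
  apply: (@derive_ge0_le _ f f') => // [y _|y /andP[y0 _]].
    exact: is_derive_continuous (df y).
  have := expR_ge1Dx (- y); rewrite expRN.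
  have e0 := expR_gt0 y; rewrite -(ler_pM2r e0) mulVf ?gt_eqF// /f'.
  by move=> ?; lra.
rewrite /th -/z.
have ez : expR z = s / t by rewrite expRB !lnK.
have -> : (s + t) / 2 = t * ((expR z + 1) / 2).
  by rewrite ez; field; rewrite gt_eqF.
rewrite (ler_wpM2l (ltW t0))//.
have [z0E|z0n] := eqVneq z 0; first by rewrite z0E phi00 expR0; lra.
by rewrite -(@ler_pM2l _ z)// lt_neqAle eq_sym z0n.
Qed.

Definition box a b s := a <= s <= b.

(** Away from [0] the mean is smooth: one constant bounds [th] and [th1], their Lipschitz constants,
    and the second order Taylor remainder. The last comes from the mean value theorem on the segment
    between the two points and the Lipschitz bound for [th1]. *)
Lemma th_box a b : 0 < a -> a <= b -> exists2 K : R, 0 <= K & forall s t,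
  box a b s -> box a b t ->
  [/\ `|th s t| <= K, `|th1 s t| <= K &
  forall s' t', box a b s' -> box a b t' ->
  [/\ `|th s' t' - th s t| <= K * (`|s' - s| + `|t' - t|),
     `|th1 s' t' - th1 s t| <= K * (`|s' - s| + `|t' - t|) &
     `|th s' t' - th s t - th1 s t * (s' - s) - th1 t s * (t' - t)|
       <= 2 * K * (`|s' - s| + `|t' - t|) ^+ 2] ].
Proof.
move=> a0 ab; have b0 : 0 < b by exact: lt_le_trans ab.
pose E : R := expR (ln b - ln a).
have E0 : 0 < E by exact: expR_gt0.
have pos s : box a b s -> 0 < s by move=> /andP[+ _]; exact: lt_le_trans.
have phiE k s t : box a b s -> box a b t -> `|phi k (ln s - ln t)| <= E.
  move=> sab tab; rewrite ger0_norm ?phi_ge0// (le_trans (phi_le _ _))//.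
  rewrite ler_expR; have [s0 t0] := (pos _ sab, pos _ tab).
  move: sab tab => /andP[as_ sb] /andP[at_ tb].
  have : ln a <= ln s by rewrite ler_ln.
  have : ln a <= ln t by rewrite ler_ln.
  have : ln s <= ln b by rewrite ler_ln.
  have : ln t <= ln b by rewrite ler_ln.
  by move=> ? ? ? ?; rewrite ler_norml; apply/andP; split; lra.
pose K1 : R := b * E + b * E / a.
pose K : R := K1 + 2 * b * E / a ^+ 2 + 2 * E / a.
have bE0 : 0 <= b * E by rewrite mulr_ge0 ?ltW.
have bEa0 : 0 <= b * E / a by rewrite divr_ge0// ltW.
have bEaa0 : 0 <= 2 * b * E / a ^+ 2 by rewrite divr_ge0 ?exprn_ge0 ?mulr_ge0 ?ltW.
have Ea0 : 0 <= 2 * E / a by rewrite divr_ge0 ?mulr_ge0 ?ltW.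
have nb s : box a b s -> `|s| <= b.
  by move=> sab; rewrite (ger0_norm (ltW (pos _ sab))); case/andP: sab.
have na s : box a b s -> `|s^-1| <= a^-1.
  move=> sab; have s0 := pos _ sab; rewrite gtr0_norm ?invr_gt0//.
  by rewrite lef_pV2 ?posrE//; case/andP: sab.
have thE s t : box a b s -> box a b t -> `|th s t| <= b * E.
  by move=> sab tab; rewrite normrM ler_pM ?nb ?phiE.
have th1E s t : box a b s -> box a b t -> `|th1 s t| <= b * E / a.
  by move=> sab tab; rewrite !normrM ler_pM ?mulr_ge0 ?na// ler_pM ?nb ?phiE.
have K0 : 0 <= K by rewrite /K /K1; lra.
have lipth s t s' t' : box a b s -> box a b t -> box a b s' -> box a b t' ->
    `|th s' t' - th s t| <= K * (`|s' - s| + `|t' - t|).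
  move=> sab tab sab' tab'.
  have -> : th s' t' - th s t = (th s' t' - th s t') + (th s t' - th s t) by ring.
  rewrite mulrDr; apply: le_trans (ler_normD _ _) _; apply: lerD.
    apply: (@derive_lip _ (th^~ t') (th1^~ t') K a b) => // [x xab|x xab].
      by apply: is_derive_th_l; exact: pos.
    by apply: le_trans (th1E _ _ _ _) _ => //; rewrite /K /K1; lra.
  apply: (@derive_lip _ (th s) (th1^~ s) K a b) => // [x xab|x xab].
    by apply: is_derive_th_r; exact: pos.
  by apply: le_trans (th1E _ _ _ _) _ => //; rewrite /K /K1; lra.
have lipth1 s t s' t' : box a b s -> box a b t -> box a b s' -> box a b t' ->
    `|th1 s' t' - th1 s t| <= K * (`|s' - s| + `|t' - t|).
  move=> sab tab sab' tab'.
  have -> : th1 s' t' - th1 s t = (th1 s' t' - th1 s t') + (th1 s t' - th1 s t) by ring.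
  rewrite mulrDr; apply: le_trans (ler_normD _ _) _; apply: lerD.
    pose d (x : R) := t' * phi 2 (ln x - ln t') * x^-1 * x^-1
      - t' * phi 1 (ln x - ln t') * x^-1 * x^-1.
    apply: (@derive_lip _ (th1^~ t') d K a b) => // [x xab|x xab].
      have x0 := pos _ xab.
      have d1 := is_deriveB_fun (is_derive1_ln x0) (is_derive_cst (ln t') x 1).
      have d2 := @is_derive_comp_fun R (phi 1) (fun s => ln s - ln t') x _ _
        (is_derive_phi 1 (ln x - ln t')) d1.
      have xn0 : id x != 0 by rewrite gt_eqF.
      have d3 := is_deriveM_fun (is_deriveZ_fun t' d2) (is_deriveV xn0 (is_derive_id x 1)).
      by apply: (is_derive_eq d3); rewrite /d /GRing.scale /=; field.
    have H k : `|t' * phi k (ln x - ln t') * x^-1 * x^-1| <= b * E / a / a.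
      rewrite normrM ler_pM ?na// normrM ler_pM ?na// normrM ler_pM ?nb ?phiE//.
    rewrite /d; apply: le_trans (ler_normB _ _) _; apply: le_trans (lerD (H _) (H _)) _.
    have -> : b * E / a / a + b * E / a / a = 2 * b * E / a ^+ 2.
      by field; rewrite gt_eqF.
    by rewrite /K /K1; lra.
  pose d (x : R) := (phi 1 (ln s - ln x) - phi 2 (ln s - ln x)) * s^-1.
  apply: (@derive_lip _ (th1 s) d K a b) => // [x xab|x xab].
    have x0 := pos _ xab.
    have d1 := is_deriveB_fun (is_derive_cst (ln s) x 1) (is_derive1_ln x0).
    have d2 := @is_derive_comp_fun R (phi 1) (fun t => ln s - ln t) x _ _
      (is_derive_phi 1 (ln s - ln x)) d1.
    have d3 := is_deriveM_fun (is_deriveM_fun (is_derive_id x 1) d2)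
      (is_derive_cst s^-1 x 1).
    by apply: (is_derive_eq d3); rewrite /d /=; field; rewrite !gt_eqF ?pos.
  rewrite /d normrM; apply: (@le_trans _ _ (2 * E / a)); last by rewrite /K /K1; lra.
  rewrite ler_pM ?na//; apply: le_trans (ler_normB _ _) _.
  by rewrite mulr_natl mulr2n lerD ?phiE.
exists K => // s t sab tab; split.
- by apply: le_trans (thE _ _ _ _) _ => //; rewrite /K /K1; lra.
- by apply: le_trans (th1E _ _ _ _) _ => //; rewrite /K /K1; lra.
move=> s' t' sab' tab'; split; [exact: lipth|exact: lipth1|].
pose D := `|s' - s| + `|t' - t|.
pose f (y : R) := s + y * (s' - s).
pose g (y : R) := t + y * (t' - t).
have fab y : 0 <= y <= 1 -> box a b (f y).
  move: sab sab' => /andP[? ?] /andP[? ?] /andP[y0 y1]; rewrite /f /box.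
  by apply/andP; split; nra.
have gab y : 0 <= y <= 1 -> box a b (g y).
  move: tab tab' => /andP[? ?] /andP[? ?] /andP[y0 y1]; rewrite /g /box.
  by apply/andP; split; nra.
have dl (c e y : R) : is_derive y 1 (fun y => c + y * e) e.
  have d1 := is_deriveM_fun (is_derive_id y 1) (is_derive_cst e y 1).
  apply: (is_derive_eq (is_deriveD_fun (is_derive_cst c y 1) d1)).
  by rewrite /=; ring.
have dh (y : R) : 0 <= y <= 1 -> is_derive y 1 (fun y => th (f y) (g y))
    (th1 (f y) (g y) * (s' - s) + th1 (g y) (f y) * (t' - t)).
  by move=> y01; apply: is_derive_th; rewrite ?pos ?fab ?gab//; exact: dl.
have dh' (y : R) (y01 : 0 < y < 1) : _ := dh y (subset_itv_oo_cc y01).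
have ch (y : R) (y01 : 0 <= y <= 1) := is_derive_continuous (dh y y01).
have [y y01] := MVT_at ler01 dh' ch.
have f0 : f 0 = s by rewrite /f mul0r addr0.
have f1 : f 1 = s' by rewrite /f mul1r addrC subrK.
have g0 : g 0 = t by rewrite /g mul0r addr0.
have g1 : g 1 = t' by rewrite /g mul1r addrC subrK.
rewrite f0 f1 g0 g1 subr0 mulr1 => ->.
have -> : th1 (f y) (g y) * (s' - s) + th1 (g y) (f y) * (t' - t)
   - th1 s t * (s' - s) - th1 t s * (t' - t) =
   (th1 (f y) (g y) - th1 s t) * (s' - s) + (th1 (g y) (f y) - th1 t s) * (t' - t).
  by ring.
have [y0 y1] := andP y01.
have fs : `|f y - s| <= `|s' - s|.
  by rewrite /f addrC addKr normrM ger0_norm// ler_piMl.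
have gt : `|g y - t| <= `|t' - t|.
  by rewrite /g addrC addKr normrM ger0_norm// ler_piMl.
have h1 : `|th1 (f y) (g y) - th1 s t| <= K * D.
  apply: le_trans (lipth1 _ _ _ _ _ _ _ _) _ => //; [exact: fab|exact: gab|].
  by rewrite ler_wpM2l// lerD.
have h2 : `|th1 (g y) (f y) - th1 t s| <= K * D.
  apply: le_trans (lipth1 _ _ _ _ _ _ _ _) _ => //; [exact: gab|exact: fab|].
  by rewrite ler_wpM2l// /D [leRHS]addrC lerD.
apply: le_trans (ler_normD _ _) _; rewrite !normrM.
have -> : 2 * K * (`|s' - s| + `|t' - t|) ^+ 2 = K * D * D + K * D * D by rewrite /D; ring.
by apply: lerD; apply: ler_pM => //; rewrite /D ?lerDl ?lerDr.
Qed.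

Lemma log_mean0 s t : 0 <= s -> 0 <= t -> (s == 0) || (t == 0) -> log_mean s t = 0.
Proof.
move=> s0 t0 st0; rewrite /log_mean.
pose f (p : R) := s `^ (1 - p) * t `^ p.
have f0 (p : R) : 0 < p < 1 -> f p = 0.
  move=> /andP[p0 p1]; rewrite /f; case/orP: st0 => /eqP ->.
    by rewrite powR0 ?mul0r// subr_eq0 gt_eqF.
  by rewrite [X in _ * X]powR0 ?mulr0// gt_eqF.
rewrite /Rintegral.
have mf : measurable_fun (`]0, 1[ : set R) f.
  apply: (eq_measurable_fun (fun _ : R => 0 : R)) => [p|]; last exact: measurable_cst.
  by rewrite inE/= in_itv/= => /f0 ->.
rewrite integral_itv_bndoo; last exact/measurable_EFinP.
rewrite (eq_integral (fun _ => 0%E)) ?integral0// => p; rewrite inE/= in_itv/=.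
by move=> /f0; rewrite /f => ->.
Qed.

Lemma continuous_phi k : continuous (phi k).
Proof. by move=> z; exact: is_derive_continuous (is_derive_phi k z). Qed.

Lemma log_mean_ge0 s t : 0 <= log_mean s t.
Proof. by apply: Rintegral_ge0 => p _; rewrite mulr_ge0 ?powR_ge0. Qed.

Lemma measurable_log_mean d (T : measurableType d) (D : set T) (f g : T -> R) :
  measurable D -> measurable_fun D f -> measurable_fun D g ->
  (forall w, D w -> 0 <= f w) -> (forall w, D w -> 0 <= g w) ->
  measurable_fun D (fun w => log_mean (f w) (g w)).
Proof.
move=> mD mf mg f0 g0.
apply: (eq_measurable_fun (fun w => if (0 < f w) && (0 < g w) then th (f w) (g w) else 0)).
  move=> x; rewrite inE => Dx; case: ifPn => [/andP[fx gx]|]; first by rewrite log_meanE.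
  rewrite negb_and -!leNgt => fg; rewrite log_mean0 ?f0 ?g0//.
  by rewrite !eq_le f0 ?g0// !andbT.
apply: measurable_fun_if => //=.
- by apply: measurable_and; apply: measurable_fun_ltr.
- apply: (@measurable_funS _ _ _ _ D) => //.
  apply: measurable_funM => //.
  apply: (measurableT_comp (continuous_measurable_fun (@continuous_phi 0))).
  by apply: measurable_funB; apply: measurableT_comp.
Qed.

End LogMean.

(** * Closure properties of absolutely continuous functions *)

Section AbsolutelyContinuousAlgebra.
Context {R : realType}.
Notation mu := (@lebesgue_measure R).
Implicit Types (f g h : R -> R).
Local Notation AC := (@absolutely_continuous01 R).

Lemma ac_dominated (K : R) f g h : AC f -> AC g ->
  (forall u v, 0 <= u <= 1 -> 0 <= v <= 1 ->
    `|h v - h u| <= K * (`|f v - f u| + `|g v - g u|)) -> AC h.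
Proof.
move=> acf acg hK e e0.
pose K' := `|K| + 1; have K'0 : 0 < K' by rewrite ltr_wpDl.
have e'0 : 0 < e / (2 * K') by rewrite divr_gt0// mulr_gt0.
have [d1 d10 fd] := acf _ e'0; have [d2 d20 gd] := acg _ e'0.
exists (Num.min d1 d2); first by rewrite lt_min d10.
move=> n a b ab dis; rewrite lt_min => /andP[s1 s2].
have := fd n a b ab dis s1; have := gd n a b ab dis s2 => Hg Hf.
have : \sum_i `|h (b i) - h (a i)| <=
    K' * (\sum_i `|f (b i) - f (a i)| + \sum_i `|g (b i) - g (a i)|).
  rewrite -big_split/= mulr_sumr; apply: ler_sum => i _.
  have [ai abi bi] := ab i.
  apply: le_trans (hK _ _ _ _) _.
  - by rewrite ai (le_trans abi).
  - by rewrite bi (le_trans ai).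
  - by rewrite ler_wpM2r ?addr_ge0// (le_trans (ler_norm _))// lerDl.
move=> /le_lt_trans; apply.
rewrite -ltr_pdivlMl//; apply: lt_le_trans (ltrD Hf Hg) _.
by rewrite le_eqVlt; apply/orP; left; apply/eqP; field; rewrite gt_eqF.
Qed.

Lemma ac_id : AC id.
Proof.
move=> e e0; exists e => // n a b ab _ /le_lt_trans; apply.
by apply: ler_sum => i _; have [_ abi _] := ab i; rewrite ger0_norm ?subr_ge0.
Qed.

Lemma ac_lipschitz (K : R) f :
  (forall u v, 0 <= u <= 1 -> 0 <= v <= 1 -> `|f v - f u| <= K * `|v - u|) -> AC f.
Proof.
move=> fK; apply: (@ac_dominated `|K| id id) => [||u v u01 v01]; try exact: ac_id.
apply: le_trans (fK u v u01 v01) _.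
apply: le_trans (_ : `|K| * `|v - u| <= _); first by rewrite ler_wpM2r// ler_norm.
by rewrite ler_wpM2l// lerDl.
Qed.

Lemma ac_cst (c : R) : AC (fun _ => c).
Proof. by apply: (@ac_lipschitz 0) => u v _ _; rewrite subrr normr0 mul0r. Qed.

Lemma acD f g : AC f -> AC g -> AC (fun t => f t + g t).
Proof.
move=> acf acg; apply: (@ac_dominated 1 f g) => // u v _ _.
by rewrite mul1r opprD addrACA ler_normD.
Qed.

Lemma ac_sum (I : finType) (F : I -> R -> R) :
  (forall i, AC (F i)) -> AC (fun t => \sum_i F i t).
Proof.
move=> acF; elim: (index_enum I) => [|i s IH].
  have -> : (fun t => \sum_(i <- [::]) F i t) = fun=> 0.
    by apply/funext => t; rewrite big_nil.
  exact: ac_cst.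
have -> : (fun t => \sum_(j <- i :: s) F j t) = fun t => F i t + \sum_(j <- s) F j t.
  by apply/funext => t; rewrite big_cons.
exact: acD.
Qed.

Lemma ac_continuous f : AC f -> {within `[0, 1], continuous f}.
Proof.
move=> acf; apply/subspace_continuousP => x /=; rewrite in_itv/= => /andP[x0 x1].
apply/cvgrPdist_lt => e e0; have [d d0 fd] := acf e e0.
have H u v : 0 <= u -> u <= v -> v <= 1 -> v - u < d -> `|f v - f u| < e.
  move=> u0 uv v1 vud.
  have := fd 1 (fun=> u) (fun=> v); rewrite !big_ord_recl !big_ord0 !addr0.
  by apply=> // i j; rewrite !ord1 eqxx.
rewrite /fmap/=; near=> y.
have y01 : 0 <= y <= 1 by near: y; exact: withinT.
have yd : `|x - y| < d.
  by near: y; apply: cvg_within; exists d.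
have /andP[y0 y1] := y01; have [yx|xy] := leP y x.
  by apply: H => //; move: yd; rewrite ger0_norm// subr_ge0.
by rewrite distrC; apply: H => //; move: yd; rewrite ltr0_norm ?opprB// ?subr_lt0// ltW.
Unshelve. all: by end_near. Qed.

Lemma ac_bounded f : AC f -> exists2 B : R, 0 <= B & forall t, 0 <= t <= 1 -> `|f t| <= B.
Proof.
move=> /ac_continuous cf.
have cnf : {within `[0, 1], continuous (fun t => `|f t|)}.
  by move=> t; apply: continuous_comp; [exact: cf|exact: norm_continuous].
have [c _ fc] := EVT_max ler01 cnf.
by exists `|f c| => // t t01; apply: fc; rewrite in_itv.
Qed.

Lemma acM f g : AC f -> AC g -> AC (fun t => f t * g t).
Proof.
move=> acf acg; have [A A0 fA] := ac_bounded acf; have [B B0 gB] := ac_bounded acg.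
apply: (@ac_dominated (A + B) f g) => // u v u01 v01.
have -> : f v * g v - f u * g u = f v * (g v - g u) + (f v - f u) * g u by ring.
apply: le_trans (ler_normD _ _) _; rewrite !normrM mulrDr addrC.
apply: lerD; first by rewrite mulrC ler_wpM2r// (le_trans (gB _ u01))// lerDr.
by rewrite ler_wpM2r// (le_trans (fA _ v01))// lerDl.
Qed.

Lemma max_diff (m x y : R) : `|Num.max x m - Num.max y m| <= `|x - y|.
Proof.
rewrite /Num.max; case: ltP => xm; case: ltP => ym; rewrite ?subrr ?normr0//.
  by rewrite ler0_norm ?subr_le0// ltr0_norm ?subr_lt0 ?(lt_le_trans xm)//; lra.
by rewrite ger0_norm ?subr_ge0// gtr0_norm ?subr_gt0 ?(lt_le_trans ym)//; lra.
Qed.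

Lemma ac_max (m : R) f : AC f -> AC (fun t => Num.max (f t) m).
Proof.
move=> acf; apply: (@ac_dominated 1 f f) => // u v _ _.
by rewrite mul1r (le_trans (max_diff _ _ _))// lerDl.
Qed.

End AbsolutelyContinuousAlgebra.

(** * Geodesics and calibrations *)

Section EdgeSums.
Context {R : realType} {X : finType}.
Variables (Q : X -> X -> R) (pi : X -> R).
Hypothesis Q0 : forall x y, 0 <= Q x y.
Hypothesis pi0 : forall x, 0 < pi x.
Hypothesis Qrev : reversible Q pi.
Implicit Types (T : X -> X -> R) (f : X -> R).

Definition dsum T : R := \sum_x \sum_y Q x y * pi x * T x y.

Lemma eq_dsum T T' : (forall x y, T x y = T' x y) -> dsum T = dsum T'.
Proof. by move=> TT; apply: eq_bigr => x _; apply: eq_bigr => y _; rewrite TT. Qed.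

Lemma dsum_swap T : dsum T = dsum (fun x y => T y x).
Proof.
rewrite /dsum exchange_big; apply: eq_bigr => x _; apply: eq_bigr => y _.
by rewrite Qrev.
Qed.

Lemma dsumD T T' : dsum (fun x y => T x y + T' x y) = dsum T + dsum T'.
Proof.
rewrite -big_split; apply: eq_bigr => x _; rewrite -big_split.
by apply: eq_bigr => y _; rewrite mulrDr.
Qed.

Lemma dsumZ (c : R) T : dsum (fun x y => c * T x y) = c * dsum T.
Proof.
rewrite mulr_sumr; apply: eq_bigr => x _; rewrite mulr_sumr.
by apply: eq_bigr => y _; rewrite mulrCA.
Qed.

Lemma dsumN T : dsum (fun x y => - T x y) = - dsum T.
Proof. by rewrite -mulN1r -dsumZ; apply: eq_dsum => x y; rewrite mulN1r. Qed.

Lemma dsumB T T' : dsum (fun x y => T x y - T' x y) = dsum T - dsum T'.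
Proof. by rewrite dsumD dsumN. Qed.

Lemma dsum_le T T' : (forall x y, T x y <= T' x y) -> dsum T <= dsum T'.
Proof.
move=> TT; apply: ler_sum => x _; apply: ler_sum => y _.
by rewrite ler_wpM2l// mulr_ge0// ltW.
Qed.

Lemma dsum_ge0 T : (forall x y, 0 <= T x y) -> 0 <= dsum T.
Proof.
move=> T0; do 2 (apply: sumr_ge0 => ? _).
by rewrite !mulr_ge0// ltW.
Qed.

Lemma dsumE T f : \sum_x pi x * (f x * \sum_y Q x y * T x y) =
  dsum (fun x y => T x y * f x).
Proof.
apply: eq_bigr => x _; rewrite !mulr_sumr; apply: eq_bigr => y _; ring.
Qed.

(** Discrete integration by parts: reversibility allows the endpoints of an edge to be exchanged,
    and the two halves are averaged. *)
Lemma dsum_antisym T f : (forall x y, T y x = - T x y) ->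
  \sum_x pi x * (f x * \sum_y Q x y * T x y) =
  2^-1 * dsum (fun x y => T x y * (f x - f y)).
Proof.
move=> TN; rewrite dsumE.
have -> : dsum (fun x y => T x y * (f x - f y)) =
    dsum (fun x y => T x y * f x) + dsum (fun x y => T x y * f x).
  rewrite [X in _ + X]dsum_swap -dsumD; apply: eq_dsum => x y.
  by rewrite TN; ring.
by field.
Qed.

Lemma is_derive_dsum (T : R -> X -> X -> R) (T' : X -> X -> R) (t : R) :
  (forall x y, is_derive t 1 (fun t => T t x y) (T' x y)) ->
  is_derive t 1 (fun t => dsum (T t)) (dsum T').
Proof.
move=> dT; apply: is_derive_sum_fun => x; apply: is_derive_sum_fun => y.
Qed.

Lemma continuous_dsum (T : R -> X -> X -> R) (t : R) :
  (forall x y, {for t, continuous (fun t => T t x y)}) ->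
  {for t, continuous (fun t => dsum (T t))}.
Proof.
move=> cT; apply: continuous_sum_at => x; apply: continuous_sum_at => y.
by apply: cvgM; [exact: cvg_cst|exact: cT].
Qed.

End EdgeSums.

(** * Local solutions of the geodesic equations *)

Section Flow.
Context {R : realType} {X : finType}.
Variables (Q : X -> X -> R) (pi : X -> R).
Hypothesis Q0 : forall x y, 0 <= Q x y.
Hypothesis pi0 : forall x, 0 < pi x.
Hypothesis Qrev : reversible Q pi.
Implicit Types (r p f g : X -> R).

(** The squared gradient in the transport metric at the density [r], polarised. *)
Definition grad_form r f g : R :=
  2^-1 * dsum Q pi (fun x y => th (r x) (r y) * ((f x - f y) * (g x - g y))).

Definition density_drift r p x : R := \sum_y Q x y * (th (r x) (r y) * (p x - p y)).

(** Minus the derivative of [grad_form r p p / 2] in the coordinate [r x], divided by [pi x]. Each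
    edge at [x] occurs in both orientations, which turns the coefficient [4^-1] into [2^-1]. *)
Definition pdot r p x : R :=
  \sum_y Q x y * (- (2^-1) * (th1 (r x) (r y) * (p x - p y) ^+ 2)).

(* Hamilton's equations of [grad_form r p p / 2], on [[0, tau]]; the density
   keeps the margin [a] from the ends of the box [[a, b]]. *)
Definition flow (a b M tau : R) (r p : R -> X -> R) : Prop :=
  [/\ forall x, continuous (r^~ x), forall x, continuous (p^~ x),
      forall t x, 0 <= t <= tau -> box (a + a) (b - a) (r t x),
      forall t x, 0 <= t <= tau -> `|p t x| <= M &
      forall (t : R) x, 0 < t < tau ->
        is_derive t 1 (r^~ x) (density_drift (r t) (p t) x) /\
        is_derive t 1 (p^~ x) (pdot (r t) (p t) x)].

Definition clamp (lo hi s : R) : R := Num.max (Num.min s hi) lo.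

Lemma clamp_diff lo hi s t : `|clamp lo hi s - clamp lo hi t| <= `|s - t|.
Proof.
apply: le_trans (max_diff _ _ _) _.
have mE u : Num.min u hi = - Num.max (- u) (- hi) by rewrite oppr_max !opprK.
rewrite !mE opprK addrC; apply: le_trans (max_diff _ _ _) _.
by rewrite opprK addrC.
Qed.

Lemma clamp_box lo hi s : lo <= hi -> box lo hi (clamp lo hi s).
Proof.
by move=> lh; rewrite /box /clamp le_max lexx orbT ge_max lh andbT ge_min lexx orbT.
Qed.

Lemma clamp_id lo hi s : box lo hi s -> clamp lo hi s = s.
Proof. by move=> /andP[ls sh]; rewrite /clamp min_l// max_l. Qed.

(* Clamping makes the field globally Lipschitz; its solution obeys the original
   equations until it leaves the box. *)
Definition clamped_field (a b M : R) (u : X + X -> R) (i : X + X) : R :=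
  let r x := clamp a b (u (inl x)) in
  let p x := clamp (- M) M (u (inr x)) in
  match i with inl x => density_drift r p x | inr x => pdot r p x end.

Lemma clamped_field_lip (a b M : R) : 0 < a -> a <= b -> 0 <= M ->
  exists2 L : R, 0 < L & forall u v i,
    `|clamped_field a b M u i - clamped_field a b M v i| <= L * \sum_j `|u j - v j|.
Proof.
move=> a0 ab M0; have [K K0 HK] := th_box a0 ab.
(* The first two summands serve the drift, the rest the momentum field. On the box, [K] bounds [th],
   [th1] and their Lipschitz constants; momentum differences are at most [M + M]. *)
pose c := K * 2 * (M + M) + K * 2 + (K * 2 * (M + M) ^+ 2 + K * (4 * (M + M))).
have c0 : 0 <= c by rewrite /c; nra.
pose q := \sum_x \sum_y Q x y.
have q0 : 0 <= q by do 2 apply: sumr_ge0 => ? _.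
exists (q * c + 1) => [|u v i]; first by rewrite ltr_wpDl// mulr_ge0.
pose S := \sum_j `|u j - v j|.
have S0 : 0 <= S by apply: sumr_ge0.
have jS j : `|u j - v j| <= S by rewrite /S (bigD1 j)//= lerDl sumr_ge0.
pose r (u : X + X -> R) x := clamp a b (u (inl x)).
pose p (u : X + X -> R) x := clamp (- M) M (u (inr x)).
have rS x : `|r u x - r v x| <= S by apply: le_trans (clamp_diff _ _ _ _) _.
have pS x : `|p u x - p v x| <= S by apply: le_trans (clamp_diff _ _ _ _) _.
have rb u' x : box a b (r u' x) by exact: clamp_box.
have pM u' x : `|p u' x| <= M.
  have : box (- M) M (p u' x) by apply: clamp_box; lra.
  by rewrite ler_norml.
have dM u' x y : `|p u' x - p u' y| <= M + M.
  by apply: le_trans (ler_normB _ _) _; rewrite lerD.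
have dS x y : `|(p u x - p u y) - (p v x - p v y)| <= 2 * S.
  have -> : (p u x - p u y) - (p v x - p v y) = (p u x - p v x) - (p u y - p v y) by ring.
  by apply: le_trans (ler_normB _ _) _; rewrite mulr_natl mulr2n lerD.
have rS2 x y : `|r u x - r v x| + `|r u y - r v y| <= 2 * S.
  by rewrite mulr_natl mulr2n lerD.
have sumq x (F G : X -> R) : (forall y, `|F y - G y| <= c * S) ->
    `|\sum_y Q x y * F y - \sum_y Q x y * G y| <= (q * c + 1) * S.
  move=> FG; rewrite -sumrB; apply: le_trans (ler_norm_sum _ _ _) _.
  apply: (@le_trans _ _ (\sum_y Q x y * (c * S))).
    apply: ler_sum => y _; rewrite -mulrBr normrM ger0_norm//.
    by rewrite ler_wpM2l.
  rewrite -mulr_suml; apply: (@le_trans _ _ (q * (c * S))); last first.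
    have -> : (q * c + 1) * S = q * (c * S) + S by ring.
    by rewrite lerDl; exact: S0.
  apply: (ler_wpM2r (mulr_ge0 c0 S0)).
  rewrite /q [leRHS](bigD1 x)//= lerDl sumr_ge0// => ? _.
  exact: sumr_ge0.
case: i => x; apply: sumq => y.
  rewrite -/(r u x) -/(r u y) -/(r v x) -/(r v y) -/(p u x) -/(p u y) -/(p v x) -/(p v y).
  have [t1 _ _] := HK _ _ (rb u x) (rb u y).
  have [tv1 tv2 Hv] := HK _ _ (rb v x) (rb v y).
  have [tl tl1 _] := Hv _ _ (rb u x) (rb u y).
  set A := th (r u x) (r u y); set B := th (r v x) (r v y).
  set d := p u x - p u y; set e := p v x - p v y.
  have -> : A * d - B * e = (A - B) * d + B * (d - e) by ring.
  apply: le_trans (ler_normD _ _) _; rewrite (normrM (A - B)) (normrM B).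
  have h1 : `|A - B| * `|d| <= K * (2 * S) * (M + M).
    by apply: ler_pM => //; [apply: le_trans tl _; exact: ler_wpM2l|exact: dM].
  have h2 : `|B| * `|d - e| <= K * (2 * S) by apply: ler_pM => //; exact: dS.
  apply: le_trans (lerD h1 h2) _; rewrite /c.
  have -> : K * (2 * S) * (M + M) + K * (2 * S) = (K * 2 * (M + M) + K * 2) * S by ring.
  by rewrite (ler_wpM2r S0)// lerDl; nra.
rewrite -/(r u x) -/(r u y) -/(r v x) -/(r v y) -/(p u x) -/(p u y) -/(p v x) -/(p v y).
have [t1 _ _] := HK _ _ (rb u x) (rb u y).
have [tv1 tv2 Hv] := HK _ _ (rb v x) (rb v y).
have [tl tl1 _] := Hv _ _ (rb u x) (rb u y).
set A := th1 (r u x) (r u y); set B := th1 (r v x) (r v y).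
set d := p u x - p u y; set e := p v x - p v y.
have -> : - (2^-1) * (A * d ^+ 2) - - (2^-1) * (B * e ^+ 2) =
  - (2^-1) * ((A - B) * d ^+ 2 + B * ((d - e) * (d + e))) by ring.
rewrite normrM normrN (ger0_norm (_ : 0 <= 2^-1))//.
apply: (@le_trans _ _ (1 * `|(A - B) * d ^+ 2 + B * ((d - e) * (d + e))|)).
  by rewrite ler_wpM2r// invf_le1// ler1n.
rewrite mul1r.
apply: le_trans (ler_normD _ _) _.
rewrite (normrM (A - B)) (normrM B) (normrM (d - e)).
have h1 : `|A - B| * `|d ^+ 2| <= K * (2 * S) * (M + M) ^+ 2.
  apply: ler_pM => //; first by apply: le_trans tl1 _; exact: ler_wpM2l.
  by rewrite normrX lerXn2r ?nnegrE ?addr_ge0// ?dM// ltW.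
have h2 : `|B| * (`|d - e| * `|d + e|) <= K * (2 * S * (M + M + (M + M))).
  apply: ler_pM; rewrite ?mulr_ge0//; apply: ler_pM => //; first exact: dS.
  by apply: le_trans (ler_normD _ _) _; rewrite lerD// ?dM.
apply: le_trans (lerD h1 h2) _; rewrite -/S /c.
have -> : K * (2 * S) * (M + M) ^+ 2 + K * (2 * S * (M + M + (M + M))) =
  (K * 2 * (M + M) ^+ 2 + K * (4 * (M + M))) * S by ring.
by rewrite (ler_wpM2r S0)// lerDr; nra.
Qed.

Lemma flow_exists r0 p0 : (forall x, 0 < r0 x) ->
  exists (a b M tau : R) (r p : R -> X -> R), [/\ 0 < a, a <= b, 0 < M, 0 < tau &
    [/\ flow a b M tau r p, r 0 = r0 & p 0 = p0]].
Proof.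
move=> r00.
(* The margin is spent in three parts: the flow moves by less than [a], competitors in the tube
   deviate from it by at most [a], and the last [a] keeps them away from the boundary of the
   simplex. *)
have [a a0 ra] : exists2 a : R, 0 < a & forall x, 3 * a <= r0 x.
  exists (3^-1 * \big[Num.min/1]_x r0 x).
    rewrite mulr_gt0 ?invr_gt0//.
    by elim/big_ind : _ => // x y x0 y0; rewrite lt_min x0.
  move=> x; rewrite mulrA divff ?mul1r//.
  by rewrite (bigD1 x)//= ge_min lexx.
pose b := \sum_x r0 x + 4 * a.
pose M := \sum_x `|p0 x| + 1.
have M0 : 0 < M by rewrite ltr_wpDl// sumr_ge0.
have ab : a <= b.
  have : 0 <= \sum_x r0 x by apply: sumr_ge0 => x _; exact: ltW.
  by rewrite /b; lra.
have rb x : r0 x <= b - 4 * a.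
  rewrite /b addrK (bigD1 x)//= lerDl sumr_ge0// => y _; exact: ltW.
have pM x : `|p0 x| <= M - 1.
  by rewrite /M addrK (bigD1 x)//= lerDl sumr_ge0.
have [L L0 HL] := clamped_field_lip a0 ab (ltW M0).
pose u0 (i : X + X) := match i with inl x => r0 x | inr x => p0 x end.
have [u [cu uu0 du]] := cauchy_lipschitz u0 L0 HL.
pose e := Num.min a 1.
have e0 : 0 < e by rewrite lt_min a0 ltr01.
have u_near i : nbhs (0 : R) [set t | `|u 0 i - u t i| < e].
  by have /cvgrPdist_lt/(_ e e0) := cu i 0.
have := @filter_forall _ _ _ _ (nbhs_filter (0 : R)) u_near.
move=> [d /= d0 ud].
exists a, b, M, (d / 2), (fun t x => u t (inl x)), (fun t x => u t (inr x)).
split => //; first by rewrite divr_gt0.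
have Hu t i : 0 <= t <= d / 2 -> `|u0 i - u t i| < e.
  move=> /andP[t0 td]; rewrite -uu0; apply: ud => /=.
  by rewrite sub0r normrN ger0_norm//; lra.
have rt t x : 0 <= t <= d / 2 -> box (a + a) (b - a) (u t (inl x)).
  move=> tt; have := Hu t (inl x) tt; rewrite lt_min /= => /andP[+ _].
  by rewrite ltr_distl => /andP[h1 h2]; have := ra x; have := rb x; rewrite /box; lra.
have pt t x : 0 <= t <= d / 2 -> `|u t (inr x)| <= M.
  move=> tt; have := Hu t (inr x) tt; rewrite lt_min /= => /andP[_ h1].
  have -> : u t (inr x) = p0 x - (p0 x - u t (inr x)) by ring.
  apply: le_trans (ler_normB _ _) _; have := pM x; lra.
split; [split=> //|by apply/funext => x; rewrite uu0|by apply/funext => x; rewrite uu0].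
move=> t x /andP[t0 td].
have tt : 0 <= t <= d / 2 by rewrite !ltW.
have cr : (fun x => clamp a b (u t (inl x))) = (fun x => u t (inl x)).
  apply/funext => y; apply: clamp_id; have := rt t y tt; rewrite /box; lra.
have cp : (fun x => clamp (- M) M (u t (inr x))) = (fun x => u t (inr x)).
  apply/funext => y; apply: clamp_id; have := pt t y tt.
  by rewrite ler_norml.
have := du t (inl x) t0; have := du t (inr x) t0.
by rewrite /clamped_field cr cp.
Qed.

End Flow.

(** * Continuity of the logarithmic mean along curves *)

Section ContinuousLogMean.
Context {R : realType}.

Lemma continuous_th (f g : R -> R) (t : R) : 0 < f t -> 0 < g t ->
  {for t, continuous f} -> {for t, continuous g} ->
  {for t, continuous (fun s => th (f s) (g s))}.
Proof.
move=> f0 g0 cf cg.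
apply: cvgM; first exact: cg.
apply: (@continuous_comp _ _ _ (fun s => ln (f s) - ln (g s)) (phi 0)); last first.
  exact: continuous_phi.
apply: cvgB.
  apply: (@continuous_comp _ _ _ f (@ln R)) => //.
  exact: is_derive_continuous (is_derive1_ln f0).
apply: (@continuous_comp _ _ _ g (@ln R)) => //.
exact: is_derive_continuous (is_derive1_ln g0).
Qed.

Lemma continuous_th1 (f g : R -> R) (t : R) : 0 < f t -> 0 < g t ->
  {for t, continuous f} -> {for t, continuous g} ->
  {for t, continuous (fun s => th1 (f s) (g s))}.
Proof.
move=> f0 g0 cf cg.
apply: cvgM; last by apply: cvgV; [rewrite gt_eqF|exact: cf].
apply: cvgM; first exact: cg.
apply: (@continuous_comp _ _ _ (fun s => ln (f s) - ln (g s)) (phi 1)); last first.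
  exact: continuous_phi.
apply: cvgB.
  apply: (@continuous_comp _ _ _ f (@ln R)) => //.
  exact: is_derive_continuous (is_derive1_ln f0).
apply: (@continuous_comp _ _ _ g (@ln R)) => //.
exact: is_derive_continuous (is_derive1_ln g0).
Qed.

End ContinuousLogMean.

(** * The Hamilton-Jacobi residual *)

Section Calibration.
Context {R : realType} {X : finType}.
Variables (Q : X -> X -> R) (pi : X -> R).
Hypothesis Q0 : forall x y, 0 <= Q x y.
Hypothesis pi0 : forall x, 0 < pi x.
Hypothesis pi1 : \sum_x pi x = 1.
Hypothesis Qrev : reversible Q pi.
Local Notation dsum := (dsum Q pi).
Local Notation grad_form := (grad_form Q pi).
Local Notation rdot := (density_drift Q).
Local Notation pdot := (pdot Q).

Lemma rdot_form (r p f : X -> R) : (forall x, 0 < r x) ->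
  \sum_x pi x * (f x * rdot r p x) = grad_form r p f.
Proof.
move=> r0; rewrite /rdot /grad_form (dsum_antisym Qrev); last first.
  by move=> x y; rewrite thC//; ring.
by congr (_ * _); apply: eq_dsum => x y; ring.
Qed.

Lemma pdot_form (r p f : X -> R) :
  \sum_x pi x * (f x * pdot r p x) = - (4^-1) *
  dsum (fun x y => (th1 (r x) (r y) * f x + th1 (r y) (r x) * f y) * (p x - p y) ^+ 2).
Proof.
rewrite /pdot dsumE.
have -> : dsum (fun x y => (th1 (r x) (r y) * f x + th1 (r y) (r x) * f y) * (p x - p y) ^+ 2) =
  dsum (fun x y => th1 (r x) (r y) * f x * (p x - p y) ^+ 2) +
  dsum (fun x y => th1 (r x) (r y) * f x * (p x - p y) ^+ 2).
  rewrite [X in _ + X](dsum_swap Qrev) -dsumD; apply: eq_dsum => x y; ring.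
rewrite -dsumD -dsumZ; apply: eq_dsum => x y; by field.
Qed.

(* The Hamilton-Jacobi residual of the calibration at [r + d]: the terms of
   order 0 and 1 in [d] cancel by the flow equations, and [C1] absorbs the
   remainder. *)
Lemma residual_le (a b M K C C1 : R) (r p d : X -> R) :
  0 < a -> a <= b -> 0 <= M -> 0 <= K -> 0 <= C ->
  (forall s t, box a b s -> box a b t ->
    [/\ `|th s t| <= K, `|th1 s t| <= K &
    forall s' t', box a b s' -> box a b t' ->
    [/\ `|th s' t' - th s t| <= K * (`|s' - s| + `|t' - t|),
       `|th1 s' t' - th1 s t| <= K * (`|s' - s| + `|t' - t|) &
       `|th s' t' - th s t - th1 s t * (s' - s) - th1 t s * (t' - t)|
         <= 2 * K * (`|s' - s| + `|t' - t|) ^+ 2] ]) ->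
  (forall x, box (a + a) (b - a) (r x)) -> (forall x, `|p x| <= M) ->
  (forall x, `|d x| <= a) ->
  2 * (K * (8 * M ^+ 2 + 4 * C * M + C ^+ 2)) * (\sum_x \sum_y Q x y) <= C1 ->
  grad_form r p p / 2 + \sum_x pi x * (pdot r p x * d x - p x * rdot r p x
    - C1 / 2 * d x ^+ 2 + C * d x * rdot r p x)
  + 2^-1 * grad_form (fun x => r x + d x) (fun x => p x - C * d x) (fun x => p x - C * d x)
  <= 0.
Proof.
move=> a0 ab M0 K0 C0 HK rb pM da hC1.
have r0 x : 0 < r x by have /andP[h _] := rb x; lra.
have rab x : box a b (r x) by have /andP[h h'] := rb x; rewrite /box; lra.
have rdab x : box a b (r x + d x).
  have /andP[h h'] := rb x; have := da x; rewrite ler_norml /box => /andP[]; lra.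
have -> : \sum_x pi x * (pdot r p x * d x - p x * rdot r p x
    - C1 / 2 * d x ^+ 2 + C * d x * rdot r p x) =
  \sum_x pi x * (d x * pdot r p x) - \sum_x pi x * (p x * rdot r p x)
  + C * \sum_x pi x * (d x * rdot r p x) - C1 / 2 * \sum_x pi x * d x ^+ 2.
  rewrite !mulr_sumr -!sumrB -big_split -sumrB; apply: eq_bigr => x _ /=; ring.
rewrite pdot_form !rdot_form//.
pose c := 8 * M ^+ 2 + 4 * C * M + C ^+ 2.
have c0 : 0 <= c by rewrite /c; nra.
have Kc0 : 0 <= K * c by exact: mulr_ge0.
(* Up to the factor [4^-1], the residual per edge without its [C1] term: the Taylor remainder of
   [th], then what the correction [- C * d] of the momentum contributes. Each summand is of second
   order in [d]. *)
pose B x y := (th (r x + d x) (r y + d y) - th (r x) (r y)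
    - th1 (r x) (r y) * d x - th1 (r y) (r x) * d y) * (p x - p y) ^+ 2
  - 2 * C * (th (r x + d x) (r y + d y) - th (r x) (r y)) * ((p x - p y) * (d x - d y))
  + C ^+ 2 * (th (r x + d x) (r y + d y) * (d x - d y) ^+ 2).
pose q := \sum_x \sum_y Q x y.
have dB : dsum B <= 4 * (K * c) * q * \sum_x pi x * d x ^+ 2.
  apply: (@le_trans _ _ (dsum (fun x y => 2 * (K * c) * (d x ^+ 2 + d y ^+ 2)))).
    apply: dsum_le => // x y.
    have [_ _ H] := HK _ _ (rab x) (rab y).
    have [tl _ tt] := H _ _ (rdab x) (rdab y).
    have [tb _ _] := HK _ _ (rdab x) (rdab y).
    move: tl tt; rewrite !(addrC (r _) (d _)) !addrK -!(addrC (r _) (d _)).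
    rewrite /B; set T := th (r x + d x) _; set T0 := th (r x) _.
    set s := `|d x| + `|d y|; move=> tl tt.
    have s0 : 0 <= s by rewrite addr_ge0.
    have ps : `|p x - p y| <= 2 * M.
      by apply: le_trans (ler_normB _ _) _; have := pM x; have := pM y; lra.
    have ds : `|d x - d y| <= s by exact: ler_normB.
    have s2 : s ^+ 2 <= 2 * (d x ^+ 2 + d y ^+ 2).
      rewrite -(real_normK (num_real (d x))) -(real_normK (num_real (d y))) /s.
      by have := sqr_ge0 (`|d x| - `|d y|); nra.
    have e1 : (T - T0 - th1 (r x) (r y) * d x - th1 (r y) (r x) * d y) * (p x - p y) ^+ 2
       <= 2 * K * s ^+ 2 * (2 * M) ^+ 2.
      apply: le_trans (ler_norm _) _; rewrite normrM ler_pM//.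
      by rewrite normrX lerXn2r// nnegrE mulr_ge0.
    have e2 : - (2 * C * (T - T0) * ((p x - p y) * (d x - d y))) <=
        2 * C * (K * s) * (2 * M * s).
      apply: le_trans (ler_norm _) _; rewrite normrN !normrM.
      rewrite (ger0_norm (_ : 0 <= 2))// (ger0_norm C0).
      by rewrite !ler_pM ?mulr_ge0.
    have e3 : C ^+ 2 * (T * (d x - d y) ^+ 2) <= C ^+ 2 * (K * s ^+ 2).
      rewrite ler_wpM2l ?exprn_ge0//; apply: le_trans (ler_norm _) _.
      by rewrite normrM ler_pM// normrX lerXn2r// nnegrE.
    apply: le_trans (lerD (lerD e1 e2) e3) _.
    have -> : 2 * K * s ^+ 2 * (2 * M) ^+ 2 + 2 * C * (K * s) * (2 * M * s) +
      C ^+ 2 * (K * s ^+ 2) = K * c * s ^+ 2 by rewrite /c; ring.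
    by apply: le_trans (ler_wpM2l Kc0 s2) _; rewrite le_eqVlt; apply/orP; left; apply/eqP; ring.
  rewrite dsumZ dsumD.
  have -> : dsum (fun _ y => d y ^+ 2) = dsum (fun x _ => d x ^+ 2) by rewrite (dsum_swap Qrev).
  have h : dsum (fun x _ => d x ^+ 2) <= q * \sum_x pi x * d x ^+ 2.
    rewrite mulr_sumr; apply: ler_sum => x _.
    have -> : \sum_y Q x y * pi x * d x ^+ 2 = (\sum_y Q x y) * (pi x * d x ^+ 2).
      by rewrite mulr_suml; apply: eq_bigr => y _; rewrite mulrA.
    apply: ler_wpM2r; first by rewrite mulr_ge0 ?exprn_even_ge0// ltW.
    by rewrite /q [leRHS](bigD1 x)//= lerDl sumr_ge0// => ? _; exact: sumr_ge0.
  have -> : 4 * (K * c) * q * \sum_x pi x * d x ^+ 2 =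
    2 * (K * c) * (q * \sum_x pi x * d x ^+ 2 + q * \sum_x pi x * d x ^+ 2) by ring.
  by rewrite ler_wpM2l ?mulr_ge0// lerD.
have D0 : 0 <= \sum_x pi x * d x ^+ 2.
  by apply: sumr_ge0 => x _; rewrite mulr_ge0 ?exprn_even_ge0// ltW.
rewrite [leLHS](_ : _ = 4^-1 * dsum B - C1 / 2 * \sum_x pi x * d x ^+ 2).
  have := ler_wpM2r D0 hC1; rewrite -/q -/c; lra.
have -> : grad_form r p p / 2 = 4^-1 * dsum (fun x y => th (r x) (r y) * (p x - p y) ^+ 2).
  by rewrite /grad_form; field.
have -> : grad_form r p p = 4^-1 * dsum (fun x y => 2 * (th (r x) (r y) * (p x - p y) ^+ 2)).
  by rewrite /grad_form dsumZ; have -> : forall z : R, 4^-1 * (2 * z) = 2^-1 * z by move=> z; field.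
have -> : grad_form r p d = 4^-1 * dsum (fun x y => 2 * (th (r x) (r y) * ((p x - p y) * (d x - d y)))).
  by rewrite /grad_form dsumZ; have -> : forall z : R, 4^-1 * (2 * z) = 2^-1 * z by move=> z; field.
rewrite /grad_form.
set G := dsum (fun x y => th (r x + d x) _ * _).
have GE : G = dsum (fun x y => th (r x + d x) (r y + d y) * ((p x - C * d x) - (p y - C * d y)) ^+ 2) by [].
rewrite GE.
have -> : B = (fun x y => th (r x) (r y) * (p x - p y) ^+ 2
  - (th1 (r x) (r y) * d x + th1 (r y) (r x) * d y) * (p x - p y) ^+ 2
  - 2 * (th (r x) (r y) * (p x - p y) ^+ 2)
  + C * (2 * (th (r x) (r y) * ((p x - p y) * (d x - d y))))
  + th (r x + d x) (r y + d y) * ((p x - C * d x) - (p y - C * d y)) ^+ 2).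
  by apply/funext => x; apply/funext => y; rewrite /B; ring.
by rewrite !dsumD !dsumN !dsumZ; field.
Qed.

End Calibration.

(** * Conserved quantities and the choice of the calibration *)

Section FlowInvariants.
Context {R : realType} {X : finType}.
Variables (Q : X -> X -> R) (pi : X -> R).
Hypothesis Q0 : forall x y, 0 <= Q x y.
Hypothesis pi0 : forall x, 0 < pi x.
Hypothesis pi1 : \sum_x pi x = 1.
Hypothesis Qrev : reversible Q pi.
Local Notation dsum := (dsum Q pi).
Local Notation grad_form := (grad_form Q pi).
Local Notation rdot := (density_drift Q).
Local Notation pdot := (pdot Q).
Variables (a b M tau : R) (r p : R -> X -> R).
Hypothesis a0 : 0 < a.
Hypothesis ab : a <= b.
Hypothesis M0 : 0 < M.
Hypothesis tau0 : 0 < tau.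
Hypothesis Hflow : flow Q a b M tau r p.
Hypothesis mass0 : \sum_x r 0 x * pi x = 1.

Let r_cont x : continuous (r^~ x). Proof. by have [h _ _ _ _] := Hflow. Qed.
Let p_cont x : continuous (p^~ x). Proof. by have [_ h _ _ _] := Hflow. Qed.
Let r_box t x : 0 <= t <= tau -> box (a + a) (b - a) (r t x).
Proof. by have [_ _ h _ _] := Hflow; exact: h. Qed.
Let p_le t x : 0 <= t <= tau -> `|p t x| <= M.
Proof. by have [_ _ _ h _] := Hflow; exact: h. Qed.
Let r_diff (t : R) x : 0 < t < tau -> is_derive t 1 (r^~ x) (rdot (r t) (p t) x).
Proof. by have [_ _ _ _ h] := Hflow => /(h t x)[]. Qed.
Let p_diff (t : R) x : 0 < t < tau -> is_derive t 1 (p^~ x) (pdot (r t) (p t) x).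
Proof. by have [_ _ _ _ h] := Hflow => /(h t x)[]. Qed.

Lemma flow_gt0 t x : 0 <= t <= tau -> 0 < r t x.
Proof.
move=> tt; have /andP[h _] := r_box x tt; apply: lt_le_trans h.
by rewrite addr_gt0.
Qed.

Let A0 := grad_form (r 0) (p 0) (p 0).

Let lt_le (t : R) : 0 < t < tau -> 0 <= t <= tau.
Proof. by move=> /andP[t0 tt]; rewrite !ltW. Qed.

(** Conservation of the Hamiltonian: the variation through [p] pairs [pdot] with [rdot], and the
    variation through [r] gives the same pairing with the opposite sign. *)
Lemma flow_energy t : 0 <= t <= tau -> grad_form (r t) (p t) (p t) = A0.
Proof.
move: t; apply: derive0_cst => t tt; last first.
  apply: cvgM; first exact: cvg_cst.
  apply: continuous_dsum => x y; apply: cvgM.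
    by apply: continuous_th; rewrite ?flow_gt0//; exact: r_cont.
  by apply: cvgM; apply: cvgB; exact: p_cont.
have tt' := lt_le tt.
have dT x y : is_derive t 1
    (fun t => th (r t x) (r t y) * ((p t x - p t y) * (p t x - p t y)))
    (4 * (2^-1 * (th (r t x) (r t y) * (p t x - p t y)
         * (pdot (r t) (p t) x - pdot (r t) (p t) y))) +
     4 * (4^-1 * ((th1 (r t x) (r t y) * rdot (r t) (p t) x
        + th1 (r t y) (r t x) * rdot (r t) (p t) y) * (p t x - p t y) ^+ 2))).
  have d1 := is_derive_th (flow_gt0 x tt') (flow_gt0 y tt') (r_diff x tt) (r_diff y tt).
  have d2 := is_deriveB_fun (p_diff x tt) (p_diff y tt).
  apply: (is_derive_eq (is_deriveM_fun d1 (is_deriveM_fun d2 d2))).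
  by field.
apply: (is_derive_eq (is_deriveZ_fun 2^-1 (is_derive_dsum Q pi dT))).
rewrite dsumD !(dsumZ Q pi 4).
have E1 : dsum (fun x y => 2^-1 * (th (r t x) (r t y) * (p t x - p t y)
    * (pdot (r t) (p t) x - pdot (r t) (p t) y))) =
    \sum_x pi x * (pdot (r t) (p t) x * rdot (r t) (p t) x).
  rewrite rdot_form//; last by move=> x; exact: flow_gt0.
  by rewrite dsumZ; congr (_ * _); apply: eq_dsum => x y; ring.
have E2 : dsum (fun x y => 4^-1 * ((th1 (r t x) (r t y) * rdot (r t) (p t) x
        + th1 (r t y) (r t x) * rdot (r t) (p t) y) * (p t x - p t y) ^+ 2)) =
    - \sum_x pi x * (rdot (r t) (p t) x * pdot (r t) (p t) x).
  by rewrite pdot_form// dsumZ mulNr opprK.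
rewrite E1 E2 mulrN -mulrBr (_ : \sum_x _ = \sum_x pi x *
    (rdot (r t) (p t) x * pdot (r t) (p t) x)); last first.
  by apply: eq_bigr => x _; rewrite [pdot _ _ _ * _]mulrC.
by rewrite subrr !mulr0.
Qed.

Lemma flow_mass t : 0 <= t <= tau -> \sum_x r t x * pi x = 1.
Proof.
move=> tt; rewrite -mass0; move: t tt; apply: derive0_cst => t tt; last first.
  by apply: continuous_sum_at => x; apply: cvgM; [exact: r_cont|exact: cvg_cst].
apply: is_derive_eq.
  apply: is_derive_sum_fun => x.
  exact: is_deriveM_fun (r_diff x tt) (is_derive_cst (pi x) t 1).
transitivity (\sum_x pi x * ((fun=> 1) x * rdot (r t) (p t) x)).
  by apply: eq_bigr => x _ /=; ring.
rewrite rdot_form//; last by move=> x; exact/flow_gt0/lt_le.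
rewrite /grad_form /dsum big1 ?mulr0// => x _; rewrite big1// => y _; ring.
Qed.

(* The quadratic term is taken with respect to a curvature [C0 + C1 t]: a large
   [C0] pushes the value below [-1] outside the tube of radius [a], and a large
   [C1] absorbs the second order error of the Hamilton-Jacobi equation. *)
Definition calib (C0 C1 t : R) (rho : X -> R) : R :=
  A0 / 2 * t + \sum_x pi x * (p t x * (rho x - r t x)
    - (C0 + C1 * t) / 2 * (rho x - r t x) ^+ 2).

Lemma calib_flow C0 C1 t : calib C0 C1 t (r t) = A0 / 2 * t.
Proof. by rewrite /calib big1 ?addr0// => x _; rewrite subrr; ring. Qed.

(** Competitors live on [[0, 1]] whereas the flow runs from time [s] to time [s + e], with [e] of
    either sign; hence the affine time. The factor of [e] is the time derivative of the calibration,
    and the last sum pairs its gradient in the density with the velocity of the competitor. *)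
Lemma is_derive_calib (C0 C1 s e z : R) (m : R -> X -> R) (dm : X -> R) :
  0 < s + e * z < tau ->
  (forall x, is_derive z 1 (m^~ x) (dm x)) ->
  let t := s + e * z in
  let d x := m z x - r t x in
  is_derive z 1 (fun z => calib C0 C1 (s + e * z) (m z))
    (e * (A0 / 2 + \sum_x pi x * (pdot (r t) (p t) x * d x - p t x * rdot (r t) (p t) x
       - C1 / 2 * d x ^+ 2 + (C0 + C1 * t) * d x * rdot (r t) (p t) x))
     + \sum_x pi x * ((p t x - (C0 + C1 * t) * d x) * dm x)).
Proof.
move=> tz Hm t d.
have dt : is_derive z 1 (fun z => s + e * z) e.
  have d1 := is_deriveD_fun (is_derive_cst s z 1) (is_deriveZ_fun e (is_derive_id z 1)).
  by apply: (is_derive_eq d1); rewrite add0r mulr1.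
have dr x := @is_derive_comp_fun R (r^~ x) (fun z => s + e * z) z _ _ (r_diff x tz) dt.
have dp x := @is_derive_comp_fun R (p^~ x) (fun z => s + e * z) z _ _ (p_diff x tz) dt.
have dd x := is_deriveB_fun (Hm x) (dr x).
have dC := is_deriveM_fun (is_deriveD_fun (is_derive_cst C0 z 1) (is_deriveZ_fun C1 dt))
  (is_derive_cst (2^-1 : R) z 1).
have dx x := is_deriveZ_fun (pi x) (is_deriveB_fun (is_deriveM_fun (dp x) (dd x))
  (is_deriveM_fun dC (is_derive_sqr_fun (dd x)))).
have H := is_deriveD_fun (is_deriveZ_fun (A0 / 2) dt) (is_derive_sum_fun xpredT dx).
apply: (is_derive_eq H).
rewrite (mulrDr e) mulr_sumr -addrA -big_split; congr (_ + _); first exact: mulrC.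
by apply: eq_bigr => x _; rewrite /= /d /t; field.
Qed.

Lemma flow_lip : exists2 L : R, 0 <= L & forall x u v,
  0 <= u <= tau -> 0 <= v <= tau ->
  `|r u x - r v x| <= L * `|u - v| /\ `|p u x - p v x| <= L * `|u - v|.
Proof.
have [K K0 HK] := th_box a0 ab.
have rab t x : 0 < t < tau -> box a b (r t x).
  by move=> /lt_le tt; have /andP[h h'] := r_box x tt; have := a0; rewrite /box; lra.
have pp t x y : 0 < t < tau -> `|p t x - p t y| <= M + M.
  by move=> /lt_le tt; apply: le_trans (ler_normB _ _) _; rewrite lerD// p_le.
pose q := \sum_x \sum_y Q x y.
have qx (x : X) (F : X -> R) (c : R) : 0 <= c -> (forall y, `|F y| <= c) ->
    `|\sum_y Q x y * F y| <= q * c.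
  move=> c0 Fc; apply: le_trans (ler_norm_sum _ _ _) _.
  apply: (@le_trans _ _ (\sum_y Q x y * c)).
    by apply: ler_sum => y _; rewrite normrM ger0_norm// ler_wpM2l.
  rewrite -mulr_suml ler_wpM2r// /q [leRHS](bigD1 x)//= lerDl sumr_ge0// => ? _.
  exact: sumr_ge0.
have MM : 0 <= M + M by rewrite addr_ge0// ltW.
have q0 : 0 <= q by do 2 apply: sumr_ge0 => ? _.
exists (q * (K * (M + M)) + q * (K * (M + M) ^+ 2)).
  by rewrite addr_ge0// !mulr_ge0// exprn_ge0.
move=> x u v uu vv; split.
  apply: (@derive_lip_oo _ (r^~ x) (fun t => rdot (r t) (p t) x) _ 0 tau) => //.
  - by move=> t tt; exact: r_diff.
  - by move=> t _; exact: r_cont.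
  - move=> t tt; apply: (@le_trans _ _ (q * (K * (M + M)))); last first.
      by rewrite lerDl !mulr_ge0// exprn_ge0.
    apply: qx => [|y]; first exact: mulr_ge0.
    have [h _ _] := HK _ _ (rab t x tt) (rab t y tt).
    by rewrite normrM ler_pM// pp.
apply: (@derive_lip_oo _ (p^~ x) (fun t => pdot (r t) (p t) x) _ 0 tau) => //.
- by move=> t tt; exact: p_diff.
- by move=> t _; exact: p_cont.
- move=> t tt; apply: (@le_trans _ _ (q * (K * (M + M) ^+ 2))); last first.
    by rewrite lerDr !mulr_ge0.
  apply: qx => [|y]; first by rewrite mulr_ge0// exprn_ge0.
  have [_ h _] := HK _ _ (rab t x tt) (rab t y tt).
  rewrite normrM normrN (ger0_norm (_ : 0 <= 2^-1))//.
  apply: (@le_trans _ _ (1 * `|th1 (r t x) (r t y) * (p t x - p t y) ^+ 2|)).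
    by rewrite ler_wpM2r// invf_le1// ler1n.
  rewrite mul1r normrM ler_pM// normrX lerXn2r ?nnegrE// pp//.
Qed.

Lemma grad_form_ge0 (rho f : X -> R) : (forall x, 0 <= rho x) -> 0 <= grad_form rho f f.
Proof.
move=> rho0; rewrite mulr_ge0// dsum_ge0// => x y.
by rewrite mulr_ge0 ?th_ge0// -expr2 sqr_ge0.
Qed.

(** The squared gradient of [f - s e g] is nonnegative. The sign [s] allows for both directions of
    time. *)
Lemma grad_form_young (rho f g : X -> R) (e s : R) : (forall x, 0 <= rho x) ->
  0 < e -> s ^+ 2 = 1 ->
  - (e / 2) * grad_form rho g g + s * grad_form rho f g <= grad_form rho f f / (2 * e).
Proof.
move=> rho0 e0 s1; have := grad_form_ge0 (fun x => f x - s * e * g x) rho0.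
have -> : grad_form rho (fun x => f x - s * e * g x) (fun x => f x - s * e * g x)
  = grad_form rho f f + e ^+ 2 * grad_form rho g g - 2 * e * (s * grad_form rho f g).
  rewrite /grad_form.
  have -> : dsum (fun x y => th (rho x) (rho y) * ((f x - s * e * g x
     - (f y - s * e * g y)) * (f x - s * e * g x - (f y - s * e * g y)))) =
   dsum (fun x y => th (rho x) (rho y) * ((f x - f y) * (f x - f y))
     + s ^+ 2 * e ^+ 2 * (th (rho x) (rho y) * ((g x - g y) * (g x - g y)))
     - 2 * e * s * (th (rho x) (rho y) * ((f x - f y) * (g x - g y)))).
    by apply: eq_dsum => x y; ring.
  by rewrite dsumB dsumD !dsumZ s1; ring.
set A := grad_form rho f f; set B := grad_form rho g g; set C := grad_form rho f g => h.
rewrite ler_pdivlMr ?mulr_gt0//; nra.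
Qed.

(** The order of choices matters: [C0] depends only on the flow, [C1] on [C0], and the horizon on
    both [C1] and the energy. *)
Lemma calib_constants : exists (tau' C0 C1 : R), [/\ 0 < tau', tau' <= tau,
  forall t rho, 0 <= t <= tau' -> (forall x, `|rho x - r t x| <= a) ->
    let d x := rho x - r t x in
    let g x := p t x - (C0 + C1 * t) * d x in
    is_true (A0 / 2 + \sum_x pi x * (pdot (r t) (p t) x * d x - p t x * rdot (r t) (p t) x
      - C1 / 2 * d x ^+ 2 + (C0 + C1 * t) * d x * rdot (r t) (p t) x)
    <= - (2^-1) * grad_form rho g g) &
  forall t rho, 0 <= t <= tau' -> ~ (forall x, `|rho x - r t x| <= a) ->
    calib C0 C1 t rho < -1].
Proof.
have [K K0 HK] := th_box a0 ab.
have rt0 x : 0 <= r 0 x by rewrite ltW// flow_gt0// lexx ltW.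
have A00 : 0 <= A0 by exact: grad_form_ge0.
pose q := \sum_x \sum_y Q x y.
have q0 : 0 <= q by do 2 apply: sumr_ge0 => ? _.
have pa x : 0 < pi x * a ^+ 2 by rewrite mulr_gt0// exprn_gt0.
(* [C0 >= M ^+ 2] lets half of the quadratic term absorb the linear one at the cost of [1] per unit
   of mass. [C0 >= 12 / (pi x * a ^+ 2)] makes a single coordinate with [|d x| > a] contribute at
   least [3] through the other half. The total is at most [1/2 + 1 - 3 < -1]. *)
pose C0 := M ^+ 2 + 1 + \sum_x 12 / (pi x * a ^+ 2).
have C0x x : 12 / (pi x * a ^+ 2) <= C0.
  rewrite /C0 (bigD1 x)//= addrCA lerDl addr_ge0 ?addr_ge0 ?exprn_even_ge0//.
  by rewrite sumr_ge0// => y _; rewrite divr_ge0// ltW.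
have C0M : M ^+ 2 <= C0.
  rewrite /C0 -addrA lerDl addr_ge0// sumr_ge0// => y _; rewrite divr_ge0// ltW//.
have C00 : 0 < C0.
  rewrite /C0 -addrA ltr_wpDl ?exprn_even_ge0// ltr_wpDr// sumr_ge0// => y _.
  by rewrite divr_ge0// ltW.
(* [C0 + 1] stands for the varying [C0 + C1 * t], which it bounds once [C1 * t <= 1]; this breaks
   the circularity in the choice of [C1]. *)
pose c := 8 * M ^+ 2 + 4 * (C0 + 1) * M + (C0 + 1) ^+ 2.
have c0 : 0 <= c by rewrite /c; nra.
pose C1 := 2 * (K * c) * q + 1.
have C10 : 0 < C1 by rewrite ltr_wpDl// !mulr_ge0.
(* [C1^-1] ensures [C1 * t <= 1], and [(A0 + 1)^-1] ensures [A0 / 2 * t <= 1 / 2]. *)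
exists (Num.min tau (Num.min C1^-1 (A0 + 1)^-1)), C0, C1; split.
- by rewrite !lt_min tau0 !invr_gt0 C10 ltr_wpDl.
- by rewrite ge_min lexx.
- move=> t rho /andP[t0 tm] da d g; move: tm; rewrite !le_min => /and3P[tt tC _].
  have t0t : 0 <= t <= tau by rewrite t0.
  have C1t : C1 * t <= 1 by rewrite -ler_pdivlMl// mulr1.
  have C1t0 : 0 <= C1 * t by rewrite mulr_ge0// ltW.
  have CC : 0 <= C0 + C1 * t by rewrite addr_ge0// ltW.
  have hC1 : 2 * (K * (8 * M ^+ 2 + 4 * (C0 + C1 * t) * M + (C0 + C1 * t) ^+ 2)) * q <= C1.
    apply: (@le_trans _ _ (2 * (K * c) * q)); last by rewrite lerDl.
    apply: (ler_wpM2r q0); apply: ler_wpM2l => //; apply: (ler_wpM2l K0); rewrite /c.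
    apply: lerD; last by rewrite lerXn2r ?nnegrE ?lerD// addr_ge0// ltW.
    by rewrite lerD// (ler_wpM2r (ltW M0))// ler_wpM2l// lerD.
  have := residual_le Q0 pi0 Qrev a0 ab (ltW M0) K0 CC HK (fun x => r_box x t0t)
    (fun x => p_le x t0t) da hC1.
  rewrite flow_energy//.
  have -> : (fun x => r t x + (rho x - r t x)) = rho by apply/funext => x; rewrite subrKC.
  by move=> H; rewrite mulNr -subr_le0 opprK.
- move=> t rho /andP[t0 tm] /existsNP[x /negP]; move: tm.
  rewrite !le_min => /and3P[tt tC tA].
  rewrite -ltNge => ax.
  have t0t : 0 <= t <= tau by rewrite t0.
  have At : A0 / 2 * t <= 2^-1.
    have : A0 * t <= 1.
      apply: (@le_trans _ _ ((A0 + 1) * t)); first by rewrite ler_wpM2r// lerDl.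
      by rewrite -ler_pdivlMl ?mulr1// ltr_wpDl.
    lra.
  have C1t0 : 0 <= C1 * t by rewrite mulr_ge0// ltW.
  rewrite /calib.
  pose d y := rho y - r t y.
  have termle y : p t y * d y - (C0 + C1 * t) / 2 * d y ^+ 2 <= 1 - C0 / 4 * d y ^+ 2.
    have h1 : C0 / 2 * d y ^+ 2 <= (C0 + C1 * t) / 2 * d y ^+ 2.
      by rewrite ler_wpM2r ?exprn_even_ge0//; lra.
    have h2 : p t y * d y <= 1 + C0 / 4 * d y ^+ 2.
      have pM : (p t y) ^+ 2 <= C0.
        apply: le_trans C0M; rewrite -(real_normK (num_real (p t y))).
        by rewrite lerXn2r ?nnegrE ?(ltW M0)// p_le.
      have := sqr_ge0 (p t y - C0 / 2 * d y) => h.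
      rewrite -(ler_pM2l C00); nra.
    lra.
  have dx : 3 <= pi x * (C0 / 4 * d x ^+ 2).
    have : a ^+ 2 <= d x ^+ 2.
      by rewrite -(real_normK (num_real (d x))) lerXn2r ?nnegrE ?(ltW a0)// ltW.
    have := C0x x; rewrite ler_pdivrMr// => h1 h2.
    have := ler_wpM2l (ltW (mulr_gt0 (pi0 x) C00)) h2; nra.
  have S1 : \sum_y pi y * (p t y * d y - (C0 + C1 * t) / 2 * d y ^+ 2) <= -2.
    apply: (@le_trans _ _ (\sum_y (pi y - pi y * (C0 / 4 * d y ^+ 2)))).
      apply: ler_sum => y _; have -> : pi y - pi y * (C0 / 4 * d y ^+ 2) = pi y * (1 - C0 / 4 * d y ^+ 2) by ring.
      by apply: ler_wpM2l; [exact: ltW|exact: termle].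
    rewrite sumrB pi1.
    have : pi x * (C0 / 4 * d x ^+ 2) <= \sum_y pi y * (C0 / 4 * d y ^+ 2).
      rewrite [leRHS](bigD1 x)//= lerDl sumr_ge0// => y _.
      apply: mulr_ge0; first exact: ltW.
      by rewrite mulr_ge0 ?sqr_ge0// divr_ge0// ltW.
    by lra.
  rewrite -/(d _); lra.
Qed.

End FlowInvariants.

(** * Lower bound for the action of a competitor *)

Section ActionLowerBound.
Context {R : realType} {X : finType}.
Variables (Q : X -> X -> R) (pi : X -> R).
Hypothesis Q0 : forall x y, 0 <= Q x y.
Hypothesis pi0 : forall x, 0 < pi x.
Hypothesis pi1 : \sum_x pi x = 1.
Hypothesis Qrev : reversible Q pi.
Local Notation dsum := (dsum Q pi).
Local Notation grad_form := (grad_form Q pi).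
Local Notation rdot := (density_drift Q).
Local Notation pdot := (pdot Q).
Variables (a b M tau : R) (r p : R -> X -> R).
Hypothesis a0 : 0 < a.
Hypothesis ab : a <= b.
Hypothesis M0 : 0 < M.
Hypothesis tau0 : 0 < tau.
Hypothesis Hflow : flow Q a b M tau r p.
Let A0 := grad_form (r 0) (p 0) (p 0).
Variables (tau' C0 C1 : R).
Hypothesis tau'tau : tau' <= tau.
Hypothesis Hsub : forall t rho, 0 <= t <= tau' -> (forall x, `|rho x - r t x| <= a) ->
    let d x := rho x - r t x in
    let g x := p t x - (C0 + C1 * t) * d x in
    is_true (A0 / 2 + \sum_x pi x * (pdot (r t) (p t) x * d x - p t x * rdot (r t) (p t) x
      - C1 / 2 * d x ^+ 2 + (C0 + C1 * t) * d x * rdot (r t) (p t) x)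
    <= - (2^-1) * grad_form rho g g).
Hypothesis Hout : forall t rho, 0 <= t <= tau' ->
  ~ (forall x, `|rho x - r t x| <= a) -> calib Q pi r p C0 C1 t rho < -1.

Let mu := @lebesgue_measure R.

Definition action_density (rho psi : X -> R) : R :=
  \sum_x \sum_y (psi x - psi y) ^+ 2 * edge_density rho x y * Q x y * pi x.

Lemma action_density_ge0 (rho psi : X -> R) : 0 <= action_density rho psi.
Proof.
do 2 (apply: sumr_ge0 => ? _).
apply: mulr_ge0; last exact: ltW.
apply: mulr_ge0 => //; apply: mulr_ge0; [exact: sqr_ge0|exact: log_mean_ge0].
Qed.

Lemma action_densityE (rho psi : X -> R) : (forall x, 0 < rho x) ->
  action_density rho psi = 2 * grad_form rho psi psi.
Proof.
move=> rho0; rewrite /grad_form mulrA divff// mul1r.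
apply: eq_bigr => x _; apply: eq_bigr => y _.
by rewrite /edge_density log_meanE//; ring.
Qed.

Lemma measurable_action_density (m f : R -> X -> R) :
  (forall t, t \in `[0, 1] -> density pi (m t)) ->
  (forall x, absolutely_continuous01 (m^~ x)) ->
  (forall x, measurable_fun (`[0, 1] : set R) (f^~ x : R -> R)) ->
  measurable_fun (`[0, 1] : set R) (fun t => action_density (m t) (f t)).
Proof.
move=> dm acm mf.
have mm x : measurable_fun (`[0, 1] : set R) (m^~ x : R -> R).
  by apply: subspace_continuous_measurable_fun => //; exact: ac_continuous.
have m0 x t : `[0, 1]%classic t -> 0 <= m t x.
  by move=> t01; have [] := dm t t01.
apply: measurable_sum => x; apply: measurable_sum => y.
apply: measurable_funM; last exact: measurable_cst.
apply: measurable_funM; last exact: measurable_cst.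
apply: measurable_funM; last by apply: measurable_log_mean => //; exact: m0.
by apply: measurable_funX; exact: measurable_funB.
Qed.

Lemma ac_flow (s e : R) : 0 <= s <= tau -> 0 <= s + e <= tau -> forall x,
  absolutely_continuous01 (fun z => r (s + e * z) x) /\
  absolutely_continuous01 (fun z => p (s + e * z) x).
Proof.
move=> /andP[s0 st] /andP[se0 set] x.
have [L L0 HL] := flow_lip Q0 a0 ab M0 Hflow.
have seg z : 0 <= z <= 1 -> 0 <= s + e * z <= tau.
  by move=> /andP[z0 z1]; apply/andP; split; nra.
have eqd u v : s + e * v - (s + e * u) = e * (v - u) by ring.
split; apply: (@ac_lipschitz _ (L * `|e|)) => u v u01 v01.
- have [h _] := HL x _ _ (seg v v01) (seg u u01).
  by apply: le_trans h _; rewrite eqd normrM mulrA.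
- have [_ h] := HL x _ _ (seg v v01) (seg u u01).
  by apply: le_trans h _; rewrite eqd normrM mulrA.
Qed.

Lemma ac_calib (s e : R) (m : R -> X -> R) :
  0 <= s <= tau -> 0 <= s + e <= tau ->
  (forall x, absolutely_continuous01 (m^~ x)) ->
  absolutely_continuous01 (fun z => calib Q pi r p C0 C1 (s + e * z) (m z)).
Proof.
move=> ss se acm.
have acf := ac_flow ss se.
have act : absolutely_continuous01 (fun z => s + e * z).
  by apply: acD; [exact: ac_cst|apply: acM; [exact: ac_cst|exact: ac_id]].
have acd x : absolutely_continuous01 (fun z => m z x - r (s + e * z) x).
  apply: acD => //; have -> : (fun z => - r (s + e * z) x) =
    fun z => (-1) * r (s + e * z) x by apply/funext => z; rewrite mulN1r.
  by apply: acM; [exact: ac_cst|case: (acf x)].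
apply: acD; first by apply: acM; [exact: ac_cst|].
apply: ac_sum => x; apply: acM; first exact: ac_cst.
apply: acD; first by apply: acM => //; case: (acf x).
have -> : (fun z => - ((C0 + C1 * (s + e * z)) / 2 * (m z x - r (s + e * z) x) ^+ 2)) =
  fun z => (- (2^-1) * (C0 + C1 * (s + e * z))) *
     ((m z x - r (s + e * z) x) * (m z x - r (s + e * z) x)).
  by apply/funext => z; field.
apply: acM; last exact: acM.
apply: acM; first exact: ac_cst.
by apply: acD; [exact: ac_cst|apply: acM; [exact: ac_cst|]].
Qed.

Lemma max_slope (sg m x y c : R) : sg ^+ 2 = 1 -> 0 <= c -> sg * (x - y) <= c ->
  sg * (Num.max x m - Num.max y m) <= c.
Proof.
move=> sg1 c0 h.
have [E|E] : sg = 1 \/ sg = -1.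
  by move/eqP: sg1; rewrite sqrf_eq1 => /orP[]/eqP; [left|right].
all: by rewrite E in h *; rewrite /Num.max; case: ltP => xm; case: ltP => ym; lra.
Qed.

(** Inside the tube, the oriented slope of the calibration is at most [- |e|/2] times the squared
    gradient of [g] plus its pairing with the potential [f]; by Young's inequality this is at most
    the squared gradient of [f] over [2 |e|]. The calibration gains [A0 / 2 * |t - s|] between the
    ends, and integration gives the bound. *)
Lemma action_lower (s t : R) (m f : R -> X -> R) :
  0 <= s <= tau' -> 0 <= t <= tau' -> s != t ->
  admissible Q pi (r s) (r t) m f ->
  (((t - s) ^+ 2 * A0)%:E <= action Q pi m f)%E.
Proof.
move=> s01 t01 st [dm acm [m0 m1] mf ode].
pose e := t - s.
have e0 : e != 0 by rewrite subr_eq0 eq_sym.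
have ne0 : 0 < `|e| by rewrite normr_gt0.
(* Orientation: the calibration is read forwards if [s < t] and backwards otherwise. *)
pose sg := e / `|e|.
have sg1 : sg ^+ 2 = 1.
  by rewrite /sg expr_div_n real_normK ?num_real// divff// sqrf_eq0.
have sge : sg * e = `|e|.
  by rewrite /sg mulrAC -expr2 -(real_normK (num_real e)) expr2 mulfK ?gt_eqF.
pose S z := calib Q pi r p C0 C1 (s + e * z) (m z).
(* At the ends the calibration is [A0 / 2] times a time, hence nonnegative, so the truncation does
   not change these values. *)
pose F z := sg * Num.max (S z) (-1).
pose G z := action_density (m z) (f z) / (4 * `|e|).
have st' : 0 <= s <= tau /\ 0 <= s + e <= tau.
  have tt := tau'tau; move: s01 t01 => /andP[? ?] /andP[? ?].
  by rewrite /e; split; apply/andP; split; lra.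
have acF : absolutely_continuous01 F.
  by apply: acM; [exact: ac_cst|apply: ac_max; apply: ac_calib; case: st'].
have mAd := measurable_action_density dm acm mf.
have mG : measurable_fun (`[0, 1] : set R) G.
  by apply: measurable_funM => //; exact: measurable_cst.
have G0 z : 0 <= G z by rewrite divr_ge0 ?action_density_ge0.
have [N [mN N0 HN]] := ode.
have Nn : mu.-negligible (N `|` [set 0] `|` [set 1]).
  apply: negligibleU; first apply: negligibleU.
  - exact/negligibleP.
  - by apply/negligibleP => //; exact: lebesgue_measure_set1.
  - by apply/negligibleP => //; exact: lebesgue_measure_set1.
have A0_ge0 : 0 <= A0.
  apply: grad_form_ge0 => // x; apply: ltW; apply: (flow_gt0 a0 Hflow).
  by rewrite lexx ltW.
have := @slope_le_integral R F G _ acF mG (fun z _ => G0 z) Nn _.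
have F1 : F 1 - F 0 = A0 / 2 * `|e|.
  have F_ends z u : 0 <= u -> s + e * z = u -> m z = r u -> F z = sg * (A0 / 2 * u).
    move=> u0 zu mzu; rewrite /F /S zu mzu calib_flow -/A0.
    have : 0 <= A0 / 2 * u by apply: mulr_ge0 => //; exact: divr_ge0.
    by move=> Au; rewrite max_l// (le_trans _ Au)// lerN10.
  have Ft : F 1 = sg * (A0 / 2 * t).
    by apply: F_ends => //; [case/andP: t01|rewrite /e; ring].
  have Fs : F 0 = sg * (A0 / 2 * s).
    by apply: F_ends => //; [case/andP: s01|rewrite mulr0 addr0].
  by rewrite Ft Fs -sge /e; ring.
rewrite F1 => HH.
have HG : (forall z : R, 0 <= z <= 1 -> ~ (N `|` [set 0] `|` [set 1]) z ->
  forall eta : R, 0 < eta -> exists2 d : R, 0 < d &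
   forall u v, 0 <= u -> u <= z -> z <= v -> v <= 1 -> z - d < u -> v < z + d ->
   F v - F u <= (G z + eta) * (v - u)).
  move=> z z01 /not_orP[/not_orP[Nz z0] z1] eta eta0.
  have z_oo : 0 < z < 1.
    move: z01 => /andP[h0 h1]; rewrite !lt_neqAle h0 h1 !andbT.
    by apply/andP; split; apply/eqP => zE; [exact: z0|exact: z1].
  have ode_z : forall x, derivable (m^~ x) z 1 /\ derive1 (m^~ x) z +
      \sum_y (f z y - f z x) * edge_density (m z) x y * Q x y = 0.
    by apply: contrapT => h; apply: Nz; apply: HN => /= h'; apply: h; exact: h'.
  have z01' : 0 <= z <= 1 by [].
  have tz : 0 < s + e * z < tau.
    move: s01 t01 st e0 z_oo => /andP[s0 s1] /andP[t0 t1]; rewrite /e => st e0 /andP[zl zr].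
    have tt := tau'tau.
    have [lst|lts|est] := ltgtP s t; last by rewrite est eqxx in st.
    - by apply/andP; split; nra.
    - by apply/andP; split; nra.
  have tz' : 0 <= s + e * z <= tau'.
    move: s01 t01 z01' => /andP[s0 s1] /andP[t0 t1] /andP[zl zr].
    by apply/andP; split; rewrite /e; nra.
  have dmz (x : X) : is_derive z 1 (m^~ x) (derive1 (m^~ x) z).
    by have [h _] := ode_z x; rewrite derive1E; exact: derivableP.
  have dS := is_derive_calib pi Hflow C0 C1 tz dmz.
  cbv beta zeta in dS.
  set D := (X in is_derive _ _ _ X) in dS.
  have [close|far] := pselect (forall x, `|m z x - r (s + e * z) x| <= a); last first.
    (* Outside the tube the truncated function is locally constant, so nothing is asked of the
       possibly degenerate edge densities there. *)
    have Sz : S z < -1 by exact: Hout.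
    have cS : {for z, continuous S} by exact: is_derive_continuous dS.
    have e1 : 0 < -1 - S z by rewrite subr_gt0.
    have /cvgrPdist_lt/(_ _ e1)[d /= d0 Sd] := cS.
    exists d => // u v u0 uz zv v1 du dv.
    have Sm y : `|z - y| < d -> Num.max (S y) (-1) = -1.
      move=> /Sd; rewrite ltr_distlC => /andP[_ h]; rewrite max_r//; lra.
    rewrite /F !Sm ?subrr; first by rewrite mulr_ge0 ?subr_ge0 ?(le_trans uz)// addr_ge0// ltW.
      by rewrite ger0_norm ?subr_ge0//; lra.
    by rewrite ler0_norm ?subr_le0//; lra.
  have mz0 x : 0 < m z x.
    have := close x; rewrite ler_norml => /andP[h _].
    have [_ _ rb _ _] := Hflow.
    have /andP[h' _] : box (a + a) (b - a) (r (s + e * z) x) by apply: rb; rewrite !ltW; case/andP: tz.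
    have := a0; lra.
  have dmE x : derive1 (m^~ x) z = rdot (m z) (f z) x.
    have [_ /eqP] := ode_z x; rewrite addr_eq0 => /eqP ->.
    rewrite -sumrN; apply: eq_bigr => y _.
    by rewrite /edge_density log_meanE//; ring.
  have DG : sg * D <= G z.
    have HW := Hsub tz' close; cbv beta zeta in HW; rewrite /D.
    set W := A0 / 2 + _ in HW *.
    set g := (fun x => p (s + e * z) x - _) in HW.
    have -> : \sum_x pi x * ((p (s + e * z) x - (C0 + C1 * (s + e * z)) *
      (m z x - r (s + e * z) x)) * derive1 (m^~ x) z) = grad_form (m z) (f z) g.
      by rewrite -rdot_form//; apply: eq_bigr => x _; rewrite dmE.
    have Y := grad_form_young Q0 pi0 (f z) g (fun x => ltW (mz0 x)) ne0 sg1.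
    rewrite /G action_densityE//.
    rewrite [leRHS](_ : _ = grad_form (m z) (f z) (f z) / (2 * `|e|)); last first.
      by field; rewrite gt_eqF.
    apply: le_trans Y; rewrite mulrDr mulrA sge lerD2r.
    rewrite (_ : - (`|e| / 2) * _ = `|e| * (- (2^-1) * grad_form (m z) g g)); last by ring.
    by rewrite ler_wpM2l.
  have [d d0 Hd] := is_derive_slope dS eta0.
  exists d => // u v u0 uz zv v1 du dv.
  rewrite /F -mulrBr; apply: max_slope => //.
    by rewrite mulr_ge0 ?subr_ge0 ?(le_trans uz)// addr_ge0// ltW.
  have := Hd u v uz zv du dv => h.
  have : sg * (S v - S u - D * (v - u)) <= eta * (v - u).
    apply: le_trans h; apply: le_trans (ler_norm _) _.
    rewrite normrM (_ : `|sg| = 1) ?mul1r//.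
    by apply/eqP; rewrite -sqrp_eq1// real_normK ?num_real// sg1.
  have uv : 0 <= v - u by rewrite subr_ge0 (le_trans uz).
  have := ler_wpM2r uv DG; lra.
have {HH HG} := HH HG.
rewrite /action -/(action_density _ _).
have -> : (\int[mu]_(z in `[0%R, 1%R]) (G z)%:E = ((4 * `|e|)^-1)%:E *
   \int[mu]_(z in `[0%R, 1%R]) (action_density (m z) (f z))%:E)%E.
  have k0 : 0 <= (4 * `|e|)^-1 by rewrite invr_ge0 mulr_ge0.
  apply/esym; rewrite -ge0_integralZl_EFin//; last 2 first.
    by move=> z _; rewrite lee_fin action_density_ge0.
    exact/measurable_EFinP.
  by apply: eq_integral => z _; rewrite -EFinM; congr (_%:E); rewrite /G; exact: mulrC.
move=> H.
have e20 : (0 <= (2 * `|e|)%:E)%E by rewrite lee_fin mulr_ge0.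
have := lee_wpmul2l e20 H.
rewrite muleA -!EFinM.
have -> : 2 * `|e| * (A0 / 2 * `|e|) = (t - s) ^+ 2 * A0.
  by rewrite -[(t - s) ^+ 2](real_normK (num_real e)); field.
have -> : 2 * `|e| * (4 * `|e|)^-1 = 2^-1 by field; rewrite gt_eqF.
by [].
Qed.

End ActionLowerBound.

(** * Short pieces of the flow are geodesics *)

Section Geodesics.
Context {R : realType} {X : finType}.
Variables (Q : X -> X -> R) (pi : X -> R).
Hypothesis Q0 : forall x y, 0 <= Q x y.
Hypothesis pi0 : forall x, 0 < pi x.
Hypothesis pi1 : \sum_x pi x = 1.
Hypothesis Qrev : reversible Q pi.
Local Notation dsum := (dsum Q pi).
Local Notation grad_form := (grad_form Q pi).
Local Notation rdot := (density_drift Q).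
Local Notation pdot := (pdot Q).
Local Notation mu := (@lebesgue_measure R).

Lemma action_ge0 m f : (0 <= action Q pi m f)%E.
Proof.
apply: mule_ge0; first by rewrite lee_fin.
by apply: integral_ge0 => t _; rewrite lee_fin; exact: action_density_ge0.
Qed.

Lemma transport_dist_self rho : density pi rho -> transport_dist Q pi rho rho = 0%E.
Proof.
move=> drho; rewrite /transport_dist.
suff -> : ereal_inf [set a | exists m f, admissible Q pi rho rho m f /\
    a = action Q pi m f] = 0%E by rewrite sqrte0.
apply/le_anti/andP; split; last first.
  by apply: le_ereal_inf_tmp => _ [m [f [_ ->]]]; exact: action_ge0.
apply: ereal_inf_lbound; exists (fun=> rho), (fun _ _ => 0); split.
  split=> //.
  - by move=> x; exact: ac_cst.
  - apply: aeW => t _ x; split; first exact: derivable_cst.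
    rewrite derive1_cst add0r big1// => y _.
    by rewrite subrr !mul0r.
rewrite /action (eq_integral (fun=> 0%E)) ?integral0 ?mule0// => t _.
congr (_%:E); rewrite big1// => x _; rewrite big1// => y _.
by rewrite subrr expr0n !mul0r.
Qed.

Variables (a b M tau : R) (r p : R -> X -> R).
Hypothesis a0 : 0 < a.
Hypothesis ab : a <= b.
Hypothesis M0 : 0 < M.
Hypothesis tau0 : 0 < tau.
Hypothesis Hflow : flow Q a b M tau r p.
Hypothesis mass0 : \sum_x r 0 x * pi x = 1.
Let A0 := grad_form (r 0) (p 0) (p 0).

Lemma density_flow t : 0 <= t <= tau -> density pi (r t).
Proof.
move=> tt; split; last exact: (flow_mass Qrev a0 Hflow mass0 tt).
by move=> x; apply: ltW; exact: (flow_gt0 a0 Hflow).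
Qed.

(** Affine reparametrisation multiplies the potential by [e], hence the conserved energy by
    [e ^+ 2]. *)
Lemma action_flow s t : 0 <= s <= tau -> 0 <= t <= tau -> s != t ->
  let e := t - s in
  admissible Q pi (r s) (r t) (fun z => r (s + e * z)) (fun z x => e * p (s + e * z) x) /\
  action Q pi (fun z => r (s + e * z)) (fun z x => e * p (s + e * z) x) = (e ^+ 2 * A0)%:E.
Proof.
move=> s01 t01 st e.
have set : 0 <= s + e <= tau by rewrite /e subrKC.
have seg z : 0 <= z <= 1 -> 0 <= s + e * z <= tau.
  move: s01 t01 => /andP[? ?] /andP[? ?] /andP[z0 z1]; rewrite /e.
  by apply/andP; split; nra.
have segoo z : 0 < z < 1 -> 0 < s + e * z < tau.
  move: s01 t01 => /andP[s0 s1] /andP[t0 t1] /andP[z0 z1]; rewrite /e.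
  have [lst|lts|est] := ltgtP s t; last by rewrite est eqxx in st.
  - by apply/andP; split; nra.
  - by apply/andP; split; nra.
have [rc pc _ _ rpd] := Hflow.
split; last first.
  rewrite /action (eq_integral (fun=> (2 * (e ^+ 2 * A0))%:E)).
    rewrite integral_cst//= lebesgue_measure_itv/= lte_fin ltr01 oppr0 adde0 mule1.
    by rewrite -EFinM; congr (_%:E); field.
  move=> z; rewrite inE/= in_itv/= => z01; congr (_%:E).
  have sz := seg z z01.
  have := @action_densityE R X Q pi (r (s + e * z)) (fun x => e * p (s + e * z) x).
  rewrite /action_density => -> => [|x]; last exact: (flow_gt0 a0 Hflow).
  rewrite /A0 -(flow_energy Qrev a0 Hflow sz).
  have -> : grad_form (r (s + e * z)) (fun x => e * p (s + e * z) x) (fun x => e * p (s + e * z) x)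
   = e ^+ 2 * grad_form (r (s + e * z)) (p (s + e * z)) (p (s + e * z)).
    rewrite /grad_form [RHS]mulrCA; congr (_ * _); rewrite -dsumZ; apply: eq_dsum => x y; ring.
  by [].
split.
- by move=> z; rewrite in_itv/= => z01; apply: density_flow; exact: seg.
- by move=> x; have [] := ac_flow Q0 a0 ab M0 Hflow s01 set x.
- by rewrite mulr0 addr0 mulr1 /e subrKC.
- move=> x; apply: measurable_funTS; apply: continuous_measurable_fun => z.
  apply: cvgM; first exact: cvg_cst.
  apply: (@continuous_comp _ _ _ (fun z => s + e * z) (p^~ x)); last exact: pc.
  apply: cvgD; first exact: cvg_cst.
  by apply: cvgM; [exact: cvg_cst|exact: cvg_id].
- exists ([set 0] `|` [set 1]); split.
  + by apply: measurableU; exact: measurable_set1.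
  + rewrite measureU0//; exact: lebesgue_measure_set1.
  + move=> z /= H; apply: contrapT => /not_orP[z0 z1]; apply: H => z01 x.
    have z_oo : 0 < z < 1.
      move: z01; rewrite in_itv/= => /andP[h0 h1]; rewrite !lt_neqAle h0 h1 !andbT.
      by apply/andP; split; apply/eqP => zE; [exact: z0|exact: z1].
    have sz := segoo z z_oo; have [dr _] := rpd _ x sz.
    have dt : is_derive z 1 (fun z => s + e * z) e.
      have d1 := is_deriveD_fun (is_derive_cst s z 1) (is_deriveZ_fun e (is_derive_id z 1)).
      by apply: (is_derive_eq d1); rewrite add0r mulr1.
    have d2 := @is_derive_comp_fun R (r^~ x) (fun z => s + e * z) z _ _ dr dt.
    split; first exact: (@ex_derive _ _ _ _ _ _ _ d2).
    rewrite derive1E (@derive_val _ _ _ _ _ _ _ d2).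
    rewrite /density_drift mulr_suml -big_split big1// => y _ /=.
    have sz' : 0 <= s + e * z <= tau by case/andP: sz => ? ?; rewrite !ltW.
    by rewrite /edge_density log_meanE ?(flow_gt0 a0 Hflow)//; ring.
Qed.

Lemma transport_dist_flow : exists tau' : R, [/\ 0 < tau', tau' <= tau &
  forall s t, 0 <= s <= tau' -> 0 <= t <= tau' ->
    transport_dist Q pi (r s) (r t) = (`|s - t| * Num.sqrt A0)%:E].
Proof.
have [tau' [C0 [C1 [tau'0 tau'tau Hsub Hout]]]] :=
  calib_constants Q0 pi0 pi1 Qrev a0 ab M0 tau0 Hflow.
exists tau'; split => // s t s01 t01.
have up u : 0 <= u <= tau' -> 0 <= u <= tau.
  by move=> /andP[u0 ut]; rewrite u0 (le_trans ut).
have [->|st] := eqVneq s t.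
  by rewrite subrr normr0 mul0r; apply: transport_dist_self; apply: density_flow; exact: up.
have [adm act] := action_flow (up s s01) (up t t01) st.
rewrite /transport_dist.
suff -> : ereal_inf [set a | exists m f, admissible Q pi (r s) (r t) m f /\
    a = action Q pi m f] = ((t - s) ^+ 2 * A0)%:E.
  by rewrite /sqrte sqrtrM ?sqr_ge0// sqrtr_sqr distrC.
apply/le_anti/andP; split; last first.
  apply: le_ereal_inf_tmp => _ [m [f [madm ->]]].
  exact: (action_lower Q0 pi0 Qrev a0 ab M0 tau0 Hflow tau'tau Hsub Hout s01 t01 st madm).
by apply: ereal_inf_lbound; eexists; eexists; split; [exact: adm|rewrite act].
Qed.

(** The curvature bound at the midpoint of the geodesic from [r 0] to [r (2 * s)], whose squared
    length is [4 * s ^+ 2 * A0]. *)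
Lemma entropy_flow_midpoint kappa : entropic_Ric_ge Q pi kappa ->
  exists2 tau' : R, 0 < tau' <= tau & forall s, 0 < s -> 2 * s <= tau' ->
  kappa * A0 * s ^+ 2 <= entropy pi (r 0) + entropy pi (r (2 * s)) - 2 * entropy pi (r s).
Proof.
move=> Ric; have [tau' [tau'0 tau'tau Hd]] := transport_dist_flow.
exists tau' => [|s s0 stau]; first by rewrite tau'0.
have A0_ge0 : 0 <= A0.
  apply: grad_form_ge0 => // x; apply: ltW; apply: (flow_gt0 a0 Hflow).
  by rewrite lexx ltW.
have seg z : 0 <= z <= 1 -> 0 <= 2 * s * z <= tau'.
  by move=> /andP[z0 z1]; apply/andP; split; nra.
have Hg : constant_speed_geodesic Q pi (fun z => r (2 * s * z)).
  split=> [z|u v].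
    rewrite in_itv/= => z01; apply: density_flow.
    by have /andP[h0 h1] := seg z z01; rewrite h0 (le_trans h1).
  rewrite !in_itv/= => u01 v01.
  rewrite !Hd ?seg ?lexx ?ler01// -EFinM; congr (_%:E).
  rewrite mulr0 mulr1 sub0r normrN -mulrBr normrM; ring.
have h01 : (2^-1 : R) \in `[0, 1].
  by rewrite in_itv/= invr_ge0 ler0n/= invf_le1// ler1n.
have := Ric _ Hg _ h01.
rewrite Hd ?seg ?lexx ?ler01// -EFin_expe -EFinM -EFinB lee_fin.
rewrite !mulr0 !mulr1 sub0r normrN exprMn real_normK ?num_real// sqr_sqrtr//.
have -> : 2 * s * 2^-1 = s by field.
set e0 := entropy _ _; set e1 := entropy _ _; set e2 := entropy _ _.
have -> : kappa / 2 * 2^-1 * (1 - 2^-1) * ((2 * s) ^+ 2 * A0) = kappa * A0 * s ^+ 2 / 2.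
  by field.
lra.
Qed.

End Geodesics.

(** * The Bochner inequality *)

Section Bochner.
Context {R : realType} {X : finType}.
Variables (Q : X -> X -> R) (pi : X -> R).
Hypothesis Q0 : forall x y, 0 <= Q x y.
Hypothesis pi0 : forall x, 0 < pi x.
Hypothesis pi1 : \sum_x pi x = 1.
Hypothesis Qrev : reversible Q pi.
Local Notation dsum := (dsum Q pi).
Local Notation grad_form := (grad_form Q pi).
Local Notation rdot := (density_drift Q).
Local Notation pdot := (pdot Q).

(* Since [th s t * (ln s - ln t) = s - t], the entropy along a [flow] has
   derivative [dsum (fun x y => (p x - p y) * (r x - r y)) / 2]; this is the
   derivative of that expression. *)
Definition hess_form (rho psi : X -> R) : R :=
  2^-1 * dsum (fun x y => (pdot rho psi x - pdot rho psi y) * (rho x - rho y)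
    + (psi x - psi y) * (rdot rho psi x - rdot rho psi y)).

Lemma continuous_rdot (r p : R -> X -> R) (t : R) x : (forall y, 0 < r t y) ->
  (forall y, {for t, continuous (r^~ y)}) -> (forall y, {for t, continuous (p^~ y)}) ->
  {for t, continuous (fun t => rdot (r t) (p t) x)}.
Proof.
move=> r0 rc pc; apply: continuous_sum_at => y; apply: cvgM; first exact: cvg_cst.
apply: cvgM; first exact: continuous_th.
by apply: cvgB; exact: pc.
Qed.

Lemma continuous_pdot (r p : R -> X -> R) (t : R) x : (forall y, 0 < r t y) ->
  (forall y, {for t, continuous (r^~ y)}) -> (forall y, {for t, continuous (p^~ y)}) ->
  {for t, continuous (fun t => pdot (r t) (p t) x)}.
Proof.
move=> r0 rc pc; apply: continuous_sum_at => y; apply: cvgM; first exact: cvg_cst.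
apply: cvgM; first exact: cvg_cst.
apply: cvgM; first exact: continuous_th1.
have cpB : {for t, continuous (fun t => p t x - p t y)} by apply: cvgB; exact: pc.
exact: (cvgM cpB cpB).
Qed.

(** The entropy along the flow has second differences at least [kappa * A0 * s ^+ 2]. If its second
    derivative at time [0] were smaller than [kappa * A0], it would stay smaller by a fixed [eta]
    for a short time, and so would the second differences. *)
Lemma bochner kappa : entropic_Ric_ge Q pi kappa -> forall rho psi,
  (forall x, 0 < rho x) -> \sum_x rho x * pi x = 1 ->
  kappa * grad_form rho psi psi <= hess_form rho psi.
Proof.
move=> Ric rho psi rho0 mrho.
have [a [b [M [tau [r [p [a0 ab M0 tau0 [Hflow r0 p0]]]]]]]] := flow_exists Q0 psi rho0.
have mass0 : \sum_x r 0 x * pi x = 1 by rewrite r0.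
have [tau' /andP[tau'0 tau'tau] Hent] :=
  entropy_flow_midpoint Q0 pi0 pi1 Qrev a0 ab M0 tau0 Hflow mass0 Ric.
rewrite r0 p0 in Hent.
have [rc pc _ _ rpd] := Hflow.
pose h t := entropy pi (r t).
pose h1 t := 2^-1 * dsum (fun x y => (p t x - p t y) * (r t x - r t y)).
pose h2 t := hess_form (r t) (p t).
have rp t x : 0 <= t <= tau -> 0 < r t x by exact: (flow_gt0 a0 Hflow).
have lt_le (t : R) : 0 < t < tau -> 0 <= t <= tau.
  by move=> /andP[t0 tt]; rewrite !ltW.
have ch t : 0 <= t <= tau -> {for t, continuous h}.
  move=> tt; apply: continuous_sum_at => x; apply: cvgM; first exact: cvg_cst.
  apply: cvgM; first exact: rc.
  apply: (@continuous_comp _ _ _ (r^~ x) (@ln R)); first exact: rc.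
  exact: is_derive_continuous (is_derive1_ln (rp t x tt)).
have ch1 t : {for t, continuous h1}.
  apply: cvgM; first exact: cvg_cst.
  apply: continuous_dsum => x y; apply: cvgM; apply: cvgB; try exact: pc; exact: rc.
have ch2 t : 0 <= t <= tau -> {for t, continuous h2}.
  move=> tt; apply: cvgM; first exact: cvg_cst.
  have cr x : {for t, continuous (fun t => rdot (r t) (p t) x)}.
    by apply: continuous_rdot => y; [exact: rp|exact: rc|exact: pc].
  have cp x : {for t, continuous (fun t => pdot (r t) (p t) x)}.
    by apply: continuous_pdot => y; [exact: rp|exact: rc|exact: pc].
  apply: continuous_dsum => x y; apply: cvgD; apply: cvgM; apply: cvgB;
    by [exact: cr|exact: cp|exact: rc|exact: pc].
have dh t : 0 < t < tau -> is_derive t 1 h (h1 t).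
  move=> tt; have tt' := lt_le t tt.
  have dr x := (rpd t x tt).1.
  have dl x := @is_derive_comp_fun R _ (r^~ x) t _ _ (is_derive1_ln (rp t x tt')) (dr x).
  have dS := is_derive_sum_fun xpredT (fun x => is_deriveZ_fun (pi x)
    (is_deriveM_fun (dr x) (dl x))).
  apply: (is_derive_eq dS).
  have -> : \sum_x pi x * (r t x * ((r t x)^-1 * rdot (r t) (p t) x)
      + rdot (r t) (p t) x * ln (r t x)) =
      \sum_x pi x * ((1 + ln (r t x)) * rdot (r t) (p t) x).
    by apply: eq_bigr => x _; field; rewrite gt_eqF// rp.
  rewrite (rdot_form Qrev)//; last by move=> x; exact: rp.
  congr (_ * _); apply: eq_dsum => x y.
  by rewrite -(th_ln (rp t x tt') (rp t y tt')); ring.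
have dh1 t : 0 < t < tau -> is_derive t 1 h1 (h2 t).
  move=> tt.
  have dr x := (rpd t x tt).1; have dp x := (rpd t x tt).2.
  have dS := is_derive_dsum Q pi (fun x y => is_deriveM_fun
    (is_deriveB_fun (dp x) (dp y)) (is_deriveB_fun (dr x) (dr y))).
  apply: (is_derive_eq (is_deriveZ_fun 2^-1 dS)).
  by congr (_ * _); apply: eq_dsum => x y; ring.
set A0 := grad_form rho psi psi in Hent *.
have h20 : h2 0 = hess_form rho psi by rewrite /h2 r0 p0.
rewrite leNgt; apply/negP; rewrite -h20 => lt0.
pose eta := (kappa * A0 - h2 0) / 2.
have eta0 : 0 < eta by rewrite divr_gt0// subr_gt0.
have tau00 : 0 <= (0 : R) <= tau by rewrite lexx ltW.
have /cvgrPdist_lt/(_ _ eta0)[d /= d0 Hd] := ch2 0 tau00.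
pose s := Num.min tau' d / 4.
have m0 : 0 < Num.min tau' d by rewrite lt_min tau'0.
have s0 : 0 < s by rewrite divr_gt0.
have std : 4 * s <= tau' /\ 4 * s <= d.
  have -> : 4 * s = Num.min tau' d by rewrite /s; field.
  by split; rewrite ge_min lexx ?orbT.
have [st sd] := std.
have h2le t : 0 <= t <= 2 * s -> h2 t <= kappa * A0 - eta.
  move=> /andP[t0 t2]; have : `|0 - t| < d.
    by rewrite sub0r normrN ger0_norm//; lra.
  by move=> /Hd; rewrite ltr_distlC => /andP[_]; rewrite /eta; lra.
pose c := kappa * A0 - eta.
have h1le u : 0 <= u <= s -> h1 (2 * u) - h1 u <= c * u.
  move=> /andP[u0 us].
  have u2 : u <= 2 * u by lra.
  have df t : u < t < 2 * u -> is_derive t 1 h1 (h2 t).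
    by move=> /andP[ut tu]; apply: dh1; apply/andP; split; lra.
  have [t /andP[ut tu] ->] := MVT_at u2 df (fun t _ => ch1 t).
  have -> : 2 * u - u = u by ring.
  by rewrite ler_wpM2r// h2le//; apply/andP; split; lra.
(* Its derivative is [2 (c u - (h1 (2 u) - h1 u)) >= 0]. Letting the step [u] vary replaces a Taylor
   expansion at [0], where the flow is only known to be continuous. *)
pose k u := c * u ^+ 2 - (h (2 * u) - 2 * h u).
have : k 0 <= k s.
  apply: (@derive_ge0_le _ k (fun u => c * (2 * u * 1) - (h1 (2 * u) * 2 - 2 * h1 u))).
  - exact: ltW.
  - move=> u /andP[u0 us].
    apply: is_deriveB_fun; first by apply: is_deriveZ_fun; exact: (is_derive_sqr_fun (is_derive_id u 1)).
    apply: is_deriveB_fun.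
      by apply: is_derive_scale; apply: dh; apply/andP; split; lra.
    by apply: is_deriveZ_fun; apply: dh; apply/andP; split; lra.
  - move=> u /andP[u0 us].
    apply: cvgB.
      apply: cvgM; first exact: cvg_cst.
      exact: (is_derive_continuous (is_derive_sqr_fun (is_derive_id u 1))).
    have c2 : {for u, continuous (fun u : R => 2 * u)}.
      by apply: cvgM; [exact: cvg_cst|exact: cvg_id].
    have ch' : {for 2 * u, continuous h} by apply: ch; apply/andP; split; lra.
    apply: cvgB; first exact: (continuous_comp c2 ch').
    apply: cvgM; first exact: cvg_cst.
    by apply: ch; apply/andP; split; lra.
  - move=> u /andP[u0 us].
    have us' : 0 <= u <= s by rewrite !ltW.
    by have := h1le u us'; lra.
have s2 : 2 * s <= tau' by lra.
have := Hent s s0 s2; rewrite /k expr0n/= mulr0 /h r0 mulr0.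
have : 0 < eta * s ^+ 2 by rewrite mulr_gt0// exprn_gt0.
rewrite /c r0; lra.
Qed.

End Bochner.

(** * Heat flow and reverse Poincare inequality *)

Section QuadraticRemainder.
Context {R : realType}.

Lemma is_derive_quadratic (f : R -> R) (x d K : R) :
  (forall z, `|f z - f x - d * (z - x)| <= K * `|z - x| ^+ 2) -> is_derive x 1 f d.
Proof.
move=> H; apply/is_derive1_caratheodory.
exists (fun z => if z == x then d else (f z - f x) / (z - x)); split.
- move=> z; case: eqP => [->|/eqP]; first by rewrite !subrr mulr0.
  by rewrite -subr_eq0 => /divfK ->.
- have cK : {for x, continuous (fun z => K * `|z - x|)}.
    apply: cvgM; first exact: cvg_cst.
    by apply: cvg_norm; apply: cvgB; [exact: cvg_id|exact: cvg_cst].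
  apply: (continuous_at_dominated cK) => [|z]; first by rewrite subrr normr0 mulr0.
  rewrite eqxx; case: eqP => [->|/eqP]; first by rewrite !subrr normr0 mulr0.
  rewrite -subr_eq0 => zx.
  have nzx : 0 < `|z - x| by rewrite normr_gt0.
  have -> : (f z - f x) / (z - x) - d = (f z - f x - d * (z - x)) / (z - x).
    by field.
  by rewrite normrM normfV ler_pdivrMr// -mulrA -expr2 H.
- by rewrite eqxx.
Qed.

(** The negative part has a corner, but its square is differentiable with a quadratic error; this is
    what the energy proof of positivity differentiates. *)
Lemma is_derive_negpart_sqr (x : R) :
  is_derive x 1 (fun y => Num.min y 0 ^+ 2) (2 * Num.min x 0).
Proof.
apply: (@is_derive_quadratic _ _ _ 1) => z.
rewrite mul1r real_normK ?num_real// ler_norml.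
have s := sqr_ge0 (z - x); have sz := sqr_ge0 z; have sx := sqr_ge0 x.
rewrite /Num.min; case: ltP => z0; case: ltP => x0.
- by apply/andP; split; lra.
- have zx : z * x <= 0 by rewrite mulr_le0_ge0// ltW.
  by apply/andP; split; lra.
- have zx : z * x <= 0 by rewrite mulr_ge0_le0// ltW.
  by apply/andP; split; lra.
- by apply/andP; split; lra.
Qed.

End QuadraticRemainder.

Section HeatFlow.
Context {R : realType} {X : finType}.
Variables (Q : X -> X -> R) (pi : X -> R).
Hypothesis Q0 : forall x y, 0 <= Q x y.
Hypothesis pi0 : forall x, 0 < pi x.
Hypothesis pi1 : \sum_x pi x = 1.
Hypothesis Qrev : reversible Q pi.
Local Notation dsum := (dsum Q pi).
Local Notation L := (generator Q).

Definition heat_flow (u : R -> X -> R) : Prop :=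
  (forall x, continuous (u^~ x)) /\
  (forall (t : R) x, 0 < t -> is_derive t 1 (u^~ x) (L (u t) x)).

Lemma heat_flow_exists f : exists2 u, heat_flow u & u 0 = f.
Proof.
pose q := \sum_x \sum_y Q x y.
have q0 : 0 <= q by do 2 apply: sumr_ge0 => ? _.
have L0 : 0 < q * 2 + 1 by rewrite ltr_wpDl// mulr_ge0.
have [u v x|u [cu uu0 du]] := @cauchy_lipschitz R X L (q * 2 + 1) f L0; last first.
  by exists u => //; split=> // t x; exact: du.
pose S := \sum_j `|u j - v j|.
have S0 : 0 <= S by apply: sumr_ge0.
have jS j : `|u j - v j| <= S by rewrite /S (bigD1 j)//= lerDl sumr_ge0.
rewrite /generator -sumrB; apply: le_trans (ler_norm_sum _ _ _) _.
apply: (@le_trans _ _ (\sum_y Q x y * (2 * S))).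
  apply: ler_sum => y _; rewrite -mulrBl mulrC normrM ger0_norm// ler_wpM2l//.
  have -> : u y - u x - (v y - v x) = (u y - v y) - (u x - v x) by ring.
  by apply: le_trans (ler_normB _ _) _; have := jS x; have := jS y; lra.
rewrite -mulr_suml; apply: (@le_trans _ _ (q * (2 * S))).
  apply: ler_wpM2r; first exact: mulr_ge0.
  by rewrite /q [leRHS](bigD1 x)//= lerDl sumr_ge0// => ? _; exact: sumr_ge0.
rewrite -/S (_ : (q * 2 + 1) * S = q * (2 * S) + S); last by ring.
by rewrite lerDl.
Qed.

Lemma generator_form f g :
  \sum_x pi x * (f x * L g x) = - (2^-1) * dsum (fun x y => (f x - f y) * (g x - g y)).
Proof.
have -> : \sum_x pi x * (f x * L g x) =
    \sum_x pi x * (f x * \sum_y Q x y * (g y - g x)).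
  by apply: eq_bigr => x _; do 2 congr (_ * _); apply: eq_bigr => y _; rewrite mulrC.
rewrite (dsum_antisym Qrev); last by move=> x y; ring.
by rewrite mulNr -mulrN -dsumN; congr (_ * _); apply: eq_dsum => x y; ring.
Qed.

Lemma generatorDr f (c : R) x : L (fun y => f y + c) x = L f x.
Proof. by apply: eq_bigr => y _; rewrite opprD addrACA subrr addr0. Qed.

Lemma heat_flowD u (c : R) : heat_flow u -> heat_flow (fun t x => u t x + c).
Proof.
move=> [cu du]; split=> [x t|t x t0].
  by apply: cvgD; [exact: cu|exact: cvg_cst].
rewrite generatorDr -[L _ _]addr0.
exact: (is_deriveD_fun (du t x t0) (is_derive_cst c t 1)).
Qed.

Lemma heat_flow_mean u t : heat_flow u -> 0 <= t ->
  \sum_x u t x * pi x = \sum_x u 0 x * pi x.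
Proof.
move=> [cu du] t0; have t0t : 0 <= t <= t by rewrite t0 lexx.
move: (t0t); apply: (@derive0_cst _ (fun t => \sum_x u t x * pi x)) => s /andP[s0 st].
  have d1 := is_derive_sum_fun xpredT (fun x => is_deriveM_fun (du s x s0)
    (is_derive_cst (pi x) s 1)).
  apply: (is_derive_eq d1).
  transitivity (\sum_x pi x * ((fun=> 1) x * L (u s) x)).
    by apply: eq_bigr => x _ /=; ring.
  rewrite generator_form /dsum big1 ?mulr0// => x _; rewrite big1// => y _.
  by rewrite subrr mul0r mulr0.
by apply: continuous_sum_at => x; apply: cvgM; [exact: cu|exact: cvg_cst].
Qed.

(* The energy of the negative part of a solution decreases, because
   [min(., 0)] is nondecreasing. *)
Lemma heat_flow_ge0 u t : heat_flow u -> (forall x, 0 <= u 0 x) -> 0 <= t ->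
  forall x, 0 <= u t x.
Proof.
move=> [cu du] u0 t0.
pose m (y : R) : R := Num.min y 0.
pose E s := \sum_x pi x * m (u s x) ^+ 2.
have E0 : E 0 = 0.
  by rewrite /E big1// => x _; rewrite /m min_r// expr0n mulr0.
have Et : - E 0 <= - E t.
  apply: (@derive_ge0_le _ (fun s => - E s) (fun s => - \sum_x pi x *
      (2 * m (u s x) * L (u s) x))) => // [s /andP[s0 _]|s _|s /andP[s0 _]].
  - apply: is_deriveN; apply: is_derive_sum_fun => x; apply: is_deriveZ_fun.
    exact: (@is_derive_comp_fun _ (fun y => Num.min y 0 ^+ 2) (u^~ x) _ _ _
      (is_derive_negpart_sqr (u s x)) (du s x s0)).
  - apply: cvgN; apply: continuous_sum_at => x; apply: cvgM; first exact: cvg_cst.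
    have cm := is_derive_continuous (is_derive_negpart_sqr (u s x)).
    exact: (continuous_comp (cu x s) cm).
  - rewrite generator_form -mulNr opprK mulr_ge0//; apply: dsum_ge0 => // x y.
    rewrite -mulrBr -mulrA mulr_ge0// /m /Num.min; case: ltP => hx; case: ltP => hy.
    + by rewrite -expr2 sqr_ge0.
    + by apply: mulr_le0; lra.
    + by apply: mulr_ge0; lra.
    + by rewrite subrr mul0r.
move=> x; rewrite leNgt; apply/negP => ux.
move: Et; rewrite E0 oppr0 oppr_ge0 leNgt => /negP; apply.
rewrite /E (bigD1 x)//= ltr_wpDr ?sumr_ge0// => [y _|].
  by rewrite mulr_ge0 ?sqr_ge0// ltW.
by rewrite /m min_l ?ltW// mulr_gt0// exprn_even_gt0//= lt_eqF.
Qed.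

Lemma heat_flow_gt0 u t : heat_flow u -> (forall x, 0 < u 0 x) -> 0 <= t ->
  forall x, 0 < u t x.
Proof.
move=> hu u0 t0 x.
pose c := \big[Num.min/1]_y u 0 y.
have c0 : 0 < c by rewrite /c; elim/big_ind : _ => // ? ? h h'; rewrite lt_min h.
have : forall y, 0 <= u t y - c.
  apply: (heat_flow_ge0 (heat_flowD (- c) hu)) => // y.
  by rewrite subr_ge0 /c (bigD1 y)//= ge_min lexx.
by move=> /(_ x); rewrite subr_ge0; exact: lt_le_trans.
Qed.

(** A lower curvature bound may always be weakened to some [- k < 0]; this treats all signs together
    and permits division by [k]. *)
Variable k : R.
Hypothesis k0 : 0 < k.
Hypothesis Bochner : forall rho psi, (forall x, 0 < rho x) ->
  \sum_x rho x * pi x = 1 ->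
  - k * grad_form Q pi rho psi psi <= hess_form Q pi rho psi.

(** With [r] running forwards and [u] backwards, the variation of the density pairs [pdot] with
    [L r] and that of the function pairs the drift with [L u]. Summation by parts turns these into
    the two terms of [hess_form], so the Bochner inequality applies. *)
Lemma is_derive_grad_form_heat (r u : R -> X -> R) (t s : R) :
  heat_flow r -> heat_flow u -> (forall x, 0 < r 0 x) -> 0 < s < t ->
  is_derive s 1 (fun s => grad_form Q pi (r s) (u (t - s)) (u (t - s)))
    (2 * hess_form Q pi (r s) (u (t - s))).
Proof.
move=> hr hu r0 /andP[s0 st].
have rp x : 0 < r s x by apply: heat_flow_gt0 => //; exact: ltW.
have ts : 0 < t - s by rewrite subr_gt0.
have dr x := hr.2 s x s0.
have duu x := is_derive_reflect (hu.2 (t - s) x ts).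
have dT x y : is_derive s 1
    (fun s => th (r s x) (r s y) * ((u (t - s) x - u (t - s) y) * (u (t - s) x - u (t - s) y)))
    (- 4 * (2^-1 * (th (r s x) (r s y) * ((u (t - s) x - u (t - s) y)
         * (L (u (t - s)) x - L (u (t - s)) y)))) +
     4 * (4^-1 * ((th1 (r s x) (r s y) * L (r s) x
        + th1 (r s y) (r s x) * L (r s) y) * (u (t - s) x - u (t - s) y) ^+ 2))).
  have d1 := is_derive_th (rp x) (rp y) (dr x) (dr y).
  have d2 := is_deriveB_fun (duu x) (duu y).
  apply: (is_derive_eq (is_deriveM_fun d1 (is_deriveM_fun d2 d2))).
  by field.
apply: (is_derive_eq (is_deriveZ_fun 2^-1 (is_derive_dsum Q pi dT))).
rewrite dsumD (dsumZ _ _ (- 4)) (dsumZ _ _ 4).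
have E1 : dsum (fun x y => 2^-1 * (th (r s x) (r s y) * ((u (t - s) x - u (t - s) y)
    * (L (u (t - s)) x - L (u (t - s)) y)))) =
    \sum_x pi x * (density_drift Q (r s) (u (t - s)) x * L (u (t - s)) x).
  transitivity (\sum_x pi x * (L (u (t - s)) x * density_drift Q (r s) (u (t - s)) x)).
    by rewrite (rdot_form Qrev)// dsumZ.
  by apply: eq_bigr => x _; rewrite [density_drift _ _ _ _ * _]mulrC.
have E2 : dsum (fun x y => 4^-1 * ((th1 (r s x) (r s y) * L (r s) x
        + th1 (r s y) (r s x) * L (r s) y) * (u (t - s) x - u (t - s) y) ^+ 2)) =
    - \sum_x pi x * (pdot Q (r s) (u (t - s)) x * L (r s) x).
  rewrite (_ : \sum_x _ = \sum_x pi x * (L (r s) x * pdot Q (r s) (u (t - s)) x)).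
    by rewrite (pdot_form Qrev) dsumZ mulNr opprK.
  by apply: eq_bigr => x _; rewrite [pdot _ _ _ _ * _]mulrC.
rewrite E1 E2 !generator_form /hess_form dsumD.
have -> : dsum (fun x y => (density_drift Q (r s) (u (t - s)) x - density_drift Q (r s) (u (t - s)) y) *
    (u (t - s) x - u (t - s) y)) =
  dsum (fun x y => (u (t - s) x - u (t - s) y) *
    (density_drift Q (r s) (u (t - s)) x - density_drift Q (r s) (u (t - s)) y)).
  by apply: eq_dsum => x y; rewrite mulrC.
by field.
Qed.

Lemma grad_form_heat_ge (r u : R -> X -> R) (t s : R) :
  heat_flow r -> heat_flow u -> (forall x, 0 < r 0 x) ->
  \sum_x r 0 x * pi x = 1 -> 0 <= s <= t ->
  expR (- (2 * k) * s) * grad_form Q pi (r 0) (u t) (u t) <=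
  grad_form Q pi (r s) (u (t - s)) (u (t - s)).
Proof.
move=> hr hu r0 r1 /andP[s0 st].
pose G s := grad_form Q pi (r s) (u (t - s)) (u (t - s)).
have -> : grad_form Q pi (r 0) (u t) (u t) = G 0 by rewrite /G subr0.
rewrite -/(G s).
have rp z x : 0 <= z -> 0 < r z x by move=> z0; exact: heat_flow_gt0.
have dE (z : R) : is_derive z 1 (fun z => expR ((2 * k) * z)) (expR ((2 * k) * z) * (2 * k)).
  exact: (is_derive_scale (is_derive_expR (2 * k * z))).
have cu z x : {for z, continuous (fun z => u (t - z) x)}.
  have c1 : {for z, continuous (fun z : R => t - z)}.
    by apply: cvgB; [exact: cvg_cst|exact: cvg_id].
  exact: (continuous_comp c1 (hu.1 x (t - z))).
have : expR (2 * k * 0) * G 0 <= expR (2 * k * s) * G s.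
  apply: (@derive_ge0_le _ (fun z => expR (2 * k * z) * G z) (fun z =>
    expR (2 * k * z) * (2 * hess_form Q pi (r z) (u (t - z)))
    + expR (2 * k * z) * (2 * k) * G z)) => //.
  - move=> z /andP[z0 zs]; apply: is_deriveM_fun.
    by apply: is_derive_grad_form_heat => //; rewrite z0 (lt_le_trans zs).
  - move=> z /andP[z0 zs]; apply: cvgM; first exact: is_derive_continuous (dE z).
    apply: cvgM; first exact: cvg_cst.
    apply: continuous_dsum => x y; apply: cvgM.
      by apply: continuous_th; [exact: rp|exact: rp|exact: hr.1|exact: hr.1].
    have cB : {for z, continuous (fun z => u (t - z) x - u (t - z) y)}.
      by apply: cvgB; exact: cu.
    exact: (cvgM cB cB).
  - move=> z /andP[z0 zs].
    rewrite -[_ * _ * G z]mulrA -mulrDr mulr_ge0 ?expR_ge0//.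
    have z0' : 0 <= z by exact: ltW.
    have := Bochner (u (t - z)) (rp z ^~ z0') (etrans (heat_flow_mean hr z0') r1).
    by rewrite -/(G z); lra.
rewrite mulr0 expR0 mul1r mulNr expRN => H.
by rewrite ler_pdivrMl ?expR_gt0.
Qed.

(** The derivative of [Phi] is the squared gradient of [u (t - s)] weighted by the arithmetic mean
    of [r s]. This mean dominates the logarithmic one, so the derivative is at least
    [2 * grad_form], hence at least [2 * expR (- (2 * k) * s) * G0]. [J] is the integral of the
    exponential factor, and [Phi t] involves only [u 0] and a density of mass one. *)
Lemma reverse_poincare (r u : R -> X -> R) (t c : R) :
  heat_flow r -> heat_flow u -> (forall x, 0 < r 0 x) ->
  \sum_x r 0 x * pi x = 1 -> 0 <= t -> (forall x, `|u 0 x| <= c) ->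
  grad_form Q pi (r 0) (u t) (u t) * ((1 - expR (- (2 * k) * t)) / k) <= c ^+ 2.
Proof.
move=> hr hu r0 r1 t0 uc.
set G0 := grad_form Q pi (r 0) (u t) (u t).
have rp z x : 0 <= z -> 0 < r z x by move=> z0; exact: heat_flow_gt0.
pose Phi s := \sum_x pi x * (r s x * u (t - s) x ^+ 2).
pose J s := (1 - expR (- (2 * k) * s)) / k.
have cu z x : {for z, continuous (fun z => u (t - z) x)}.
  have c1 : {for z, continuous (fun z : R => t - z)}.
    by apply: cvgB; [exact: cvg_cst|exact: cvg_id].
  exact: (continuous_comp c1 (hu.1 x (t - z))).
have dJ (z : R) : is_derive z 1 J (2 * expR (- (2 * k) * z)).
  have d1 := is_derive_scale (is_derive_expR (- (2 * k) * z)).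
  have d2 := is_deriveM_fun (is_deriveB_fun (is_derive_cst (1 : R) z 1) d1)
    (is_derive_cst (k^-1) z 1).
  by apply: (is_derive_eq d2); rewrite /=; field; rewrite gt_eqF.
have : Phi 0 - G0 * J 0 <= Phi t - G0 * J t.
  apply: (@derive_ge0_le _ (fun s => Phi s - G0 * J s) (fun s =>
    \sum_x pi x * (r s x * (2 * u (t - s) x * - L (u (t - s)) x)
       + L (r s) x * u (t - s) x ^+ 2)
    - G0 * (2 * expR (- (2 * k) * s)))) => //.
  - move=> s /andP[s0 st].
    have ts : 0 < t - s by rewrite subr_gt0.
    have du x := is_derive_sqr_fun (is_derive_reflect (hu.2 (t - s) x ts)).
    have dPhi := is_derive_sum_fun xpredT (fun x => is_deriveZ_fun (pi x)
      (is_deriveM_fun (hr.2 s x s0) (du x))).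
    exact: (is_deriveB_fun dPhi (is_deriveZ_fun G0 (dJ s))).
  - move=> s /andP[s0 st]; apply: cvgB; last first.
      apply: cvgM; first exact: cvg_cst.
      exact: is_derive_continuous (dJ s).
    apply: continuous_sum_at => x; apply: cvgM; first exact: cvg_cst.
    by apply: cvgM; [exact: hr.1|exact: (cvgM (cu s x) (cu s x))].
  - move=> s /andP[s0 st]; rewrite subr_ge0.
    have s0t : 0 <= s <= t by rewrite !ltW.
    have H := grad_form_heat_ge hr hu r0 r1 s0t.
    set v := u (t - s); rewrite -/v in H.
    have -> : \sum_x pi x * (r s x * (2 * v x * - L v x) + L (r s) x * v x ^+ 2) =
      - 2 * \sum_x pi x * ((r s x * v x) * L v x) +
      \sum_x pi x * (v x ^+ 2 * L (r s) x).
      by rewrite mulr_sumr -big_split; apply: eq_bigr => x _ /=; ring.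
    rewrite !generator_form.
    have -> : - 2 * (- (2^-1) * dsum (fun x y => (r s x * v x - r s y * v y) * (v x - v y)))
      + - (2^-1) * dsum (fun x y => (v x ^+ 2 - v y ^+ 2) * (r s x - r s y)) =
      dsum (fun x y => (r s x + r s y) / 2 * ((v x - v y) * (v x - v y))).
      by rewrite mulrA -!dsumZ -dsumD; apply: eq_dsum => x y; field.
    apply: (@le_trans _ _ (2 * grad_form Q pi (r s) v v)).
      by rewrite mulrCA ler_wpM2l// mulrC.
    rewrite /grad_form mulrA divff// mul1r; apply: dsum_le => // x y.
    by rewrite ler_wpM2r -?expr2 ?sqr_ge0// th_le_mean// rp// ltW.
rewrite /J mulr0 expR0 subrr mul0r mulr0 subr0 -/(J t) => H.
have Phi0 : 0 <= Phi 0.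
  apply: sumr_ge0 => x _; apply: mulr_ge0; first exact: ltW.
  by apply: mulr_ge0; [exact/ltW/rp|exact: sqr_ge0].
have Phit : Phi t <= c ^+ 2.
  apply: (@le_trans _ _ (\sum_x r t x * pi x * c ^+ 2)); last first.
    by rewrite -mulr_suml (heat_flow_mean hr t0) r1 mul1r.
  apply: ler_sum => x _; rewrite subrr mulrA [pi x * _]mulrC ler_wpM2l//.
    by apply: mulr_ge0; [exact/ltW/rp|exact: ltW].
  by rewrite -(real_normK (num_real (u 0 x))) lerXn2r ?nnegrE// (le_trans _ (uc x)).
by rewrite -/(J t); lra.
Qed.

End HeatFlow.

(** * Spectral gap *)

Section SpectralGap.
Context {R : realType} {X : finType}.
Variables (Q : X -> X -> R) (pi : X -> R).
Hypothesis Q0 : forall x y, 0 <= Q x y.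
Hypothesis pi0 : forall x, 0 < pi x.
Hypothesis pi1 : \sum_x pi x = 1.
Hypothesis Qrev : reversible Q pi.
Hypothesis Qirr : irreducible Q.
Local Notation dsum := (dsum Q pi).
Local Notation L := (generator Q).
Implicit Types f g v : X -> R.

Definition dirichlet f g : R := 2^-1 * dsum (fun x y => (f x - f y) * (g x - g y)).
Definition weighted_ip f g : R := \sum_x pi x * (f x * g x).

Lemma dirichletE f g : dirichlet f g = - weighted_ip f (L g).
Proof. by rewrite /dirichlet /weighted_ip (generator_form Qrev) mulNr opprK. Qed.

Lemma dirichlet_ge0 f : 0 <= dirichlet f f.
Proof. by rewrite mulr_ge0// dsum_ge0// => x y; rewrite -expr2 sqr_ge0. Qed.

Lemma dirichlet_lin f g (s : R) :
  dirichlet (fun x => f x + s * g x) (fun x => f x + s * g x) =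
  dirichlet f f + 2 * s * dirichlet f g + s ^+ 2 * dirichlet g g.
Proof.
have -> : dirichlet (fun x => f x + s * g x) (fun x => f x + s * g x) =
  2^-1 * dsum (fun x y => (f x - f y) * (f x - f y) + 2 * s * ((f x - f y) * (g x - g y))
   + s ^+ 2 * ((g x - g y) * (g x - g y))).
  by congr (_ * _); apply: eq_dsum => x y; ring.
by rewrite !dsumD !dsumZ /dirichlet; ring.
Qed.

Lemma ip_lin f g (s : R) :
  weighted_ip (fun x => f x + s * g x) (fun x => f x + s * g x) =
  weighted_ip f f + 2 * s * weighted_ip f g + s ^+ 2 * weighted_ip g g.
Proof.
by rewrite /weighted_ip !mulr_sumr -!big_split; apply: eq_bigr => x _ /=; ring.
Qed.

Lemma ip_ge0 f : 0 <= weighted_ip f f.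
Proof.
by apply: sumr_ge0 => x _; apply: mulr_ge0; [exact: ltW|rewrite -expr2 sqr_ge0].
Qed.

Lemma ip_eq0 f : weighted_ip f f = 0 -> forall x, f x = 0.
Proof.
move=> /eqP; rewrite psumr_eq0; last first.
  by move=> x _; apply: mulr_ge0; [exact: ltW|rewrite -expr2 sqr_ge0].
move=> /allP H x; have := H x (mem_index_enum x).
by rewrite mulf_eq0 gt_eqF//= mulf_eq0 orbb => /eqP.
Qed.

Lemma dirichlet0_cst f : dirichlet f f = 0 -> forall x y, f x = f y.
Proof.
move=> /eqP; rewrite mulf_eq0 invr_eq0 pnatr_eq0/= => D0.
have T0 x y : 0 <= Q x y * pi x * ((f x - f y) * (f x - f y)).
  by rewrite mulr_ge0 -?expr2 ?sqr_ge0// mulr_ge0// ltW.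
have edge x y : 0 < Q x y -> f x = f y.
  move=> Qxy; move: D0; rewrite psumr_eq0; last by move=> ? _; exact: sumr_ge0.
  move=> /allP/(_ x (mem_index_enum x))/=; rewrite psumr_eq0// => /allP.
  move=> /(_ y (mem_index_enum y))/=; rewrite !mulf_eq0 (gt_eqF Qxy) (gt_eqF (pi0 x))/= orbb subr_eq0.
  by move=> /eqP.
move=> x y; have /connectP[s] := Qirr x y.
elim: s x => [|z s IH] x /=; first by move=> _ ->.
by move=> /andP[xz zs] ys; rewrite (edge x z xz) (IH z zs ys).
Qed.

Lemma scale_form (c : R) f :
  dirichlet (fun x => c * f x) (fun x => c * f x) = c ^+ 2 * dirichlet f f /\
  weighted_ip (fun x => c * f x) (fun x => c * f x) = c ^+ 2 * weighted_ip f f.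
Proof.
split.
  rewrite /dirichlet [RHS]mulrCA; congr (_ * _); rewrite -dsumZ.
  by apply: eq_dsum => x y; ring.
by rewrite /weighted_ip mulr_sumr; apply: eq_bigr => x _; ring.
Qed.

(** The functions are reached through an evaluation [ev] from an abstract space, so that compactness
    can be supplied by Tychonoff's theorem in the product topology. *)
Lemma dirichlet_min_compact (T : topologicalType) (ev : T -> X -> R) (K : set T) :
  compact K -> (forall x, continuous (fun w => ev w x)) ->
  (exists w, [/\ K w, \sum_x ev w x * pi x = 0 & weighted_ip (ev w) (ev w) = 1]) ->
  exists w0, [/\ K w0, \sum_x ev w0 x * pi x = 0, weighted_ip (ev w0) (ev w0) = 1 &
    forall w, K w -> \sum_x ev w x * pi x = 0 -> weighted_ip (ev w) (ev w) = 1 ->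
      dirichlet (ev w0) (ev w0) <= dirichlet (ev w) (ev w)].
Proof.
move=> cK ec [w1 [w1K w1m w1n]].
have mc : continuous (fun w => \sum_x ev w x * pi x).
  by move=> w; apply: continuous_sum_at => x; apply: cvgM; [exact: ec|exact: cvg_cst].
have ic : continuous (fun w => weighted_ip (ev w) (ev w)).
  move=> w; apply: continuous_sum_at => x; apply: cvgM; first exact: cvg_cst.
  exact: (cvgM (ec x w) (ec x w)).
have dc : continuous (fun w => dirichlet (ev w) (ev w)).
  move=> w; apply: cvgM; first exact: cvg_cst.
  apply: continuous_sum_at => x; apply: continuous_sum_at => y.
  apply: cvgM; first exact: cvg_cst.
  have cd : {for w, continuous (fun w => ev w x - ev w y)} by apply: cvgB; exact: ec.
  exact: (cvgM cd cd).
pose S : set T := K `&` ((fun w => \sum_x ev w x * pi x) @^-1` [set 0] `&`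
  (fun w => weighted_ip (ev w) (ev w)) @^-1` [set 1]).
have cS : compact S.
  apply: compact_closedI => //; apply: closedI.
    by apply: closed_comp => [w _|]; [exact: mc|exact: closed_eq].
  by apply: closed_comp => [w _|]; [exact: ic|exact: closed_eq].
have S0 : S !=set0 by exists w1.
have [w0 w0S wmin] := compact_EVT_min S0 cS (continuous_subspaceT dc).
have [w0K [w0m w0n]] := set_mem w0S.
by exists w0; split => // w wK wm wn; apply: wmin; apply: mem_set.
Qed.

Lemma rayleigh_min : (exists2 v, \sum_x v x * pi x = 0 & weighted_ip v v != 0) ->
  exists v0, [/\ \sum_x v0 x * pi x = 0, weighted_ip v0 v0 = 1 &
   forall v, \sum_x v x * pi x = 0 -> dirichlet v0 v0 * weighted_ip v v <= dirichlet v v].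
Proof.
move=> [w w0 wn0].
(* A unit vector satisfies [v x ^+ 2 <= (pi x)^-1 <= B <= B ^+ 2], so the unit sphere lies in the
   cube [K]. *)
pose B : R := 1 + \sum_x (pi x)^-1.
have Bx x : (pi x)^-1 <= B.
  rewrite /B (bigD1 x)//= addrCA lerDl addr_ge0// sumr_ge0// => y _.
  by rewrite invr_ge0 ltW.
have B1 : 1 <= B by rewrite lerDl sumr_ge0// => y _; rewrite invr_ge0 ltW.
pose K := [set v : X -> R | forall x, `[- B, B]%classic (v x)].
have normalize v : \sum_x v x * pi x = 0 -> weighted_ip v v != 0 ->
    let v' x := (Num.sqrt (weighted_ip v v))^-1 * v x in
    [/\ K v', \sum_x v' x * pi x = 0 & weighted_ip v' v' = 1].
  move=> v0 vn0; set c := (Num.sqrt _)^-1; cbv zeta.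
  have c2 : c ^+ 2 * weighted_ip v v = 1.
    by rewrite /c exprVn sqr_sqrtr ?ip_ge0// mulVf.
  have n1 : weighted_ip (fun x => c * v x) (fun x => c * v x) = 1 by rewrite (scale_form c v).2.
  split => //; last first.
    by under eq_bigr => x _ do rewrite -mulrA; rewrite -mulr_sumr v0 mulr0.
  move=> x /=; rewrite in_itv/= -ler_norml.
  have h : pi x * (c * v x) ^+ 2 <= 1.
    rewrite -n1 /weighted_ip [leRHS](bigD1 x)//= -expr2 lerDl sumr_ge0// => y _.
    by apply: mulr_ge0; [exact: ltW|rewrite -expr2 sqr_ge0].
  have h2 : `|c * v x| ^+ 2 <= B ^+ 2.
    rewrite real_normK ?num_real//; apply: (@le_trans _ _ (pi x)^-1).
      by rewrite -ler_pdivlMl// mulr1 in h.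
    by apply: le_trans (Bx x) _; rewrite expr2 ler_peMr// (le_trans _ B1).
  by rewrite -(@ler_pXn2r _ 2)// nnegrE ?(le_trans _ B1).
have cK : @compact (prod_topology (fun _ : X => R : topologicalType)) K.
  apply: (@tychonoff X (fun _ => R : topologicalType) (fun _ => `[- B, B]%classic)) => x.
  exact: segment_compact.
have [|v0 [_ v00 v01 vmin]] := dirichlet_min_compact
    (T := prod_topology (fun _ : X => R : topologicalType)) (ev := fun v => v) cK
    (fun x => @proj_continuous X (fun _ => R : topologicalType) x).
  by eexists; exact: (normalize w w0 wn0).
exists v0; split => // v vm.
have [->|vn0] := eqVneq (weighted_ip v v) 0; first by rewrite mulr0 dirichlet_ge0.
have [nK nm n1] := normalize v vm vn0.
have := vmin _ nK nm n1.
have vp : 0 < weighted_ip v v by rewrite lt_neqAle eq_sym vn0 ip_ge0.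
rewrite (scale_form _ v).1 exprVn sqr_sqrtr ?ip_ge0// => h.
by rewrite -ler_pdivlMr// mulrC.
Qed.

Lemma quadratic_crit (al be : R) : (forall s : R, 0 <= 2 * s * al + s ^+ 2 * be) -> al = 0.
Proof.
move=> H; apply/eqP; apply/negPn/negP => al0.
have b1 : 0 < 1 + `|be| by rewrite ltr_wpDr.
(* This [s] is small enough for the linear term to outweigh [s ^+ 2 * be], whatever the sign of
   [be]. *)
have := H (- al / (1 + `|be|)).
have -> : 2 * (- al / (1 + `|be|)) * al + (- al / (1 + `|be|)) ^+ 2 * be =
  (al / (1 + `|be|)) ^+ 2 * (be - 2 * (1 + `|be|)).
  by field; rewrite gt_eqF.
have a2 : 0 < (al / (1 + `|be|)) ^+ 2.
  by rewrite exprn_even_gt0//= mulf_neq0// invr_eq0 gt_eqF.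
rewrite pmulr_rge0// => h; have := ler_norm be; have := normr_ge0 be; lra.
Qed.

Variable lam : R.
Hypothesis gap : spectral_gap Q lam.

Lemma spectral_gap_gt0 : 0 < lam.
Proof.
have [[lam0 [psi [x psix] Lpsi]] _] := gap.
have N0 : 0 < weighted_ip psi psi.
  rewrite lt_neqAle ip_ge0 andbT eq_sym; apply/eqP => /ip_eq0 /(_ x) h.
  by rewrite h eqxx in psix.
have E : dirichlet psi psi = lam * weighted_ip psi psi.
  rewrite dirichletE /weighted_ip -sumrN mulr_sumr; apply: eq_bigr => y _.
  by rewrite -!mulrN Lpsi; ring.
have := dirichlet_ge0 psi; rewrite E pmulr_lge0// => lam_ge0.
by rewrite lt_neqAle eq_sym lam0.
Qed.

(** [lam] is given as the least nonzero eigenvalue, not as a Rayleigh quotient. The minimal quotient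
    is shown to be a nonzero eigenvalue: nonzero because otherwise the minimiser would be constant
    by irreducibility, hence [0]; an eigenvalue because the minimiser is critical. *)
Lemma poincare v : \sum_x v x * pi x = 0 -> lam * weighted_ip v v <= dirichlet v v.
Proof.
move=> vm; have [->|vn0] := eqVneq (weighted_ip v v) 0; first by rewrite mulr0 dirichlet_ge0.
have [v0 [m0 n0 Hmin]] := rayleigh_min (ex_intro2 _ _ v vm vn0).
apply: le_trans (Hmin v vm); rewrite ler_wpM2r ?ip_ge0//.
set m := dirichlet v0 v0.
apply: gap.2; split.
  apply/eqP => mz; have v0c := dirichlet0_cst mz.
  have v0z x : v0 x = 0.
    rewrite -m0 -[LHS]mulr1 -pi1 mulr_sumr; apply: eq_bigr => y _.
    by rewrite (v0c x y).
  move: n0; rewrite /weighted_ip big1 => [/esym/eqP|x _]; first by rewrite oner_eq0.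
  by rewrite v0z !mulr0.
have crit f : \sum_x f x * pi x = 0 -> dirichlet v0 f - m * weighted_ip v0 f = 0.
  move=> fm; apply: (@quadratic_crit _ (dirichlet f f - m * weighted_ip f f)) => s.
  have sm : \sum_x (v0 x + s * f x) * pi x = 0.
    under eq_bigr => x _ do rewrite mulrDl -mulrA.
    by rewrite big_split/= -mulr_sumr m0 fm mulr0 addr0.
  have := Hmin _ sm; rewrite dirichlet_lin ip_lin n0 -/m.
  by rewrite -subr_ge0; congr (0 <= _); ring.
exists v0.
  apply: contrapT => H; move: n0; rewrite /weighted_ip big1 => [/esym/eqP|x _]; first by rewrite oner_eq0.
  have -> : v0 x = 0 by apply: contrapT => /eqP h; apply: H; exists x.
  by rewrite !mulr0.
move=> x.
(* The centred point mass is an admissible variation; testing criticality with it gives the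
   eigenvalue equation at [x]. *)
pose f y : R := (y == x)%:R - pi x.
have fm : \sum_y f y * pi y = 0.
  rewrite /f; under eq_bigr => y _ do rewrite mulrBl.
  rewrite sumrB -mulr_sumr pi1 mulr1 (bigD1 x)//= eqxx mul1r big1 ?addr0 ?subrr//.
  by move=> y /negbTE ->; rewrite mul0r.
have := crit f fm.
have -> : dirichlet v0 f = - pi x * L v0 x.
  have -> : dirichlet v0 f = dirichlet f v0.
    by congr (_ * _); apply: eq_dsum => y z; ring.
  have -> : dirichlet f v0 = dirichlet (fun y => (y == x)%:R) v0.
    by congr (_ * _); apply: eq_dsum => y z; rewrite /f; ring.
  rewrite dirichletE /weighted_ip (bigD1 x)//= eqxx mul1r big1 ?addr0 ?mulNr//.
  by move=> y /negbTE ->; rewrite mul0r mulr0.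
have -> : weighted_ip v0 f = pi x * v0 x.
  rewrite /weighted_ip /f; under eq_bigr => y _ do rewrite mulrBr mulrBr.
  rewrite sumrB [X in _ - X](_ : _ = pi x * \sum_y v0 y * pi y).
    rewrite m0 mulr0 subr0 (bigD1 x)//= eqxx mulr1 big1 ?addr0//.
    by move=> y /negbTE ->; rewrite !mulr0.
  by rewrite mulr_sumr; apply: eq_bigr => y _; ring.
move=> h; apply: (mulfI (lt0r_neq0 (pi0 x))).
by apply/eqP; rewrite -subr_eq0 -h; apply/eqP; ring.
Qed.

End SpectralGap.

(** * Isoperimetry *)

Section ExponentialBounds.
Context {R : realType}.

(** From [(1 + 1/8) ^ 8 <= e]; a bound this sharp is used so that [1 - expR (- 1) >= 61/100]. *)
Lemma expRN1_le : expR (- 1) <= 39 / 100 :> R.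
Proof.
have h : (9 / 8) ^+ 8 <= expR 1 :> R.
  have -> : expR 1 = expR 8^-1 ^+ 8 :> R by rewrite -expRM_natl; congr expR; field.
  rewrite lerXn2r ?nnegrE ?expR_ge0//.
  by apply: le_trans (expR_ge1Dx _); lra.
rewrite expRN -[leRHS]invrK lef_pV2 ?posrE ?expR_gt0//.
apply: le_trans h; rewrite invf_div -subr_ge0.
by rewrite !exprS expr0; lra.
Qed.

(* [exp (- u)] lies below its chord: combine the tangent inequalities
   [1 >= exp (- u) (1 + u)] and [exp (- 1) >= exp (- u) u]. *)
Lemma expRN_chord (u : R) : 0 <= u <= 1 -> (1 - expR (- 1)) * u <= 1 - expR (- u).
Proof.
move=> /andP[u0 u1].
have e0 := expR_gt0 (- u).
have h1 : expR (- u) * (1 + u) <= 1.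
  by rewrite -[leRHS](expRxMexpNx_1 u) mulrC ler_wpM2r ?expR_ge1Dx// ltW.
have h2 : expR (- u) * u <= expR (- 1).
  have -> : expR (- 1) = expR (- u) * expR (u - 1) by rewrite -expRD; congr expR; ring.
  by rewrite (ler_wpM2l (ltW e0))//; have := expR_ge1Dx (u - 1); lra.
have g1 : 0 <= 1 - u by lra.
have := ler_wpM2r g1 h1; have := ler_wpM2r u0 h2.
have -> : expR (- u) * (1 + u) * (1 - u) = expR (- u) - expR (- u) * u * u by ring.
lra.
Qed.

End ExponentialBounds.

(** * From the gradient estimate to the perimeter *)

Section Isoperimetry.
Context {R : realType} {X : finType}.
Variables (Q : X -> X -> R) (pi : X -> R).
Hypothesis Q0 : forall x y, 0 <= Q x y.
Hypothesis Qxx : forall x, Q x x = 0.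
Hypothesis pi0 : forall x, 0 < pi x.
Hypothesis pi1 : \sum_x pi x = 1.
Hypothesis Qrev : reversible Q pi.
Hypothesis Qirr : irreducible Q.
Local Notation dsum := (dsum Q pi).
Local Notation L := (generator Q).
Local Notation dirichlet := (dirichlet Q pi).
Local Notation ip := (weighted_ip pi).
Variable k : R.
Hypothesis k0 : 0 < k.
Hypothesis Bochner : forall rho psi, (forall x, 0 < rho x) ->
  \sum_x rho x * pi x = 1 ->
  - k * grad_form Q pi rho psi psi <= hess_form Q pi rho psi.
Variable lam : R.
Hypothesis gap : spectral_gap Q lam.
Variable Qm : R.
Hypothesis Qm0 : 0 < Qm.
Hypothesis Qm_le : forall x y, 0 < Q x y -> Qm <= Q x y.

(** Equal values at the endpoints make the logarithmic mean explicit. The edge occurs in both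
    orientations, which cancels the [2^-1] of [grad_form]. *)
Lemma grad_form_edge (rho v : X -> R) x y : x != y -> (forall z, 0 <= rho z) ->
  rho x = rho y ->
  Q x y * pi x * rho x * (v x - v y) ^+ 2 <= grad_form Q pi rho v v.
Proof.
move=> xy rho0 rxy.
pose T a b := Q a b * pi a * (th (rho a) (rho b) * ((v a - v b) * (v a - v b))).
have T0 a b : 0 <= T a b.
  apply: mulr_ge0; first by apply: mulr_ge0 => //; exact: ltW.
  by apply: mulr_ge0; [exact: th_ge0|rewrite -expr2 sqr_ge0].
have Txy : T x y = Q x y * pi x * rho x * (v x - v y) ^+ 2.
  by rewrite /T rxy thxx; ring.
have Tyx : T y x = Q x y * pi x * rho x * (v x - v y) ^+ 2.
  by rewrite /T rxy thxx -Qrev; ring.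
have S0 a : 0 <= \sum_b T a b by apply: sumr_ge0.
have Sx a b : T a b <= \sum_c T a c.
  by rewrite (bigD1 b)//= lerDl sumr_ge0.
have : T x y + T y x <= dsum (fun a b => th (rho a) (rho b) * ((v a - v b) * (v a - v b))).
  rewrite -[leRHS]/(\sum_a \sum_b T a b) [leRHS](bigD1 x)//=.
  rewrite [X in _ <= _ + X](bigD1 y) 1?eq_sym//= addrA.
  apply: (@le_trans _ _ (\sum_b T x b + \sum_b T y b)); first exact: lerD.
  by rewrite lerDl sumr_ge0.
rewrite Txy Tyx /grad_form; lra.
Qed.

(* Apply the reverse Poincare inequality to densities that put mass [e] close to
   0 away from [x] and [y], equally distributed on the edge. *)
Lemma edge_gradient (u : R -> X -> R) (t c : R) x y :
  heat_flow Q u -> 0 <= t -> (forall z, `|u 0 z| <= c) -> 0 < Q x y ->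
  (u t x - u t y) ^+ 2 * (Qm / 2) * ((1 - expR (- (2 * k) * t)) / k) <= c ^+ 2.
Proof.
move=> hu t0 uc Qxy.
set J := _ / k; set Y := _ * J.
have J0 : 0 <= J.
  apply: divr_ge0; last exact: ltW.
  by rewrite subr_ge0 -expR0 ler_expR mulNr oppr_le0 mulr_ge0// mulr_ge0// ltW.
have Qm20 : 0 <= Qm / 2 by rewrite divr_ge0// ltW.
have Y0 : 0 <= Y by apply: mulr_ge0 => //; apply: mulr_ge0 => //; exact: sqr_ge0.
have xy : x != y by apply/eqP => xy; move: Qxy; rewrite xy Qxx ltxx.
pose P := pi x + pi y.
have P0 : 0 < P by rewrite addr_gt0.
have P1 : P <= 1.
  by rewrite -pi1 (bigD1 x)//= (bigD1 y) 1?eq_sym//= addrA lerDl sumr_ge0// => z _; exact: ltW.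
(* The average of two lower bounds, one for each orientation of the edge, by reversibility. *)
have wP : Qm / 2 * P <= Q x y * pi x.
  have h1 : Qm * pi x <= Q x y * pi x by rewrite ler_wpM2r ?Qm_le// ltW.
  have h2 : Qm * pi y <= Q x y * pi x.
    rewrite Qrev ler_wpM2r//; first exact: ltW.
    apply: Qm_le; have : 0 < Q y x * pi y by rewrite -Qrev mulr_gt0.
    by rewrite pmulr_lgt0.
  rewrite /P; lra.
have eps_bound e : 0 < e -> e < 1 -> (1 - e) * Y <= c ^+ 2.
  move=> e0 e1.
  (* The common value on the edge, fixed by total mass one: [h * P + e * (1 - P) = 1]. *)
  pose h := (1 - e * (1 - P)) / P.
  have hP : (1 - e) / P <= h by rewrite ler_wpM2r ?invr_ge0 ?(ltW P0)//; nra.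
  have h0 : 0 < h.
    by apply: lt_le_trans hP; rewrite divr_gt0// subr_gt0.
  pose rho z := if (z == x) || (z == y) then h else e.
  have rho0 z : 0 < rho z by rewrite /rho; case: ifP.
  have rhox : rho x = h by rewrite /rho eqxx.
  have rhoy : rho y = h by rewrite /rho eqxx orbT.
  have rho1 : \sum_z rho z * pi z = 1.
    rewrite (bigD1 x)//= (bigD1 y) 1?eq_sym//= rhox rhoy.
    rewrite (eq_bigr (fun z => e * pi z)); last first.
      by move=> z /andP[/negbTE zx /negbTE zy]; rewrite /rho zx zy.
    rewrite -mulr_sumr.
    have : P + \sum_(i | (i != x) && (i != y)) pi i = 1.
      by rewrite -[RHS]pi1 [RHS](bigD1 x)//= [X in _ = _ + X](bigD1 y) 1?eq_sym//= addrA.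
    move=> /(canRL (addKr _)) ->.
    by rewrite /h /P; field; rewrite gt_eqF.
  have [r hr r0] := heat_flow_exists Q0 rho.
  have := @reverse_poincare R X Q pi Q0 pi0 Qrev k k0 Bochner r u t c hr hu.
  rewrite r0 => /(_ rho0 rho1 t0 uc); rewrite -/J; apply: le_trans.
  have H := grad_form_edge (u t) xy (fun z => ltW (rho0 z)) (etrans rhox (esym rhoy)).
  apply: le_trans (ler_wpM2r J0 H); rewrite rhox.
  have -> : (1 - e) * Y = (1 - e) * (Qm / 2) * (u t x - u t y) ^+ 2 * J by rewrite /Y; ring.
  apply: (ler_wpM2r J0); apply: (ler_wpM2r (sqr_ge0 _)).
  apply: (@le_trans _ _ (Qm / 2 * P * ((1 - e) / P))).
    by rewrite le_eqVlt; apply/orP; left; apply/eqP; field; rewrite gt_eqF.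
  apply: ler_pM => //; first by apply: mulr_ge0 => //; exact: ltW.
  by rewrite divr_ge0 ?subr_ge0// ltW.
rewrite leNgt; apply/negP => cY.
have Yp : 0 < Y by apply: le_lt_trans cY; exact: sqr_ge0.
have Y2 : 0 < 2 * Y by exact: mulr_gt0.
(* Replaces the limit [e -> 0]: for this [e] the left side of [eps_bound] is the midpoint of
   [c ^+ 2] and [Y]. *)
pose e := (Y - c ^+ 2) / (2 * Y).
have e0 : 0 < e by rewrite divr_gt0 ?subr_gt0.
have e1 : e < 1.
  rewrite /e ltr_pdivrMr// mul1r (@le_lt_trans _ _ Y)//.
    by rewrite gerBl sqr_ge0.
  by rewrite mulr_natl mulr2n ltrDl.
have := eps_bound e e0 e1.
have -> : (1 - e) * Y = (Y + c ^+ 2) / 2 by rewrite /e; field; rewrite gt_eqF.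
lra.
Qed.

Variable A : {set X}.
Local Notation indA := (fun x : X => (x \in A)%:R : R).
Local Notation a := (set_weight pi A).
Local Notation gam := (1 - expR (- 1) : R).

Lemma set_weightE : \sum_x pi x * indA x = a.
Proof.
rewrite /set_weight [RHS]big_mkcond; apply: eq_bigr => x _.
by case: (x \in A); rewrite ?mulr1 ?mulr0.
Qed.

(** Only edges that cross the boundary of [A] contribute to the Dirichlet form, once in each
    orientation. *)
Lemma perimeter_ge (v : X -> R) (B : R) :
  (forall x y, 0 < Q x y -> `|v x - v y| <= B) ->
  dirichlet indA v <= B * perimeter Q pi A.
Proof.
move=> vB.
have perE : perimeter Q pi A = dsum (fun x y => indA x * (1 - indA y)).
  rewrite /perimeter big_mkcond; apply: eq_bigr => x _.
  case: (x \in A); last by rewrite big1// => y _; rewrite mul0r mulr0.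
  rewrite big_mkcond; apply: eq_bigr => y _.
  by case: (y \in A); rewrite /= ?subrr ?subr0 ?mulr1 ?mulr0.
have -> : B * perimeter Q pi A = 2^-1 * dsum (fun x y => B * `|indA x - indA y|).
  rewrite dsumZ perE.
  have -> : dsum (fun x y => `|indA x - indA y|) =
     dsum (fun x y => indA x * (1 - indA y)) + dsum (fun x y => indA x * (1 - indA y)).
    rewrite [X in _ + X](dsum_swap Qrev) -dsumD; apply: eq_dsum => x y.
    by case: (x \in A); case: (y \in A); rewrite /= ?subrr ?subr0 ?sub0r ?normrN ?normr0 ?normr1;
      ring.
  by field.
rewrite ler_wpM2l//; apply: ler_sum => x _; apply: ler_sum => y _.
have := Q0 x y; rewrite le_eqVlt => /predU1P[<-|Qxy]; first by rewrite !mul0r.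
apply: ler_wpM2l; first by rewrite mulr_ge0// ltW.
apply: le_trans (ler_norm _) _.
by rewrite normrM mulrC ler_wpM2r// vB.
Qed.

(** The loss of mass [m 0 - m T] in [A] is estimated from above by the gradient bound and from below
    by the spectral gap. *)
Lemma isoperimetric_time (T : R) : 0 < T -> 2 * k * T <= 1 ->
  (1 - expR (- (lam * T))) * (a * (1 - a)) <=
  perimeter Q pi A * (Num.sqrt T / Num.sqrt (Qm * gam)).
Proof.
move=> T0 kT.
have gam0 : 0 < gam.
  by rewrite subr_gt0 (le_lt_trans (@expRN1_le R))// ltr_pdivrMr// mul1r ltr_nat.
pose D := Num.sqrt (Qm * gam).
have D0 : 0 < D by rewrite sqrtr_gt0 mulr_gt0.
have D2 : D ^+ 2 = Qm * gam by rewrite sqr_sqrtr// mulr_ge0// ltW.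
(* Subtracting [1/2] halves the supremum norm and leaves gradients unchanged. *)
have [u hu u0] := heat_flow_exists Q0 (fun x => indA x - 2^-1).
have uc x : `|u 0 x| <= 2^-1.
  by rewrite u0 ler_norml; case: (x \in A) => /=; apply/andP; split; lra.
(* The bound blows up like [s ^ (-1/2)], which is integrable at [0]; its primitive is the
   [sqrt s / D] of [step1]. *)
have grad s x y : 0 < s -> s <= T -> 0 < Q x y ->
    `|u s x - u s y| <= (2 * D * Num.sqrt s)^-1.
  move=> s0 sT Qxy.
  have := edge_gradient hu (ltW s0) uc Qxy.
  set d := u s x - u s y; set J := _ / k => H.
  have Jge : 2 * gam * s <= J.
    rewrite /J ler_pdivlMr// mulNr.
    have ks : 0 <= 2 * k * s <= 1.
      apply/andP; split.
        by apply: mulr_ge0; [apply: mulr_ge0 => //; exact: ltW|exact: ltW].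
      apply: (@le_trans _ _ (2 * k * T)) => //.
        by apply: ler_wpM2l => //; apply: mulr_ge0 => //; exact: ltW.
    by have := expRN_chord ks; lra.
  have ss : 0 < Num.sqrt s by rewrite sqrtr_gt0.
  have h : d ^+ 2 * (D * Num.sqrt s) ^+ 2 <= 2^-1 ^+ 2.
    apply: le_trans H; rewrite exprMn D2 sqr_sqrtr ?(ltW s0)//.
    have -> : d ^+ 2 * (Qm * gam * s) = d ^+ 2 * (Qm / 2) * (2 * gam * s) by field.
    by apply: ler_wpM2l => //; apply: mulr_ge0; [exact: sqr_ge0|apply: divr_ge0 => //; exact: ltW].
  have h' : `|d| * (D * Num.sqrt s) <= 2^-1.
    have n0 : 0 <= `|d| * (D * Num.sqrt s).
      by apply: mulr_ge0 => //; apply: mulr_ge0; exact: ltW.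
    rewrite -(@ler_pXn2r _ 2) ?nnegrE ?invr_ge0//.
    by rewrite exprMn real_normK ?num_real.
  rewrite -mulrA invfM -ler_pdivrMr ?invr_gt0 ?mulr_gt0// invrK; exact: h'.
have c_u s x : {for s, continuous (u^~ x)} by exact: hu.1.
pose m s := ip indA (u s).
have step1 : m 0 <= m T + perimeter Q pi A / D * Num.sqrt T.
  have : m 0 + perimeter Q pi A / D * Num.sqrt 0 <= m T + perimeter Q pi A / D * Num.sqrt T.
    apply: (@derive_ge0_le _ (fun s => m s + perimeter Q pi A / D * Num.sqrt s)
      (fun s => ip indA (L (u s)) + perimeter Q pi A / D * (2 * Num.sqrt s)^-1)).
    - exact: ltW.
    - move=> s /andP[s0 _].
      have dm := is_derive_sum_fun xpredT (fun x => is_deriveZ_fun (pi x)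
        (is_deriveZ_fun (indA x) (hu.2 s x s0))).
      exact: (is_deriveD_fun dm (is_deriveZ_fun (perimeter Q pi A / D) (is_derive1_sqrt s0))).
    - move=> s _; apply: cvgD.
        apply: continuous_sum_at => x; apply: cvgM; first exact: cvg_cst.
        by apply: cvgM; [exact: cvg_cst|exact: c_u].
      by apply: cvgM; [exact: cvg_cst|exact: sqrt_continuous].
    - move=> s /andP[s0 sT].
      have := perimeter_ge (fun x y => grad s x y s0 (ltW sT)).
      rewrite (dirichletE Qrev) addrC -subr_ge0 opprK.
      have -> : (2 * D * Num.sqrt s)^-1 * perimeter Q pi A =
         perimeter Q pi A / D * (2 * Num.sqrt s)^-1.
        by field; rewrite !gt_eqF// sqrtr_gt0.
      by rewrite [X in 0 <= X -> _]addrC addrC.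
  by rewrite sqrtr0 mulr0 addr0.
(* The same flow recentred to mean zero, as the spectral gap requires. *)
pose v s x := u s x + (2^-1 - a).
have hv : heat_flow Q v by exact: heat_flowD.
have lam0 := spectral_gap_gt0 Q0 pi0 Qrev gap.
have v0E x : v 0 x = indA x - a by rewrite /v u0; ring.
have vmean0 : \sum_x v 0 x * pi x = 0.
  rewrite (eq_bigr (fun x => pi x * indA x - a * pi x)) => [|x _]; last first.
    by rewrite v0E; ring.
  by rewrite sumrB -mulr_sumr pi1 set_weightE mulr1 subrr.
have vmean s : 0 <= s -> \sum_x v s x * pi x = 0.
  by move=> s0; rewrite (heat_flow_mean Qrev hv s0).
pose N s := ip (v s) (v s).
have N0 : N 0 = a * (1 - a).
  rewrite /N /weighted_ip (eq_bigr (fun x => pi x * indA x * (1 - 2 * a) + a ^+ 2 * pi x)).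
    by rewrite big_split/= -mulr_suml -mulr_sumr pi1 set_weightE; ring.
  by move=> x _; rewrite v0E; case: (x \in A) => /=; ring.
have NT : N T <= expR (- (lam * T)) ^+ 2 * N 0.
  have : - (expR (2 * lam * 0) * N 0) <= - (expR (2 * lam * T) * N T).
    apply: (@derive_ge0_le _ (fun s => - (expR (2 * lam * s) * N s))
      (fun s => - (expR (2 * lam * s) * (2 * ip (v s) (L (v s)))
         + expR (2 * lam * s) * (2 * lam) * N s))).
    - exact: ltW.
    - move=> s /andP[s0 _].
      have dE := is_derive_scale (is_derive_expR (2 * lam * s)).
      have dN : is_derive s 1 N (2 * ip (v s) (L (v s))).
        have d1 := is_derive_sum_fun xpredT (fun x => is_deriveZ_fun (pi x)
          (is_deriveM_fun (hv.2 s x s0) (hv.2 s x s0))).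
        apply: (is_derive_eq d1); rewrite /weighted_ip mulr_sumr.
        by apply: eq_bigr => x _; ring.
      exact: is_deriveN (is_deriveM_fun dE dN).
    - move=> s _; apply: cvgN; apply: cvgM.
        exact: is_derive_continuous (is_derive_scale (is_derive_expR (2 * lam * s))).
      apply: continuous_sum_at => x; apply: cvgM; first exact: cvg_cst.
      exact: (cvgM (hv.1 x s) (hv.1 x s)).
    - move=> s /andP[s0 _].
      have := poincare Q0 pi0 pi1 Qrev Qirr gap (vmean s (ltW s0)).
      rewrite (dirichletE Qrev) -/(N s) => H.
      rewrite oppr_ge0 -[_ * _ * N s]mulrA -mulrDr mulr_ge0_le0 ?expR_ge0//; lra.
  rewrite mulr0 expR0 mul1r lerN2 => H.
  have EE : expR (2 * lam * T) * expR (- (lam * T)) ^+ 2 = 1.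
    by rewrite -expRM_natl -expRD -[RHS]expR0; congr expR; ring.
  by rewrite -(ler_pM2l (expR_gt0 (2 * lam * T))) mulrA EE mul1r.
have cross : ip indA (v T) = m T + (2^-1 - a) * a.
  rewrite /m -[X in _ = _ + _ * X]set_weightE mulr_sumr -big_split; apply: eq_bigr => x _ /=.
  by rewrite /v; ring.
have m0 : m 0 = a / 2.
  rewrite /m /weighted_ip -set_weightE mulr_suml; apply: eq_bigr => x _.
  by rewrite u0; case: (x \in A) => /=; field.
have ipv0 : ip (v 0) (v T) = ip indA (v T).
  rewrite /weighted_ip; under eq_bigr => x _ do rewrite v0E mulrBl mulrBr.
  rewrite sumrB [X in _ - X](_ : _ = a * \sum_x v T x * pi x).
    by rewrite vmean ?ltW// mulr0 subr0.
  by rewrite mulr_sumr; apply: eq_bigr => x _; ring.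
set E := expR (- (lam * T)) in NT *.
have E0 : 0 < E by exact: expR_gt0.
(* Cauchy-Schwarz with the decay of [N] built in: expand the squared norm of [v T - E * v 0]. *)
have CS : ip (v 0) (v T) <= E * N 0.
  have := ip_ge0 pi0 (fun x => v T x + (- E) * v 0 x); rewrite ip_lin -/(N T) -/(N 0).
  have -> : ip (v T) (v 0) = ip (v 0) (v T).
    by apply: eq_bigr => x _; rewrite [v T x * _]mulrC.
  move=> h; rewrite -(ler_pM2l E0); nra.
move: CS; rewrite ipv0 cross N0 => CS.
have -> : perimeter Q pi A * (Num.sqrt T / D) = perimeter Q pi A / D * Num.sqrt T.
  by field; rewrite gt_eqF.
move: step1; rewrite m0; nra.
Qed.

Lemma isoperimetric_min :
  3^-1 * Num.sqrt Qm * Num.min (lam / Num.sqrt k) (Num.sqrt lam) * (a * (1 - a))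
  <= perimeter Q pi A.
Proof.
have lam0 := spectral_gap_gt0 Q0 pi0 Qrev gap.
have gamE : 61 / 100 <= gam by have := @expRN1_le R; lra.
have gam0 : 0 < gam by lra.
have sgam : 78 / 100 <= Num.sqrt gam.
  rewrite -(@ler_pXn2r _ 2) ?nnegrE ?sqrtr_ge0// sqr_sqrtr ?(ltW gam0)//.
  by apply: le_trans gamE; rewrite expr2; lra.
have a0 : 0 <= a by rewrite /set_weight sumr_ge0// => x _; exact: ltW.
have a1 : 0 <= 1 - a.
  rewrite -pi1 -set_weightE -sumrB sumr_ge0// => x _.
  by case: (x \in A) => /=; rewrite ?mulr1 ?mulr0 ?subrr ?subr0// ltW.
have V0 : 0 <= a * (1 - a) by exact: mulr_ge0.
have sQ0 : 0 < Num.sqrt Qm by rewrite sqrtr_gt0.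
have sl0 : 0 < Num.sqrt lam by rewrite sqrtr_gt0.
have sk0 : 0 < Num.sqrt k by rewrite sqrtr_gt0.
set V := a * (1 - a) in V0 *.
have gg : 17 / 36 <= gam * Num.sqrt gam.
  by apply: le_trans (ler_pM _ _ gamE sgam); rewrite //; lra.
have sD : Num.sqrt (Qm * gam) = Num.sqrt Qm * Num.sqrt gam by rewrite sqrtrM// ltW.
have sg0 : 0 < Num.sqrt gam by rewrite sqrtr_gt0.
(* By the chord bound, [1 - expR (- (lam * T)) >= gam * c] for every [c] in [[0, 1]] below
   [lam * T]; so the mass estimate becomes linear in [c]. *)
have final (T c : R) : 0 < T -> 2 * k * T <= 1 -> c <= lam * T -> 0 <= c ->
    c <= 1 -> Num.sqrt Qm * (gam * Num.sqrt gam) * (c / Num.sqrt T) * V <= perimeter Q pi A.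
  move=> T0 kT cT c0 c1.
  have H := isoperimetric_time T0 kT; rewrite -/V sD in H.
  have sT : 0 < Num.sqrt T by rewrite sqrtr_gt0.
  have h1 : gam * c * V <= perimeter Q pi A * (Num.sqrt T / (Num.sqrt Qm * Num.sqrt gam)).
    apply: le_trans H; rewrite ler_wpM2r//.
    apply: le_trans (expRN_chord _) _; first by rewrite c0.
    by rewrite lerD2l lerN2 ler_expR lerN2.
  rewrite -ler_pdivrMr ?divr_gt0 ?mulr_gt0// in h1.
  apply: le_trans h1; rewrite le_eqVlt; apply/orP; left; apply/eqP.
  by field; rewrite !gt_eqF.
have pre (z : R) : 0 <= z -> Num.min (lam / Num.sqrt k) (Num.sqrt lam) <= z * (3 * (gam * Num.sqrt gam)) ->
   Num.sqrt Qm * (gam * Num.sqrt gam) * z * V <= perimeter Q pi A ->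
   3^-1 * Num.sqrt Qm * Num.min (lam / Num.sqrt k) (Num.sqrt lam) * V <= perimeter Q pi A.
  move=> z0 zle; apply: le_trans; apply: ler_wpM2r => //.
  apply: (@le_trans _ _ (3^-1 * Num.sqrt Qm * (z * (3 * (gam * Num.sqrt gam))))).
    by apply: ler_wpM2l => //; apply: mulr_ge0 => //; exact: ltW.
  by rewrite le_eqVlt; apply/orP; left; apply/eqP; field.
(* First [T = 1 / lam] with [c = 1], then [T = 1 / (2 * k)] with [c = lam / (2 * k)]. *)
have [kl|lk] := leP (2 * k) lam.
  apply: (pre (1 / Num.sqrt lam^-1)); last first.
  - apply: final => //; rewrite ?invr_gt0 ?ler_pdivrMr ?mul1r ?mulfV ?gt_eqF//.
  - rewrite ge_min; apply/orP; right; rewrite sqrtrV ?(ltW lam0)// div1r invrK ler_peMr ?(ltW sl0)//.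
    by lra.
  - by rewrite divr_ge0// sqrtr_ge0.
have T0 : 0 < (2 * k)^-1 by rewrite invr_gt0 mulr_gt0.
apply: (pre (lam / (2 * k) / Num.sqrt (2 * k)^-1)); last first.
- apply: final => //; rewrite ?mulfV ?gt_eqF ?mulr_gt0//.
    by rewrite divr_ge0 ?mulr_ge0// ltW.
  by rewrite ler_pdivrMr ?mulr_gt0// mul1r ltW.
- rewrite ge_min; apply/orP; left.
  (* Matches [gg]: three times [17/36] is [17/12]. *)
  have s2 : Num.sqrt 2 <= 17 / 12 :> R.
    rewrite -(@ler_pXn2r _ 2) ?nnegrE ?sqrtr_ge0// sqr_sqrtr//.
    by rewrite expr2; lra.
  have s20 : 0 < Num.sqrt 2 :> R by rewrite sqrtr_gt0.
  have -> : lam / (2 * k) / Num.sqrt (2 * k)^-1 * (3 * (gam * Num.sqrt gam)) =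
     lam / Num.sqrt k * (3 * (gam * Num.sqrt gam) / Num.sqrt 2).
    rewrite sqrtrV ?mulr_ge0 ?ltW// invrK sqrtrM//.
    have -> : 2 * k = Num.sqrt 2 ^+ 2 * Num.sqrt k ^+ 2 by rewrite !sqr_sqrtr// ltW.
    by field; rewrite !gt_eqF.
  rewrite ler_peMr ?divr_ge0 ?(ltW lam0) ?(ltW sk0)// ler_pdivlMr// mul1r.
  by apply: le_trans s2 _; lra.
- by rewrite !divr_ge0 ?mulr_ge0 ?sqrtr_ge0// ltW.
Qed.

End Isoperimetry.

(** Some weight is positive, and detailed balance carries positivity along every edge. *)
Lemma reversible_gt0 (R : realType) (X : finType) (Q : X -> X -> R) (pi : X -> R) :
  irreducible Q -> probability_weights pi -> reversible Q pi ->
  forall x, 0 < pi x.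
Proof.
move=> Qirr [pi0 pi1] Qrev.
have [z z0] : exists z, 0 < pi z.
  apply: contrapT => /forallNP h; move: pi1.
  rewrite big1 => [/esym /eqP|z _]; first by rewrite oner_eq0.
  by apply/eqP; rewrite eq_le pi0 andbT leNgt; apply/negP/h.
move=> x; have /connectP[p] := Qirr z x.
elim: p z z0 => [z z0 _ ->//|y p IH z z0 /= /andP[zy yp] xl].
apply: IH yp xl; rewrite lt_neqAle pi0 andbT; apply/eqP => y0.
by have := mulr_gt0 zy z0; rewrite Qrev -y0 mulr0 ltxx.
Qed.

Theorem theorem4p1 (R : realType) (X : finType) (hX : (1 < #|X|)%N)
    (Q : X -> X -> R) (pi : X -> R)
    (hQ : transition_rates Q) (hirr : irreducible Q)
    (hpi : probability_weights pi) (hstat : stationary Q pi)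
    (hrev : reversible Q pi)
    (kappa : R) (hRic : entropic_Ric_ge Q pi kappa)
    (lambda1 : R) (hlambda1 : spectral_gap Q lambda1)
    (Qmin : R) (hQmin : min_rate Q Qmin)
    (A : {set X}) :
  3^-1 * Num.sqrt Qmin * isoperimetric_rate kappa lambda1 *
    (set_weight pi A * (1 - set_weight pi A)) <= perimeter Q pi A.
Proof.
have [Q0 Qxx] := hQ; have pi1 := hpi.2.
have pi0 := reversible_gt0 hirr hpi hrev.
have [[Qmin0 _] Qmin_lb] := hQmin.
have Qmin_le x y : 0 < Q x y -> Qmin <= Q x y.
  by move=> Qxy; apply: Qmin_lb; split => //; exists x, y.
have lam0 := spectral_gap_gt0 Q0 pi0 hrev hlambda1.
have min_case k : 0 < k -> - k <= kappa ->
    3^-1 * Num.sqrt Qmin * Num.min (lambda1 / Num.sqrt k) (Num.sqrt lambda1) *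
      (set_weight pi A * (1 - set_weight pi A)) <= perimeter Q pi A.
  move=> k0 kk.
  apply: (isoperimetric_min Q0 Qxx pi0 pi1 hrev hirr k0 _ hlambda1 Qmin0 Qmin_le).
  move=> rho psi rho0 rho1.
  have B := bochner Q0 pi0 pi1 hrev hRic psi rho0 rho1.
  apply: le_trans B.
  apply: ler_wpM2r kk; apply: grad_form_ge0 => // x; exact: ltW.
rewrite /isoperimetric_rate; have [kappa0|kappa0] := eqVneq kappa 0.
  (* Zero curvature is in particular at least [- lambda1]; for [k = lambda1] both entries of the
     minimum equal the square root of [lambda1]. *)
  have sl0 : 0 < Num.sqrt lambda1 by rewrite sqrtr_gt0.
  have := min_case lambda1 lam0; rewrite kappa0 oppr_le0 => /(_ (ltW lam0)).
  have -> : lambda1 / Num.sqrt lambda1 = Num.sqrt lambda1.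
    by apply: (canLR (mulfK _)); rewrite ?gt_eqF// -expr2 sqr_sqrtr ?ltW.
  by rewrite minxx.
by apply: min_case; rewrite ?normr_gt0// lerNl -normrN ler_norm.
Qed.
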